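(* Let $n\ge 3$, let $U\subset\mathbb{R}^n$ be a domain and suppose $f:U\to Cl_n$ is a weak solution to the $n$-Dirac equation $D\|f\|^{n-2}f=0$ on $U$. Suppose also that $y=M(x)=(ax+b)(cx+d)^{-1}$ is a Möbius transformation (with $a,b,c,d\in Cl_n$ satisfying the conditions (i)-(iii) of the context) such that $cx+d$ is non-zero on the closure of $M^{-1}(U)$. Then the function $x\mapsto (cx+d)^{-1}f(M(x))$ is a weak solution to the $n$-Dirac equation on $M^{-1}(U)$.
   Context: $Cl_n$ is the real associative Clifford algebra of dimension $2^n$ generated by an orthonormal basis $e_1,\dots,e_n$ of $\mathbb{R}^n\subset Cl_n$ with $e_ie_j+e_je_i=-2\delta_{ij}$ (so $x^2=-\|x\|^2$ for $x\in\mathbb{R}^n$). A basis of $Cl_n$ is given by $1$ and the products $e_{j_1}\cdots e_{j_r}$, $j_1<\dots<j_r$, $1\le r\le n$; $\|A\|$ is the Euclidean norm of the coefficients of $A\in Cl_n$ in this basis. Reversion $A\mapsto\tilde A$ is the linear anti-automorphism with $e_{j_1}\cdots e_{j_r}\mapsto e_{j_r}\cdots e_{j_1}$; conjugation $A\mapsto\overline{A}$ is the linear anti-automorphism with $e_{j_1}\cdots e_{j_r}\mapsto(-1)^re_{j_r}\cdots e_{j_1}$. The Dirac operator is $D=\sum_{j=1}^n e_j\frac{\partial}{\partial x_j}$, acting from the left on $Cl_n$-valued functions. A $Cl_n$-valued test function on an open set has components in $C_0^\infty$ of that set. A function $f:U\to Cl_n$ is a weak solution to the $n$-Dirac equation on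 $U$ if each component of $f$ is in $L^n_{loc}(U)$ and $\int_U \overline{\|f\|^{n-2}f}\,D\eta\,dx^n=0$ for every $Cl_n$-valued test function $\eta$ on $U$. Möbius transformations of $\mathbb{R}^n\cup\{\infty\}$ are written as $M(x)=(ax+b)(cx+d)^{-1}$ with $a,b,c,d\in Cl_n$ such that (i) $a,b,c,d$ are all products of vectors of $\mathbb{R}^n$; (ii) $\tilde a c,\ \tilde c d,\ \tilde d b,\ \tilde b a\in\mathbb{R}^n$; (iii) $\tilde a d-\tilde c b=1$. For $x\in\mathbb{R}^n$ with $cx+d\neq0$, $cx+d$ is a product of non-zero vectors, hence invertible in $Cl_n$. $M^{-1}(U)$ denotes $\{x\in\mathbb{R}^n: cx+d\ne 0,\ M(x)\in U\}$. *)

(* Defs.v *)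
From HB Require Import structures.
From mathcomp Require Import all_boot all_order all_algebra falgebra.
Set Implicit Arguments. Unset Strict Implicit. Unset Printing Implicit Defensive.
Import Order.TTheory GRing.Theory Num.Theory.
Local Open Scope ring_scope.

(* The Clifford algebra Cl_n over a field: a multivector is its family of       *)
(* coefficients in the basis e_A (A a subset of {0, ..., n-1}), where e_A is    *)
(* the product of the e_i (i in A) in increasing order (clbasis_prod below).    *)
(* The library's algebra structures are attached to it, so that `*', `*:', 1    *)
(* and `^-1' are the Clifford product, scaling, unit and inverse.               *)
Definition Cl (R : fieldType) (n : nat) : Type := {ffun {set 'I_n} -> R^o}.

Section CliffordAlgebra.
Variables (R : fieldType) (n : nat).
Implicit Types (A B C : {set 'I_n}) (a b c : Cl R n).

HB.instance Definition _ := Vector.copy (Cl R n) {ffun {set 'I_n} -> R^o}.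

Definition clcoef a A : R := (a : {ffun {set 'I_n} -> R^o}) A.
Definition clbasis A : Cl R n := [ffun B => (B == A)%:R].
Definition clsymd A B : {set 'I_n} := (A :\: B) :|: (B :\: A).
Definition clinv A B : nat := #|[set p in setX A B | (p.2 <= p.1)%N]|.
(* e_A e_B = (-1)^k e_C, C the symmetric difference of A and B and k the number *)
(* of (i, j) in A x B with j <= i: each such pair with j < i costs a             *)
(* transposition of anticommuting generators, each common index a square -1.    *)
Definition clmul a b : Cl R n :=
  \sum_A \sum_B
    (clcoef a A * clcoef b B * (-1) ^+ clinv A B) *: clbasis (clsymd A B).

Lemma clcoefE a : a = \sum_A clcoef a A *: clbasis A.
Proof.
apply/ffunP => C; rewrite sum_ffunE (bigD1 C) //= big1 => [|A neAC].
  by rewrite !ffunE eqxx addr0 [RHS]mulr1.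
by rewrite !ffunE eq_sym (negPf neAC) [LHS]mulr0.
Qed.

Lemma clcoef_basis A B : clcoef (clbasis A) B = (B == A)%:R.
Proof. exact: ffunE. Qed.

Lemma clcoefD a b A : clcoef (a + b) A = clcoef a A + clcoef b A.
Proof. exact: ffunE. Qed.

Lemma clcoefZ (k : R) a A : clcoef (k *: a) A = k * clcoef a A.
Proof. exact: ffunE. Qed.

Fact clmulDl : left_distributive clmul +%R.
Proof.
move=> a b c; rewrite /clmul -big_split; apply: eq_bigr => A _ /=.
rewrite -big_split; apply: eq_bigr => B _ /=.
by rewrite -scalerDl clcoefD !mulrDl.
Qed.

Fact clmulDr : right_distributive clmul +%R.
Proof.
move=> a b c; rewrite /clmul -big_split; apply: eq_bigr => A _ /=.
rewrite -big_split; apply: eq_bigr => B _ /=.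
by rewrite -scalerDl clcoefD mulrDr !mulrDl.
Qed.

Fact clmulZl k a b : k *: clmul a b = clmul (k *: a) b.
Proof.
rewrite /clmul scaler_sumr; apply: eq_bigr => A _ /=.
rewrite scaler_sumr; apply: eq_bigr => B _ /=.
by rewrite scalerA clcoefZ !mulrA.
Qed.

Fact clmulZr k a b : k *: clmul a b = clmul a (k *: b).
Proof.
rewrite /clmul scaler_sumr; apply: eq_bigr => A _ /=.
rewrite scaler_sumr; apply: eq_bigr => B _ /=.
by rewrite scalerA clcoefZ !mulrA [k * _]mulrC.
Qed.

Lemma clmul_basis A B :
  clmul (clbasis A) (clbasis B) = (-1) ^+ clinv A B *: clbasis (clsymd A B).
Proof.
rewrite /clmul (big_only1 A) //= => [|A' neA _]; last first.
  by rewrite big1 // => B' _; rewrite clcoef_basis (negPf neA) !mul0r scale0r.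
rewrite (big_only1 B) //= => [|B' neB _]; last first.
  by rewrite [clcoef _ B']clcoef_basis (negPf neB) mulr0 mul0r scale0r.
by rewrite !clcoef_basis !eqxx !mul1r.
Qed.

Fact clmul0r a : clmul 0 a = 0.
Proof. by have := clmulZl 0 0 a; rewrite !scale0r. Qed.

Fact clmulr0 a : clmul a 0 = 0.
Proof. by have := clmulZr 0 a 0; rewrite !scale0r. Qed.

Lemma clmul_suml (I : finType) (F : I -> Cl R n) b :
  clmul (\sum_i F i) b = \sum_i clmul (F i) b.
Proof. by apply: (big_morph (clmul^~ b)) => [x y|]; rewrite ?clmulDl ?clmul0r. Qed.

Lemma clmul_sumr (I : finType) (F : I -> Cl R n) b :
  clmul b (\sum_i F i) = \sum_i clmul b (F i).
Proof. by apply: (big_morph (clmul b)) => [x y|]; rewrite ?clmulDr ?clmulr0. Qed.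

Lemma clsymdA : associative clsymd.
Proof.
by move=> A B C; apply/setP => i; rewrite !inE; do 3!case: (i \in _).
Qed.

Lemma clinvE A B : clinv A B = (\sum_(i in A) #|[set j in B | (j <= i)%N]|)%N.
Proof.
rewrite /clinv -sum1dep_card.
rewrite (eq_bigl (fun p => (p.1 \in A) && (p.2 \in [set j in B | (j <= p.1)%N]))).
  rewrite -(pair_big_dep (mem A) (fun i j => j \in [set j in B | (j <= i)%N])
    (fun _ _ => 1%N)).
  by apply: eq_bigr => i _; rewrite sum1_card.
by move=> [i j]; rewrite !inE andbA.
Qed.

Lemma odd_clsymd (P : pred 'I_n) A B :
  odd #|[set j in clsymd A B | P j]| =
  odd #|[set j in A | P j]| (+) odd #|[set j in B | P j]|.
Proof.
have -> : [set j in clsymd A B | P j] =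
    clsymd [set j in A | P j] [set j in B | P j].
  by apply/setP => i; rewrite !inE; do 2!case: (i \in _); case: (P i).
move: [set _ in A | _] [set _ in B | _] => {}A {}B.
rewrite /clsymd cardsU (_ : _ :&: _ = set0) ?cards0 ?subn0; last first.
  by apply/setP => i; rewrite !inE; do 2!case: (i \in _).
rewrite -(cardsID B A) -(cardsID A B) [B :&: A]setIC !oddD.
by case: (odd #|A :&: B|); case: (odd _); case: (odd _).
Qed.

Lemma odd_clinvr A B C :
  odd (clinv A (clsymd B C)) = odd (clinv A B) (+) odd (clinv A C).
Proof.
rewrite !clinvE; elim/big_rec3: _ => //= i x y z _ ih.
by rewrite !oddD ih odd_clsymd; do 4!case: (odd _).
Qed.

Lemma clinvE' A B : clinv A B = (\sum_(j in B) #|[set i in A | (j <= i)%N]|)%N.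
Proof.
rewrite clinvE; under eq_bigr do rewrite -sum1dep_card.
rewrite (exchange_big_dep (mem B)) /= => [|i j _ /andP[]//].
apply: eq_bigr => j jB; rewrite -sum1dep_card.
by apply: eq_bigl => i; rewrite jB.
Qed.

Lemma odd_clinvl A B C :
  odd (clinv (clsymd A B) C) = odd (clinv A C) (+) odd (clinv B C).
Proof.
rewrite !clinvE'; elim/big_rec3: _ => //= i x y z _ ih.
by rewrite !oddD ih odd_clsymd; do 4!case: (odd _).
Qed.

Fact clmulA : associative clmul.
Proof.
move=> a b c; rewrite (clcoefE a) !clmul_suml; apply: eq_bigr => A _.
rewrite (clcoefE b) !(clmul_suml, clmul_sumr); apply: eq_bigr => B _.
rewrite (clcoefE c) !clmul_sumr; apply: eq_bigr => C _.
rewrite -!clcoefE -!(clmulZl, clmulZr) !clmul_basis.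
rewrite !scalerA clsymdA; congr (_ *: _).
rewrite -!mulrA; congr (_ * (_ * _)).
rewrite [RHS]mulrCA; congr (_ * _).
rewrite -!exprD.
rewrite -[LHS]signr_odd -[RHS]signr_odd !oddD odd_clinvr odd_clinvl.
by rewrite [in RHS]addbA [in RHS]addbC.
Qed.

Definition clunit : Cl R n := clbasis set0.

Fact clmul1r : left_id clunit clmul.
Proof.
move=> a; rewrite [in RHS](clcoefE a) {1}(clcoefE a) clmul_sumr.
apply: eq_bigr => A _; rewrite -clmulZr clmul_basis clinvE big_set0 scale1r.
by congr (_ *: clbasis _); apply/setP => i; rewrite !inE; case: (i \in A).
Qed.

Fact clmulr1 : right_id clunit clmul.
Proof.
move=> a; rewrite [in RHS](clcoefE a) {1}(clcoefE a) clmul_suml.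
apply: eq_bigr => A _; rewrite -clmulZl clmul_basis clinvE' big_set0 scale1r.
by congr (_ *: clbasis _); apply/setP => i; rewrite !inE; case: (i \in A).
Qed.

Fact clunit_neq0 : clunit != 0.
Proof.
apply/eqP => /(congr1 (clcoef^~ set0)); rewrite clcoef_basis eqxx /clcoef ffunE.
by apply/eqP; rewrite oner_eq0.
Qed.

HB.instance Definition _ := GRing.Zmodule_isNzRing.Build (Cl R n)
  clmulA clmul1r clmulr1 clmulDl clmulDr clunit_neq0.
HB.instance Definition _ := GRing.Lmodule_isLalgebra.Build R (Cl R n) clmulZl.
HB.instance Definition _ := GRing.Lalgebra_isAlgebra.Build R (Cl R n) clmulZr.
HB.instance Definition _ := Algebra_isFalgebra.Build R (Cl R n).

Definition clgen (i : 'I_n) : Cl R n := clbasis [set i].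

Lemma clinv1l i B : clinv [set i] B = #|[set j in B | (j <= i)%N]|.
Proof. by rewrite clinvE big_set1. Qed.

Lemma clgenM i j : clgen i * clgen j + clgen j * clgen i = (- (i == j)%:R) *+ 2.
Proof.
have E (k l : 'I_n) : clgen k * clgen l =
    (-1) ^+ (l <= k)%N *: clbasis (clsymd [set k] [set l]).
  rewrite -[LHS]/(clmul _ _) clmul_basis clinv1l; congr ((-1) ^+ _ *: _).
  case: leqP => kl; last first.
    apply: eq_card0 => m; rewrite !inE.
    by apply/negP => /andP[/eqP->]; rewrite leqNgt kl.
  by apply: (@eq_card1 _ l) => m; rewrite !inE; case: eqP => //= ->.
rewrite !{}E; case: eqVneq => [->|neij].
  rewrite leqnn expr1 scaleN1r -mulr2n; congr (- _ *+ 2).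
  by congr clbasis; apply/setP => k; rewrite !inE; case: eqP.
have -> : clsymd [set j] [set i] = clsymd [set i] [set j].
  by rewrite /clsymd setUC.
rewrite -scalerDl oppr0 mul0rn.
have : (i : nat) != j by [].
by case: ltngtP => //= _ _; rewrite ?expr0 ?expr1 (subrr, addNr) scale0r.
Qed.

Lemma clbasis_prod A : clbasis A = \prod_(i <- enum A) clgen i.
Proof.
have srt : sorted (fun i j : 'I_n => (i < j)%N) (enum A).
  rewrite {1}/enum_mem -enumT; apply: sorted_filter => [i j k|]; first exact: ltn_trans.
  by have := iota_ltn_sorted 0 n; rewrite -val_enum_ord sorted_map.
have -> : A = [set i in enum A] by apply/setP => i; rewrite inE mem_enum.
rewrite [in RHS](_ : [set i in enum A] = A); last first.
  by apply/setP => i; rewrite inE mem_enum.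
elim: (enum A) srt => [_|i s ih /=].
  by rewrite big_nil; congr clbasis; apply/setP => i; rewrite !inE.
rewrite path_sortedE => [/andP[/allP lti srt]|? ? ?]; last exact: ltn_trans.
rewrite big_cons -ih // -[RHS]/(clmul _ _) clmul_basis clinv1l.
rewrite (_ : #|_| = 0%N) ?expr0 ?scale1r; last first.
  apply: eq_card0 => j; rewrite !inE; apply/negP => /andP[/lti ij].
  by rewrite leqNgt ij.
congr clbasis; apply/setP => j; rewrite !inE.
by case: eqVneq => [->|_] /=; case: (boolP (_ \in s)) => //= /lti; rewrite ?ltnn.
Qed.

Definition clvec (x : 'rV[R]_n) : Cl R n := \sum_i x ord0 i *: clgen i.
Definition clvec_part a : 'rV[R]_n := \row_i clcoef a [set i].

Lemma clvecK : cancel clvec clvec_part.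
Proof.
move=> x; apply/rowP => i; rewrite mxE.
have -> : clcoef (clvec x) [set i] = \sum_j x ord0 j * clcoef (clgen j) [set i].
  by rewrite /clcoef sum_ffunE; apply: eq_bigr => j _; rewrite ffunE.
rewrite (big_only1 i) //= => [|j neji _]; rewrite clcoef_basis ?eqxx ?mulr1 //.
by rewrite (inj_eq set1_inj) eq_sym (negPf neji) mulr0.
Qed.

Definition is_clvec a : Prop := exists v, a = clvec v.
Definition is_vector_product a : Prop :=
  exists s : seq 'rV[R]_n, a = \prod_(v <- s) clvec v.

Definition clrev a : Cl R n :=
  \sum_A clcoef a A *: \prod_(i <- rev (enum A)) clgen i.
Definition clconj a : Cl R n :=
  \sum_A clcoef a A *: ((-1) ^+ #|A| *: \prod_(i <- rev (enum A)) clgen i).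

End CliffordAlgebra.

Definition clnorm (R : rcfType) (n : nat) (a : Cl R n) : R :=
  Num.sqrt (\sum_A clcoef a A ^+ 2).

Section Mobius.
Variables (R : fieldType) (n : nat).
Implicit Types (a b c d : Cl R n) (x : 'rV[R]_n).

Definition mobius_coefficients a b c d : Prop :=
  [/\ [/\ is_vector_product a, is_vector_product b,
          is_vector_product c & is_vector_product d],
      [/\ is_clvec (clrev a * c), is_clvec (clrev c * d),
          is_clvec (clrev d * b) & is_clvec (clrev b * a)]
    & clrev a * d - clrev c * b = 1].

Definition mobius_den c d x : Cl R n := c * clvec x + d.

Definition mobius a b c d x : Cl R n :=
  (a * clvec x + b) * (mobius_den c d x)^-1.

End Mobius.

From mathcomp Require Import all_classical all_reals all_analysis.
Import numFieldNormedType.Exports.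
Local Open Scope classical_set_scope.

(* Row vectors carry the product sigma-algebra of their coordinates. *)
Section MeasurableRow.
Context {d} {T : measurableType d} (n : nat).

Let coors (i : 'I_n) (x : 'rV[T]_n) : T := x ord0 i.

Let row_set0 : g_sigma_preimage coors set0.
Proof. exact: sigma_algebra0. Qed.

Let row_setC A : g_sigma_preimage coors A -> g_sigma_preimage coors (~` A).
Proof. exact: sigma_algebraC. Qed.

Let row_bigcup (F : _^nat) : (forall i, g_sigma_preimage coors (F i)) ->
  g_sigma_preimage coors (\bigcup_i (F i)).
Proof. exact: sigma_algebra_bigcup. Qed.

HB.instance Definition _ := @isMeasurable.Build (measure_tuple_display d)
  'rV[T]_n (g_sigma_preimage coors) row_set0 row_setC row_bigcup.

End MeasurableRow.

Lemma measurable_fun_rowP d1 d2 (T1 : measurableType d1) (T2 : measurableType d2)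
    n (f : T1 -> 'rV[T2]_n) :
  measurable_fun [set: T1] f <->
  forall i, measurable_fun [set: T1] (fun x => f x ord0 i).
Proof.
apply: (@iff_trans _ (g_sigma_preimage
    (fun i => (fun x : 'rV[T2]_n => x ord0 i) \o f) `<=` measurable)).
  rewrite g_sigma_preimage_comp; split=> [mf A [/= C preC <-]|prefS].
    exact: mf.
  by move=> _ A mA; apply: prefS; exists A.
split=> [fS i|mf].
- move=> _ A mA.
  apply: fS; apply: sub_sigma_algebra.
  case: n i => [[] []//|n i] in f *.
  rewrite -bigcup_mkord_ord.
  exists i; first exact: ltn_ord.
  by exists A => //; rewrite inord_val.
- apply: smallest_sub; first exact: sigma_algebra_measurable.
  case: n => [|n] in f mf *; first by rewrite big_ord0.
  rewrite -bigcup_mkord_ord; apply: bigcup_sub => i Ii.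
  by move=> A [B mB <-]; exact: mf.
Qed.

Section LebesgueRow.
Context {R : realType}.
Local Open Scope ereal_scope.

Definition row_cons n (p : R * 'rV[R]_n) : 'rV[R]_n.+1 :=
  row_mx (const_mx p.1 : 'rV_1) p.2.
Definition row_uncons n (v : 'rV[R]_n.+1) : R * 'rV[R]_n :=
  (v ord0 ord0, rsubmx (v : 'rV_(1 + n))).

Lemma row_cons0 n p : @row_cons n p ord0 ord0 = p.1.
Proof.
have -> : (ord0 : 'I_n.+1) = lshift n (ord0 : 'I_1) by exact: val_inj.
exact: etrans (row_mxEl _ _ _ _) (mxE _ _ _ _).
Qed.

Lemma row_consS n p i : @row_cons n p ord0 (lift ord0 i) = p.2 ord0 i.
Proof.
have -> : lift ord0 i = rshift 1 i by exact: val_inj.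
exact: row_mxEr.
Qed.

Lemma row_consK n : cancel (@row_cons n) (@row_uncons n).
Proof.
move=> [x v]; congr pair; last exact: row_mxKr.
exact: row_cons0.
Qed.

Lemma measurable_row_cons n : measurable_fun [set: R * 'rV[R]_n] (@row_cons n).
Proof.
apply/measurable_fun_rowP => i; have [j ->|->] := unliftP ord0 i; last first.
  rewrite (_ : (fun _ => _) = fst); first exact: measurable_fst.
  by apply/funext => p; rewrite row_cons0.
have -> : (fun p : R * 'rV[R]_n => row_cons p ord0 (lift ord0 j)) =
    fun p => p.2 ord0 j.
  by apply/funext => p; rewrite row_consS.
have /measurable_fun_rowP : measurable_fun [set: R * 'rV[R]_n] snd by [].
exact.
Qed.

Lemma measurable_row_uncons n : measurable_fun [set: 'rV[R]_n.+1] (@row_uncons n).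
Proof.
have /measurable_fun_rowP mid := @measurable_id _ 'rV[R]_n.+1 setT.
apply: measurable_fun_pair => /=; first exact: mid.
apply/measurable_fun_rowP => i; under eq_fun do rewrite mxE.
exact: mid.
Qed.

Section Cons.
Variables (n : nat) (mu : {sigma_finite_measure set 'rV[R]_n -> \bar R}).

Definition cons_measure : set 'rV[R]_n.+1 -> \bar R :=
  pushforward (@lebesgue_measure R \x mu) (@row_cons n).

Let preim_mes A : measurable A -> measurable (@row_cons n @^-1` A).
Proof. by move=> mA; rewrite -[X in measurable X]setTI; exact: measurable_row_cons. Qed.

Let cons_measure0 : cons_measure set0 = 0.
Proof. by rewrite /cons_measure /pushforward preimage_set0 measure0. Qed.

Let cons_measure_ge0 A : 0 <= cons_measure A.
Proof. by rewrite /cons_measure /pushforward measure_ge0. Qed.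

Let cons_measure_sigma_additive : semi_sigma_additive cons_measure.
Proof.
move=> F mF tF mUF; rewrite /cons_measure /pushforward preimage_bigcup.
apply: measure_semi_sigma_additive.
- by move=> k; exact: preim_mes.
- apply/trivIsetP => /= i j _ _ ij; rewrite -preimage_setI.
  by move/trivIsetP : tF => /(_ _ _ _ _ ij) ->//; rewrite preimage_set0.
- by rewrite -preimage_bigcup; exact: preim_mes.
Qed.

HB.instance Definition _ := isMeasure.Build _ _ _ cons_measure
  cons_measure0 cons_measure_ge0 cons_measure_sigma_additive.

Let cons_measure_sigma_finite : sigma_finite setT cons_measure.
Proof.
have [F FT Ffin] : sigma_finite setT (@lebesgue_measure R \x mu).
  have /sigma_finiteP[F [TF ndF Foo]] := sigma_finiteT (@lebesgue_measure R).
  have /sigma_finiteP[G [TG ndG Goo]] := sigma_finiteT mu.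
  exists (fun k => F k `*` G k).
   rewrite -setXTT TF TG predeqE => -[x y]; split.
      move=> [/= [k _ Fx] [l _ Gy]]; exists (maxn k l) => //; split.
      - by move: x Fx; exact/subsetPset/ndF/leq_maxl.
      - by move: y Gy; exact/subsetPset/ndG/leq_maxr.
    by move=> [k _ []/= ? ?]; split; exists k.
  move=> k; have [? ?] := Foo k; have [? ?] := Goo k.
  split; first exact: measurableX.
  by rewrite product_measure1E// lte_mul_pinfty// ge0_fin_numE.
exists (fun k => @row_uncons n @^-1` F k) => [|k].
  by rewrite -preimage_bigcup -FT preimage_setT.
have [mF Foo] := Ffin k; split.
  by rewrite -[X in measurable X]setTI; exact: measurable_row_uncons.
rewrite /cons_measure /pushforward -comp_preimage.
by rewrite (_ : _ \o _ = id) //; apply/funext => p; exact: row_consK.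
Qed.

HB.instance Definition _ := Measure_isSigmaFinite.Build _ _ _ cons_measure
  cons_measure_sigma_finite.

End Cons.

(* The n-fold product of the Lebesgue measure of R, on the product sigma-algebra. *)
Fixpoint borel_lebesgue n : {sigma_finite_measure set 'rV[R]_n -> \bar R} :=
  match n with
  | 0 => dirac (0%R : 'rV[R]_0)
  | n'.+1 => cons_measure (borel_lebesgue n')
  end.

Lemma measurable_box n (A : 'I_n -> set R) : (forall i, measurable (A i)) ->
  measurable [set v : 'rV[R]_n | forall i, A i (v ord0 i)].
Proof.
move=> mA; rewrite (_ : mkset _ =
    \bigcap_(i in [set: 'I_n]) ((fun v : 'rV[R]_n => v ord0 i) @^-1` A i)).
  apply: fin_bigcap_measurable => // i _; rewrite -[X in measurable X]setTI.
  have /measurable_fun_rowP mid := @measurable_id _ 'rV[R]_n setT.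
  exact: mid.
by apply/seteqP; split=> v /= Av i; [move=> _|]; exact: Av.
Qed.

Lemma borel_lebesgue_box n (A : 'I_n -> set R) : (forall i, measurable (A i)) ->
  borel_lebesgue n [set v : 'rV[R]_n | forall i, A i (v ord0 i)] =
    \prod_(i < n) lebesgue_measure (A i).
Proof.
elim: n => [|n ih] in A * => mA.
  by rewrite big_ord0 /= diracE mem_set // => -[].
rewrite big_ord_recl /= -ih => [|i]; last exact: mA.
have mB : measurable [set v : 'rV[R]_n | forall i, A (lift ord0 i) (v ord0 i)].
  exact: (@measurable_box n (fun i => A (lift ord0 i))).
rewrite -product_measure1E//; last exact: mA.
rewrite /cons_measure /pushforward; congr (_ \x _).
apply/seteqP; split=> p /=.
  by move=> Ap; split=> [|i]; [rewrite -row_cons0|rewrite -row_consS]; exact: Ap.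
move=> [Ap1 Ap2] i; have [j ->|->] := unliftP ord0 i.
  by rewrite row_consS; exact: Ap2.
by rewrite row_cons0.
Qed.

End LebesgueRow.

(* R^n with the sigma-algebra of Lebesgue measurable sets: the completion of the *)
(* product measure, in the Caratheodory form used for R by the library.          *)
Definition rV_lebesgue (R : realType) (n : nat) :=
  caratheodory_type ((@borel_lebesgue R n)^*)%mu.
HB.instance Definition _ (R : realType) n := Measurable.on (rV_lebesgue R n).

Definition lebesgue (R : realType) (n : nat) :
    set (rV_lebesgue R n) -> \bar R :=
  @completed_measure_extension _ _ R (@borel_lebesgue R n).
HB.instance Definition _ (R : realType) n := Measure.on (@lebesgue R n).

Lemma lebesgue_box (R : realType) n (A : 'I_n -> set R) :
  (forall i, measurable (A i)) ->
  lebesgue [set v : 'rV[R]_n | forall i, A i (v ord0 i)] =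
    (\prod_(i < n) lebesgue_measure (A i))%E.
Proof.
move=> mA; rewrite -borel_lebesgue_box// -[LHS]/(mu_ext _ _) measurable_mu_extE//.
exact: measurable_box.
Qed.

Section NDirac.
Variables (R : realType) (n : nat).
Implicit Types (U : set 'rV[R]_n) (g : 'rV[R]_n -> R) (f h : 'rV[R]_n -> Cl R n).

Definition domain U : Prop := [/\ open U, connected U & U !=set0].

Definition partial (j : 'I_n) g : 'rV[R]_n -> R :=
  fun x => 'D_(delta_mx ord0 j) g x.

Definition smooth g : Prop := forall s : seq 'I_n,
  continuous (foldr partial g s) /\
  forall (j : 'I_n) x, derivable (foldr partial g s) x (delta_mx ord0 j).

(* Test functions on U are extended by 0 to the whole space. *)
Definition test_function U g : Prop :=
  [/\ smooth g, compact (closure [set x | g x != 0])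
    & closure [set x | g x != 0] `<=` U].

Definition cl_test_function U h : Prop :=
  forall A, test_function U (fun x => clcoef (h x) A).

Definition dirac_op h : 'rV[R]_n -> Cl R n := fun x =>
  \sum_j clgen R j *
    (\sum_A partial j (fun y => clcoef (h y) A) x *: clbasis R A).

Definition Lp_loc (p : nat) U g : Prop :=
  measurable_fun (U : set (rV_lebesgue R n)) (g : rV_lebesgue R n -> R) /\
  forall K, compact K -> K `<=` U ->
    (\int[@lebesgue R n]_(x in K) (`|g x| ^+ p)%:E < +oo)%E.

(* Functions on U are represented by total functions, whose values outside U   *)
(* are irrelevant; the Cl_n-valued integral is taken componentwise, in the      *)
(* extended reals so that a divergent integral does not count as 0.            *)
Definition weak_ndirac_solution U f : Prop :=
  (forall A, Lp_loc n U (fun x => clcoef (f x) A)) /\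
  forall h, cl_test_function U h -> forall A,
    (\int[@lebesgue R n]_(x in U)
      (clcoef (clconj (clnorm (f x) ^+ (n - 2) *: f x) * dirac_op h x) A)%:E
     = 0)%E.

(* M(x) is computed in Cl_n; M(x) in U means that it is a vector lying in U, so *)
(* that clvec_part recovers M(x) in mobius_pullback.                             *)
Definition mobius_preimage (a b c d : Cl R n) U : set 'rV[R]_n :=
  [set x | mobius_den c d x != 0 /\
           exists2 y, U y & mobius a b c d x = clvec y].

Definition mobius_pullback (a b c d : Cl R n) f : 'rV[R]_n -> Cl R n :=
  fun x => (mobius_den c d x)^-1 * f (clvec_part (mobius a b c d x)).

End NDirac.

(* Main.v *)
(* Write f' = W (f o phi) for an invertible Clifford-valued weight W that scales  *)

(* The n-Dirac equation is conformally covariant, and in weak form this comes down to an identity of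
   integrands. If f' = W (f o phi) and left multiplication by W scales norms by om, then
   conj(|f'|^(n-2) f') D h is om^(n-2) times conj(|f|^(n-2) f) o phi times conj(W) D h. With psi the
   inverse of phi, D(S (h o psi)) contains a term with D S, which vanishes for monogenic S, and
   first derivatives of h. So the required identity is a pointwise condition on S: for each i, J
   sum_j (d_j psi_i) e_j S = om^(n-2) conj(W) e_i. [cc_dirac_push] draws the identity from this
   condition, and [conformal_weak_solution] adds the change of variables. Local L^n integrability
   survives because om^n / J is bounded on compact sets.

   The condition is checked in [conformal_translation], [conformal_sandwich] and
   [conformal_inversion]. Along the factorization of a Moebius map the weights multiply to (x +
   p)^-1 c^-1 = (c x + d)^-1, the weight of the theorem.

   The change of variables formulas come from the product structure of the measure: similarities
   from the uniqueness of translation-invariant measures, and the inversion from projective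
   coordinates (t, u) of the point (t, t u), in which only t changes. They are proved for measurable
   functions on the product sigma-algebra and then carried to the completion. *)
(* norms by om. If the Jacobian J of phi and a monogenic function S satisfy       *)
(*   J D(S (h o phi^-1)) o phi = om^(n-2) conj(W) D h                             *)
(* for every test function h, then the change of variables phi turns the weak     *)
(* equation of f' tested against h into that of f tested against S (h o phi^-1).  *)
(* This applies to translations (W = S = 1), to the maps x |-> w x w for a        *)
(* vector w (W = w, S proportional to w), and to the inversion x |-> x/|x|^2      *)
(* (W = x^-1, S = -x/|x|^n, the Cauchy kernel). A Moebius transformation with     *)
(* c <> 0 factors through these: there are vectors p, q with                      *)
(*   c x + d = c (x + p)                                                          *)
(*   M(x) = q + rev(c)^-1 ((x + p)/|x + p|^2) c^-1                                *)
(* and c is a product of invertible vectors; c = 0 is simpler.                    *)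
From HB Require Import structures.
Require Import Defs.
From mathcomp Require Import all_boot all_order all_algebra falgebra.
From mathcomp Require Import ring lra.
Set Implicit Arguments. Unset Strict Implicit. Unset Printing Implicit Defensive.
Import Order.TTheory GRing.Theory Num.Theory.
Local Open Scope ring_scope.

(** * Clifford conjugation and norm *)

Section CliffordConjugation.
Variables (R : fieldType) (n : nat).
Implicit Types (A B C : {set 'I_n}) (a b c : Cl R n).

Lemma clP a b : (forall A, clcoef a A = clcoef b A) -> a = b.
Proof. by move=> ab; apply/ffunP => A; exact: ab. Qed.

Lemma clcoef0 A : clcoef (0 : Cl R n) A = 0.
Proof. exact: ffunE. Qed.

Lemma clcoef_sum (I : Type) (r : seq I) (P : pred I) (F : I -> Cl R n) A :
  clcoef (\sum_(i <- r | P i) F i) A = \sum_(i <- r | P i) clcoef (F i) A.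
Proof.
by apply: (big_morph (fun a => clcoef a A)) => [x y|]; rewrite ?clcoefD ?clcoef0.
Qed.

Lemma clbasisM A B :
  clbasis R A * clbasis R B = (-1) ^+ clinv A B *: clbasis R (clsymd A B).
Proof. exact: clmul_basis. Qed.

Lemma clbasis0 : clbasis R (set0 : {set 'I_n}) = 1.
Proof. by []. Qed.

Lemma clsymdxx A : clsymd A A = set0.
Proof. by rewrite /clsymd setDv setU0. Qed.

Lemma clsymdC A B : clsymd A B = clsymd B A.
Proof. by rewrite /clsymd setUC. Qed.

Lemma clsymd_eq0 A B : (clsymd A B == set0) = (A == B).
Proof.
apply/eqP/eqP => [|->]; last exact: clsymdxx.
move/setP => AB; apply/setP => i; have := AB i; rewrite !inE.
by case: (i \in A); case: (i \in B).
Qed.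

Lemma clgen_sq (i : 'I_n) : clgen R i * clgen R i = - 1.
Proof.
rewrite clbasisM clinv1l clsymdxx clbasis0.
rewrite (@eq_card1 _ i) ?expr1 ?scaleN1r// => j; rewrite !inE.
by case: eqP => [->|]; rewrite ?leqnn.
Qed.

Lemma clgen_prod_rev (s : seq 'I_n) :
  (\prod_(i <- rev s) clgen R i) * (\prod_(i <- s) clgen R i) = (-1) ^+ size s.
Proof.
elim: s => [|i s ih]; first by rewrite !big_nil mulr1.
rewrite rev_cons -cats1 big_cat big_seq1 big_cons /= mulrA -[_ * _ * clgen R i]mulrA.
by rewrite clgen_sq mulrN1 mulNr ih exprS mulN1r.
Qed.

Lemma clbasis_sq A : clbasis R A * clbasis R A = (-1) ^+ clinv A A.
Proof. by rewrite clbasisM clsymdxx clbasis0 -in_algE rmorphXn rmorphN1. Qed.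

(** Both the reversed product and e_A are inverse to e_A up to sign: the former times e_A is
    (-1)^|A|, and e_A^2 = (-1)^(clinv A A). *)
Lemma clbasis_rev A : \prod_(i <- rev (enum A)) clgen R i =
  (-1) ^+ (#|A| + clinv A A) *: clbasis R A.
Proof.
have := clgen_prod_rev (enum A); rewrite -clbasis_prod -cardE.
move=> /(congr1 (fun x => x * clbasis R A)); rewrite -mulrA clbasis_sq => E.
have {E} := congr1 (fun x => x * (-1) ^+ clinv A A) E.
rewrite -mulrA -expr2 sqrr_sign mulr1 => ->.
by rewrite -mulrA commr_sign mulrA -exprD -[RHS]mulr_algl -in_algE rmorphXn rmorphN1.
Qed.

(* The two anti-automorphisms of the algebra are both diagonal in the basis e_A. *)
Definition cltwist (s : {set 'I_n} -> bool) a : Cl R n :=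
  \sum_A clcoef a A *: ((-1) ^+ s A *: clbasis R A).

(** The sign rule under which e_A |-> (-1)^(s A) e_A reverses products: e_A e_B and e_B e_A are
    multiples of the same basis element, with signs given by [clinv A B] and [clinv B A]. *)
Definition clantisign (s : {set 'I_n} -> bool) : Prop := forall A B,
  s (clsymd A B) = s A (+) s B (+) odd (clinv A B) (+) odd (clinv B A).

Lemma clcoef_twist s a A : clcoef (cltwist s a) A = (-1) ^+ s A * clcoef a A.
Proof.
rewrite clcoef_sum (bigD1 A)//= big1 => [|B neBA].
  by rewrite !clcoefZ clcoef_basis eqxx mulr1 addr0 mulrC.
by rewrite !clcoefZ clcoef_basis eq_sym (negPf neBA) !mulr0.
Qed.

Lemma cltwistD s a b : cltwist s (a + b) = cltwist s a + cltwist s b.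
Proof. by apply: clP => A; rewrite !(clcoefD, clcoef_twist) mulrDr. Qed.

Lemma cltwistZ s (k : R) a : cltwist s (k *: a) = k *: cltwist s a.
Proof. by apply: clP => A; rewrite !(clcoefZ, clcoef_twist) mulrCA. Qed.

Lemma cltwist0 s : cltwist s 0 = 0.
Proof. by apply: clP => A; rewrite clcoef_twist clcoef0 mulr0. Qed.

Lemma cltwist_sum s (I : Type) (r : seq I) (P : pred I) (F : I -> Cl R n) :
  cltwist s (\sum_(i <- r | P i) F i) = \sum_(i <- r | P i) cltwist s (F i).
Proof.
by apply: (big_morph (cltwist s)) => [x y|]; rewrite ?cltwistD ?cltwist0.
Qed.

Lemma cltwist_basis s A : cltwist s (clbasis R A) = (-1) ^+ s A *: clbasis R A.
Proof.
apply: clP => B; rewrite clcoef_twist clcoefZ clcoef_basis.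
by case: eqP => [->|]; rewrite ?mulr0.
Qed.

Lemma cltwistK s : involutive (cltwist s).
Proof. by move=> a; apply: clP => A; rewrite !clcoef_twist mulrA -expr2 sqrr_sign mul1r. Qed.

Lemma cltwistM s : clantisign s -> forall a b,
  cltwist s (a * b) = cltwist s b * cltwist s a.
Proof.
move=> anti a b.
rewrite (clcoefE a) mulr_suml !cltwist_sum mulr_sumr; apply: eq_bigr => A _.
rewrite (clcoefE b) mulr_sumr !cltwist_sum mulr_suml; apply: eq_bigr => B _.
rewrite -!(scalerAl, scalerAr) !cltwistZ -!(scalerAl, scalerAr) !scalerA [X in X *: _ = _]mulrC.
congr (_ *: _).
rewrite clbasisM cltwistZ !cltwist_basis -scalerAl -scalerAr clbasisM !scalerA clsymdC.
congr (_ *: _); rewrite -!exprD -[LHS]signr_odd -[RHS]signr_odd clsymdC anti !oddD.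
rewrite !oddb.
by case: (s A); case: (s B); case: (odd (clinv A B)); case: (odd (clinv B A)).
Qed.

(** The sign (-1)^|A| of conjugation cancels the one in [clbasis_rev]; what remains makes the
    conjugate of e_A its inverse. *)
Lemma clconjE a : clconj a = cltwist (fun A => odd (clinv A A)) a.
Proof.
apply: eq_bigr => A _; rewrite clbasis_rev; congr (_ *: _).
by rewrite scalerA exprD mulrA -expr2 sqrr_sign mul1r signr_odd.
Qed.

Lemma clrevE a :
  clrev a = cltwist (fun A => odd #|A| (+) odd (clinv A A)) a.
Proof.
by apply: eq_bigr => A _; rewrite clbasis_rev -oddD signr_odd.
Qed.

(** Modulo 2, [clinv] is bilinear for the symmetric difference, so A |-> clinv A A is a quadratic
    form with polarization clinv A B + clinv B A. *)
Lemma clantisign_conj : clantisign (fun A => odd (clinv A A)).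
Proof.
move=> A B; rewrite odd_clinvl !odd_clinvr.
by do 4!case: (odd _).
Qed.

Lemma clantisign_rev : clantisign (fun A => odd #|A| (+) odd (clinv A A)).
Proof.
move=> A B; rewrite clantisign_conj.
have -> : odd #|clsymd A B| = odd #|A| (+) odd #|B|.
  by have := odd_clsymd predT A B; rewrite !setIdE !setIT.
by do 6!case: (odd _).
Qed.

Lemma clconjM a b : clconj (a * b) = clconj b * clconj a.
Proof. by rewrite !clconjE; exact/cltwistM/clantisign_conj. Qed.

Lemma clconjZ (k : R) a : clconj (k *: a) = k *: clconj a.
Proof. by rewrite !clconjE cltwistZ. Qed.

Lemma clrevM a b : clrev (a * b) = clrev b * clrev a.
Proof. by rewrite !clrevE; exact/cltwistM/clantisign_rev. Qed.

Lemma clrevK : involutive (@clrev R n).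
Proof. by move=> a; rewrite !clrevE cltwistK. Qed.

Lemma clrev1 : clrev 1 = 1 :> Cl R n.
Proof.
rewrite clrevE -clbasis0 cltwist_basis cards0 clinvE big_set0 expr0.
exact: scale1r.
Qed.

Lemma clconj1 : clconj 1 = 1 :> Cl R n.
Proof. by rewrite clconjE -clbasis0 cltwist_basis clinvE big_set0 scale1r. Qed.

Lemma clconj_gen (i : 'I_n) : clconj (clgen R i) = - clgen R i.
Proof.
rewrite clconjE cltwist_basis signr_odd clinv1l (@eq_card1 _ i) ?expr1 ?scaleN1r//.
by move=> j; rewrite !inE; case: eqP => [->|]; rewrite ?leqnn.
Qed.

Lemma clrev_gen (i : 'I_n) : clrev (clgen R i) = clgen R i.
Proof.
rewrite clrevE cltwist_basis cards1 clinv1l (@eq_card1 _ i) ?scale1r//.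
by move=> j; rewrite !inE; case: eqP => [->|]; rewrite ?leqnn.
Qed.

Implicit Types v w x : 'rV[R]_n.

Lemma clconj_vec v : clconj (clvec v) = - clvec v.
Proof.
rewrite clconjE cltwist_sum -sumrN; apply: eq_bigr => i _.
by rewrite cltwistZ -clconjE clconj_gen scalerN.
Qed.

Lemma clrev_vec v : clrev (clvec v) = clvec v.
Proof.
rewrite clrevE cltwist_sum; apply: eq_bigr => i _.
by rewrite cltwistZ -clrevE clrev_gen.
Qed.

Lemma clvecD v w : clvec (v + w) = clvec v + clvec w.
Proof. by rewrite /clvec -big_split; apply: eq_bigr => i _; rewrite mxE scalerDl. Qed.

Lemma clvecZ (k : R) v : clvec (k *: v) = k *: clvec v.
Proof. by rewrite /clvec scaler_sumr; apply: eq_bigr => i _; rewrite mxE scalerA. Qed.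

Lemma clvecN v : clvec (- v) = - clvec v.
Proof. by rewrite -!scaleN1r clvecZ. Qed.

Lemma clvec0 : clvec 0 = 0 :> Cl R n.
Proof. by rewrite -[X in clvec X](scale0r (0 : 'rV_n)) clvecZ scale0r. Qed.

Lemma clvec_inj : injective (@clvec R n).
Proof. exact: can_inj (@clvecK R n). Qed.

Lemma clvec_delta (i : 'I_n) : clvec (delta_mx ord0 i) = clgen R i.
Proof.
rewrite /clvec (bigD1 i)//= mxE !eqxx scale1r big1 ?addr0// => j neji.
by rewrite mxE (negPf neji) andbF scale0r.
Qed.

Definition rdot v w : R := \sum_i v ord0 i * w ord0 i.

Lemma rdotC v w : rdot v w = rdot w v.
Proof. by apply: eq_bigr => i _; rewrite mulrC. Qed.

Lemma rdotDl v w x : rdot (v + w) x = rdot v x + rdot w x.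
Proof. by rewrite /rdot -big_split; apply: eq_bigr => i _; rewrite mxE mulrDl. Qed.

Lemma rdotZl k v x : rdot (k *: v) x = k * rdot v x.
Proof. by rewrite /rdot mulr_sumr; apply: eq_bigr => i _; rewrite mxE mulrA. Qed.

Lemma rdotDr v w x : rdot x (v + w) = rdot x v + rdot x w.
Proof. by rewrite ![rdot x _]rdotC rdotDl. Qed.

Lemma rdotZr k v x : rdot x (k *: v) = k * rdot x v.
Proof. by rewrite ![rdot x _]rdotC rdotZl. Qed.

Lemma rdot0l x : rdot 0 x = 0.
Proof. by rewrite /rdot big1// => i _; rewrite mxE mul0r. Qed.

Lemma rdot_delta v i : rdot v (delta_mx ord0 i) = v ord0 i.
Proof.
rewrite /rdot (bigD1 i)//= mxE !eqxx mulr1 big1 ?addr0// => j neji.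
by rewrite mxE (negPf neji) andbF mulr0.
Qed.

Lemma clvecM_anti v w :
  clvec v * clvec w + clvec w * clvec v = (- (rdot v w *+ 2))%:A.
Proof.
rewrite {1 4}/clvec mulr_suml mulr_sumr -big_split/=.
rewrite /rdot -sumrMnl -sumrN -[RHS]in_algE rmorph_sum/=; apply: eq_bigr => i _.
rewrite /clvec mulr_sumr mulr_suml -big_split/= (bigD1 i)//= big1 ?addr0 => [|j neji].
  rewrite -!(scalerAl, scalerAr) clgen_sq !scalerA [w _ _ * _]mulrC -mulr2n.
  by rewrite scalerN mulNrn scaleNr scalerMnl.
rewrite -!(scalerAl, scalerAr) !scalerA [w _ _ * _]mulrC -scalerDr clgenM.
by rewrite eq_sym (negPf neji) oppr0 mul0rn scaler0.
Qed.

Definition cldot a b : R := \sum_A clcoef a A * clcoef b A.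

(** Since conj(e_A) is the inverse of e_A, the scalar part of conj(e_A) e_B is 1 if A = B and 0
    otherwise. Norms can thus be computed by Clifford algebra. *)
Lemma cldotE a b : cldot a b = clcoef (clconj a * b) set0.
Proof.
rewrite clconjE /cltwist mulr_suml clcoef_sum; apply: eq_bigr => A _.
rewrite {2}(clcoefE b) mulr_sumr clcoef_sum (bigD1 A)//= big1 => [|B neBA].
  rewrite -!(scalerAl, scalerAr) clbasisM clsymdxx !clcoefZ clcoef_basis eqxx.
  rewrite signr_odd mulr1 addr0; congr (_ * _).
  by rewrite mulrCA -expr2 sqrr_sign mulr1.
rewrite -!(scalerAl, scalerAr) clbasisM !clcoefZ clcoef_basis eq_sym clsymd_eq0.
by rewrite eq_sym (negPf neBA) !mulr0.
Qed.

End CliffordConjugation.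

(** * The Euclidean norm and multiplication by vectors *)

Section CliffordNorm.
Variables (R : rcfType) (n : nat).
Implicit Types (a b c : Cl R n) (v w x : 'rV[R]_n).

Lemma clvec_sq v : clvec v * clvec v = - (rdot v v)%:A.
Proof.
have := clvecM_anti v v; rewrite -mulr2n -mulNrn -scalerMnl => /eqP.
rewrite -subr_eq0 -mulrnBl -scaler_nat scaler_eq0 pnatr_eq0/= subr_eq0.
by move=> /eqP->; rewrite scaleNr.
Qed.

Lemma rdot_ge0 v : 0 <= rdot v v.
Proof. by apply: sumr_ge0 => i _; rewrite -expr2 sqr_ge0. Qed.

Lemma rdot_eq0 v : (rdot v v == 0) = (v == 0).
Proof.
apply/eqP/eqP => [|->]; last exact: rdot0l.
move=> /eqP; rewrite psumr_eq0 => [/allP v0|i _]; last by rewrite -expr2 sqr_ge0.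
apply/rowP => i; rewrite mxE; apply/eqP.
by have := v0 i (mem_index_enum i); rewrite /= -expr2 sqrf_eq0.
Qed.

Lemma rdot_gt0 v : (0 < rdot v v) = (v != 0).
Proof. by rewrite lt_def rdot_ge0 andbT rdot_eq0. Qed.

(* [clvec] of this vector is the Clifford product w x w. *)
Definition sandwich w x : 'rV[R]_n := rdot w w *: x - (rdot w x *+ 2) *: w.

Lemma sandwichE w x : clvec (sandwich w x) = clvec w * clvec x * clvec w.
Proof.
have E : clvec x * clvec w = (- (rdot x w *+ 2))%:A - clvec w * clvec x.
  by rewrite -clvecM_anti addrK.
rewrite -mulrA E mulrBr mulrA clvec_sq -scalerAr mulr1 mulNr opprK -scalerAl mul1r.
by rewrite clvecD clvecN !clvecZ addrC rdotC scaleNr.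
Qed.

Lemma rdot_sandwich w x y :
  rdot (sandwich w x) (sandwich w y) = rdot w w ^+ 2 * rdot x y.
Proof.
rewrite /sandwich -!scaleNr !(rdotDl, rdotDr, rdotZl, rdotZr) [rdot x w]rdotC.
ring.
Qed.

Lemma sandwich_sandwich w x : sandwich w (sandwich w x) = rdot w w ^+ 2 *: x.
Proof.
apply/rowP => i; rewrite /sandwich -!scaleNr !(rdotDl, rdotDr, rdotZl, rdotZr).
rewrite !mxE; ring.
Qed.

Lemma clnormE a : clnorm a = Num.sqrt (cldot a a).
Proof. by []. Qed.

Lemma cldot_ge0 a : 0 <= cldot a a.
Proof. by apply: sumr_ge0 => i _; rewrite -expr2 sqr_ge0. Qed.

Lemma clnorm_ge0 a : 0 <= clnorm a.
Proof. exact: sqrtr_ge0. Qed.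

(** The squared norm of v a is the scalar part of conj(a) conj(v) v a, and conj(v) v is the real
    number |v|^2. *)
Lemma clnorm_vecM v a : clnorm (clvec v * a) = Num.sqrt (rdot v v) * clnorm a.
Proof.
rewrite !clnormE -sqrtrM ?rdot_ge0//; congr Num.sqrt; rewrite !cldotE clconjM.
rewrite -mulrA [clconj (clvec v) * _]mulrA clconj_vec mulNr clvec_sq opprK.
by rewrite -scalerAl mul1r -scalerAr clcoefZ.
Qed.

Lemma clcoef_le_norm a A : `|clcoef a A| <= clnorm a.
Proof.
rewrite -sqrtr_sqr ler_sqrt ?cldot_ge0// /cldot (bigD1 A)//= lerDl.
by apply: sumr_ge0 => B _; rewrite sqr_ge0.
Qed.

Lemma clvec_unit v : (clvec v \is a GRing.unit) = (v != 0).
Proof.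
apply/idP/idP => [|v0]; first by apply: contraTN => /eqP ->; rewrite clvec0 unitr0.
apply/unitrP; exists (- (rdot v v)^-1 *: clvec v).
rewrite -scalerAl -scalerAr clvec_sq scalerN scalerA mulNr mulVf ?scaleN1r ?opprK//.
by rewrite rdot_eq0.
Qed.

(** At v = 0 both sides are 0, because 0^-1 = 0. *)
Lemma clvecV v : (clvec v)^-1 = clvec (- (rdot v v)^-1 *: v).
Proof.
have [->|v0] := eqVneq v 0; first by rewrite scaler0 clvec0 invr0.
apply: (@mulIr _ (clvec v)); first by rewrite clvec_unit.
rewrite mulVr ?clvec_unit// clvecZ -scalerAl clvec_sq scalerN scalerA mulNr mulVf.
  by rewrite scaleN1r opprK.
by rewrite rdot_eq0.
Qed.

End CliffordNorm.

From mathcomp Require Import all_classical all_reals all_analysis measurable_realfun.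
Import numFieldNormedType.Exports.
Local Open Scope classical_set_scope.
Local Open Scope ring_scope.

(** * Functions of class C^k on an open set *)

Section ChainRule.
Context {R : numFieldType}.

Lemma deriveE1 (V W : normedModType R) (f : V -> W) x v :
  'D_v f x = 'D_1 (fun h : R => f (h *: v + x)) 0.
Proof.
rewrite /derive; set g1 := fun h => h^-1 *: _; set g2 := fun h => h^-1 *: _.
suff -> : g1 = g2 by [].
by rewrite funeqE /g1 /g2 => h /=; rewrite addr0 scale0r add0r [_%:A]mulr1.
Qed.

(** On the line through [x] along [v], derivability of [c] becomes differentiability of a curve, to
    which the chain rule for differentials applies. *)
Lemma is_derive_compd (U V W : normedModType R) (c : U -> V) (g : V -> W) x v :
  derivable c x v -> differentiable g (c x) ->
  is_derive x v (g \o c) ('d g (c x) ('D_v c x)).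
Proof.
move=> dc dg.
have dl : differentiable (fun h : R => c (h *: v + x)) 0.
  by apply/derivable1_diffP; have /derivable1P := dc.
have l0 : c (0 *: v + x) = c x by rewrite scale0r add0r.
have dg0 : differentiable g (c (0 *: v + x)) by rewrite l0.
apply: DeriveDef.
  apply/derivable1P; apply/derivable1_diffP.
  exact: (@differentiable_comp _ _ _ _ (fun h : R => c (h *: v + x)) g).
rewrite [LHS]deriveE1 [in RHS]deriveE1 [in RHS]deriveE// [LHS]deriveE; last first.
  exact: (@differentiable_comp _ _ _ _ (fun h : R => c (h *: v + x)) g).
by rewrite (@diff_comp _ _ _ _ (fun h : R => c (h *: v + x)) g)//= l0.
Qed.

End ChainRule.

Section Differentiable.
Variables (R : realType) (n : nat).
Implicit Types (O : set 'rV[R]_n) (g : 'rV[R]_n -> R) (x h : 'rV[R]_n).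

Local Notation e j := (delta_mx ord0 j : 'rV[R]_n).

(** The vertices of the staircase path from 0 to [h] that changes one coordinate at a time. *)
Definition row_take (k : nat) h : 'rV[R]_n :=
  \row_i (if (i < k)%N then h ord0 i else 0).

Lemma row_take0 h : row_take 0 h = 0.
Proof. by apply/rowP => i; rewrite !mxE. Qed.

Lemma row_take_all h : row_take n h = h.
Proof. by apply/rowP => i; rewrite !mxE ltn_ord. Qed.

Lemma row_takeS (k : 'I_n) h : row_take k.+1 h = row_take k h + h ord0 k *: e k.
Proof.
apply/rowP => i; rewrite !mxE eqxx/= ltnS leq_eqVlt.
have [->|neik] := eqVneq i k; first by rewrite eqxx ltnn mulr1 add0r.
by rewrite (inj_eq val_inj) (negPf neik) mulr0 addr0.
Qed.

Lemma row_normP h (M : R) : 0 <= M ->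
  reflect (forall i, `|h ord0 i| <= M) (`|h| <= M).
Proof.
move=> M0; rewrite [`|h|]mx_normrE; apply: (iffP idP) => [hM i|hM].
  by apply: le_trans hM; exact: (le_bigmax _ (fun ij => `|h ij.1 ij.2|) (ord0, i)).
by apply: bigmax_le => // -[i j] _ /=; rewrite ord1.
Qed.

Lemma row_norm_coord h i : `|h ord0 i| <= `|h|.
Proof. exact: (@row_normP h _ (normr_ge0 _) _). Qed.

Lemma row_norm_path (k : 'I_n) h (t : R) : `|t| <= `|h ord0 k| ->
  `|row_take k h + t *: e k| <= `|h|.
Proof.
move=> th; apply/row_normP => // i; rewrite !mxE eqxx/=.
have [->|neik] := eqVneq i k; last first.
  by rewrite mulr0 addr0; case: ifP => _; rewrite ?normr0// row_norm_coord.
by rewrite ltnn mulr1 add0r (le_trans th)// row_norm_coord.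
Qed.

Lemma line_shift (k : 'I_n) x (t s : R) (g : 'rV[R]_n -> R) :
  is_derive (x + t *: e k) (e k) g s ->
  is_derive t 1 (fun t => g (x + t *: e k)) s.
Proof.
move=> dg; have E : (fun u : R => g (u *: e k + (x + t *: e k))) =
    (fun u : R => g (x + (u + t) *: e k)).
  by apply/funext => u; rewrite scalerDl addrCA.
pose f (u : R) := g (x + u *: e k).
have E2 : (fun u : R => f (u *: (1 : R) + t)) = (fun u : R => g (x + (u + t) *: e k)).
  by apply/funext => u; rewrite [_%:A]mulr1.
apply: DeriveDef.
  apply: (derivable1P f t 1).2; rewrite E2 -E.
  exact: (derivable1P g _ _).1 (@ex_derive _ _ _ _ _ _ _ dg).
rewrite -(@derive_val _ _ _ _ _ _ _ dg) -[fun _ => _]/f.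
by rewrite (deriveE1 f) (deriveE1 g) E E2.
Qed.

Lemma mvt_partial (k : 'I_n) x (t : R) (g : 'rV[R]_n -> R) :
  (forall s : R, `|s| <= `|t| -> derivable g (x + s *: e k) (e k)) ->
  exists2 s : R, `|s| <= `|t| &
    g (x + t *: e k) - g x = t * partial k g (x + s *: e k).
Proof.
move=> dg; pose f s := g (x + s *: e k); pose df s := partial k g (x + s *: e k).
have fd (s : R) : `|s| <= `|t| -> is_derive s 1 f (df s).
  by move=> st; apply: line_shift; apply: derivableP; exact: dg.
have f0 : f 0 = g x by rewrite /f scale0r addr0.
have [t0|t0] := leP 0 t.
  have [s|s|s] := @MVT_segment _ f df 0 t t0.
  - by rewrite in_itv/= => /andP[s0 st]; apply: fd; rewrite !ger0_norm// ltW.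
  - by apply: derivable_within_continuous => u; rewrite in_itv/= => /andP[u0 ut];
      have /fd[] : `|u| <= `|t| by rewrite !ger0_norm.
  rewrite in_itv/= => /andP[s0 st] E; exists s; first by rewrite !ger0_norm.
  by rewrite -f0 E subr0 mulrC.
have [s|s|s] := @MVT_segment _ f df t 0 (ltW t0).
- by rewrite in_itv/= => /andP[s0 st]; apply: fd; rewrite !ltr0_norm// lerN2 ltW.
- apply: derivable_within_continuous => u; rewrite in_itv/= => /andP[u0 ut].
  by have /fd[] : `|u| <= `|t| by rewrite !ler0_norm ?lerN2// ltW.
rewrite in_itv/= => /andP[s0 st] E; exists s.
  by rewrite !ler0_norm ?lerN2// ltW.
by rewrite -f0 -opprB E sub0r mulrN opprK mulrC.
Qed.

(** Move from x to x + h along the staircase of [row_take]. On each edge the mean value theorem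
    gives the increment of g as a partial derivative at a nearby point, close to its value at x by
    continuity. *)
Lemma differentiable_partial O g x : open O -> O x ->
  (forall j y, O y -> derivable g y (e j)) ->
  (forall j, {for x, continuous (partial j g)}) ->
  differentiable g x /\
  forall v, 'd g x v = \sum_j v ord0 j * partial j g x.
Proof.
move=> Oo Ox dg cg.
pose L (v : 'rV[R]_n) : R := \sum_j v ord0 j * partial j g x.
have Llin : linear L.
  move=> k u v; rewrite /L scaler_sumr -big_split; apply: eq_bigr => i _ /=.
  by rewrite !mxE mulrDl -scalerAl.
pose LM := GRing.isLinear.Build _ _ _ _ L Llin.
pose LL : {linear 'rV[R]_n -> R} := HB.pack L LM.
have Lc : continuous LL.
  apply: (@continuous_big _ _ _ _ _ _ _ _ (fun j (v : 'rV[R]_n) => v ord0 j * partial j g x)).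
    exact: add_continuous.
  by move=> j _ y;
    exact: (continuousM (@coord_continuous _ 1 n ord0 j y) (@cst_continuous _ _ _ y)).
have dgx := @diff_unique R 'rV[R]_n R g LL x Lc.
(* The premise of [diff_unique] becomes the statement of [main]: the first-order expansion of [g] at
   [x] with linear part [L]. *)
lazymatch type of dgx with ?P -> _ => have main : P end.
  apply/eqaddoP => _/posnumP[eps].
  have N0 : 0 < (n%:R + 1 : R) by rewrite ltr_wpDl.
  (* Each of the n edges contributes an error of at most e1 |h|; the denominator n + 1 is nonzero
     even for n = 0. *)
  pose e1 := eps%:num / (n%:R + 1).
  have e10 : 0 < e1 by rewrite divr_gt0.
  have : \forall y \near x, O y /\ forall j, `|partial j g x - partial j g y| <= e1.
    near=> y; split; first by near: y; exact: open_nbhs_nbhs.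
    near: y; apply: filter_forall => j.
    by have /cvgrPdist_le := cg j; apply.
  move=> /nbhs_ballP[d /= d0 xd].
  have nd : \forall h \near (0 : 'rV[R]_n), `|h| < d by exact: nbhs0_lt.
  near=> h.
  have hd : `|h| < d.
    by near: h; exact: nd.
  have xdk k : `|k| <= `|h| -> O (x + k) /\ forall j, `|partial j g x - partial j g (x + k)| <= e1.
    move=> kh; apply: xd; rewrite -ball_normE/= opprD addrA subrr sub0r normrN.
    exact: le_lt_trans hd.
  have step (k : 'I_n) : `|g (x + row_take k.+1 h) - g (x + row_take k h)
      - h ord0 k * partial k g x| <= e1 * `|h|.
    rewrite row_takeS addrA.
    have [s hs|s sh ->] := @mvt_partial k (x + row_take k h) (h ord0 k) g.
      by rewrite -addrA; apply: dg; apply: (xdk _ _).1; exact: row_norm_path.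
    rewrite -mulrBr normrM mulrC ler_pM// ?row_norm_coord//.
    by rewrite distrC -addrA; apply: (xdk _ _).2; exact: row_norm_path.
  rewrite [X in `|X| <= _](_ : _ =
      \sum_(k < n) (g (x + row_take k.+1 h) - g (x + row_take k h)
      - h ord0 k * partial k g x)); last first.
    rewrite sumrB -(big_mkord xpredT (fun k => g (x + row_take k.+1 h) - g (x + row_take k h))).
    rewrite telescope_sumr// row_take_all row_take0 addr0.
    by rewrite /= [x + h]addrC -addrA -opprD.
  apply: le_trans (ler_norm_sum _ _ _) _.
  apply: (@le_trans _ _ (\sum_(k < n) e1 * `|h|)); first exact: ler_sum.
  rewrite sumr_const card_ord -mulr_natl mulrA ler_wpM2r// /e1.
  by rewrite mulrA ler_pdivrMr// mulrC ler_wpM2l// lerDl.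
move: dgx => /(_ main) dgx.
split; last by move=> v; rewrite dgx.
by apply/diff_locallyP; rewrite dgx; split.
Unshelve. all: by end_near. Qed.

End Differentiable.

Lemma row_continuous (T : topologicalType) (R : realType) (n : nat)
    (f : T -> 'rV[R]_n) x :
  (forall i, {for x, continuous (fun y => f y ord0 i)}) -> {for x, continuous f}.
Proof.
move=> cf A [P nP PA].
have : \forall y \near x, forall j, P ord0 j (f y ord0 j).
  by apply: filter_forall => j; apply: (cf j); exact: nP.
by apply: filterS => y Py; apply: PA => i j; rewrite ord1.
Qed.

Lemma near_eq_continuous (T U : topologicalType) (f g : T -> U) (x : T) :
  (\forall y \near x, f y = g y) -> {for x, continuous f} -> {for x, continuous g}.
Proof.
move=> fg cf A; rewrite -(nbhs_singleton fg) => /cf fA.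
have gA : \forall y \near x, A (f y) := fA.
by apply: filterS2 fg gA => y /= <-.
Qed.

Section Ck.
Variables (R : realType) (n : nat).
Implicit Types (O : set 'rV[R]_n) (f g : 'rV[R]_n -> R) (x h : 'rV[R]_n).

Local Notation e j := (delta_mx ord0 j : 'rV[R]_n).

(** Relative to a set, because maps such as the inversion are smooth only away from a point, and
    phrased with partial derivatives to match [smooth]. *)
Fixpoint Ck (k : nat) O g : Prop :=
  (forall x, O x -> {for x, continuous g}) /\
  if k is k'.+1 then
    forall j, (forall x, O x -> derivable g x (e j)) /\ Ck k' O (partial j g)
  else True.

Lemma Ck_continuous k O g x : Ck k O g -> O x -> {for x, continuous g}.
Proof. by case: k => [|k] [cg _]; exact: cg. Qed.

Lemma Ck_derivable k O g j x : Ck k.+1 O g -> O x -> derivable g x (e j).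
Proof. by move=> [_ dg] Ox; apply: (dg j).1. Qed.

Lemma Ck_partial k O g j : Ck k.+1 O g -> Ck k O (partial j g).
Proof. by move=> [_ dg]; exact: (dg j).2. Qed.

Lemma Ck_setU k O O' g : Ck k O g -> Ck k O' g -> Ck k (O `|` O') g.
Proof.
elim: k g => [|k ih] g [cg dg] [cg' dg'].
  by split=> // x [/cg|/cg'].
split=> [x [/cg|/cg']//|j].
have [dj pj] := dg j; have [dj' pj'] := dg' j.
by split=> [x [/dj|/dj']//|]; exact: ih.
Qed.

Lemma CkW k O g : Ck k.+1 O g -> Ck k O g.
Proof.
elim: k g => [|k ih] g [cg dg]; split=> // j; have [dj pj] := dg j.
by split=> //; exact: ih.
Qed.

Lemma eq_near_open O (f g : 'rV[R]_n -> R) x : open O -> O x ->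
  (forall y, O y -> f y = g y) -> \forall y \near x, f y = g y.
Proof.
move=> Oo Ox fg; near=> y; apply: fg; near: y.
exact: open_nbhs_nbhs.
Unshelve. all: by end_near. Qed.

Lemma eq_partial O f g j x : open O -> O x -> (forall y, O y -> f y = g y) ->
  partial j f x = partial j g x.
Proof. by move=> Oo Ox fg; apply: near_eq_derive; exact: eq_near_open fg. Qed.

Lemma eq_Ck k O f g : open O -> (forall x, O x -> f x = g x) ->
  Ck k O f -> Ck k O g.
Proof.
move=> Oo; elim: k f g => [|k ih] f g fg [cf df].
  by split=> // x Ox; apply: near_eq_continuous (cf x Ox); exact: eq_near_open fg.
split=> [x Ox|j]; first by apply: near_eq_continuous (cf x Ox); exact: eq_near_open fg.
have [dj pj] := df j; split=> [x Ox|].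
  by apply: near_eq_derivable (dj x Ox); exact: eq_near_open fg.
by apply: ih pj => x Ox; exact: (eq_partial _ Oo).
Qed.

(** One order is gained by exhibiting formulas that give the partial derivatives on [O]; on an open
    set [Ck] does not see values outside. *)
Lemma CkS k O g (dg : 'I_n -> 'rV[R]_n -> R) : open O ->
  (forall x, O x -> {for x, continuous g}) ->
  (forall j x, O x -> is_derive x (e j) g (dg j x)) ->
  (forall j, Ck k O (dg j)) -> Ck k.+1 O g.
Proof.
move=> Oo cg gdg kdg; split=> // j; split=> [x /(gdg j)[]//|].
by apply: eq_Ck (kdg j) => // x /(gdg j) dgj; rewrite /partial derive_val.
Qed.

Lemma Ck_cst k O (c : R) : open O -> Ck k O (cst c).
Proof.
move=> Oo; elim: k c => [|k ih] c; first by split=> // x _; exact: cst_continuous.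
by apply: (CkS (dg := fun _ => cst 0)) => // x _; exact: cst_continuous.
Qed.

Lemma CkD k O f g : open O -> Ck k O f -> Ck k O g -> Ck k O (f \+ g).
Proof.
move=> Oo; elim: k f g => [|k ih] f g kf kg.
  by split=> // x Ox; apply: continuousD; apply: Ck_continuous Ox; eassumption.
apply: (CkS (dg := fun j => partial j f \+ partial j g)) => // [x Ox|j x Ox|j].
- by apply: continuousD; apply: Ck_continuous Ox; eassumption.
- by apply: is_deriveD; apply: derivableP; apply: Ck_derivable Ox; eassumption.
- by apply: ih; exact: Ck_partial.
Qed.

Lemma CkM k O f g : open O -> Ck k O f -> Ck k O g -> Ck k O (f \* g).
Proof.
move=> Oo; elim: k f g => [|k ih] f g kf kg.
  by split=> // x Ox; apply: continuousM; apply: Ck_continuous Ox; eassumption.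
apply: (CkS (dg := fun j => (f \* partial j g) \+ (g \* partial j f))) => // [x Ox|j x Ox|j].
- by apply: continuousM; apply: Ck_continuous Ox; eassumption.
- by apply: is_deriveM; apply: derivableP; apply: Ck_derivable Ox; eassumption.
- by apply: CkD => //; apply: ih; (exact: Ck_partial || exact: CkW).
Qed.

Lemma CkZ k O (c : R) g : open O -> Ck k O g -> Ck k O (fun x => c * g x).
Proof. by move=> Oo; apply: CkM => //; exact: Ck_cst. Qed.

Lemma Ck_sum k O (I : Type) (r : seq I) (F : I -> 'rV[R]_n -> R) : open O ->
  (forall i, Ck k O (F i)) -> Ck k O (fun x => \sum_(i <- r) F i x).
Proof.
move=> Oo kF; elim: r => [|i r ih].
  by under eq_fun do rewrite big_nil; exact: Ck_cst.
by under eq_fun do rewrite big_cons; exact: CkD.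
Qed.

Lemma Ck_exp k O g m : open O -> Ck k O g -> Ck k O (fun x => g x ^+ m).
Proof.
move=> Oo kg; elim: m => [|m ih]; first exact: Ck_cst.
by under eq_fun do rewrite exprS; exact: CkM.
Qed.

Lemma is_derive_coord j i x : is_derive x (e j) (fun y => y ord0 i) (e j ord0 i).
Proof.
have dc := @differentiable_coord R 1 n x ord0 i.
apply: DeriveDef; first exact: diff_derivable.
have := derive_mx (@derivable_id _ _ x (e j)).
by rewrite derive_id => /matrixP/(_ ord0 i); rewrite [RHS]mxE => ->.
Qed.

Lemma Ck_coord k O i : open O -> Ck k O (fun x => x ord0 i).
Proof.
move=> Oo; case: k => [|k]; first by split=> // x _; exact: coord_continuous.
apply: (CkS (dg := fun j => cst (e j ord0 i))) => // [x _|j x _|j].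
- exact: coord_continuous.
- exact: is_derive_coord.
- exact: Ck_cst.
Qed.

Lemma CkV k O g : open O -> (forall x, O x -> g x != 0) ->
  Ck k O g -> Ck k O (fun x => (g x)^-1).
Proof.
move=> Oo g0; elim: k => [|k ih] kg.
  by split=> // x Ox; apply: continuousV; [exact: g0|exact: (Ck_continuous kg Ox)].
have kV := ih (CkW kg).
apply: (CkS (dg := fun j x => - 1 * ((g x)^-1 ^+ 2 * partial j g x))) => // [x Ox|j x Ox|j].
- by apply: continuousV; [exact: g0|exact: (Ck_continuous kg Ox)].
- have dgx := @Ck_derivable k O g j x kg Ox; have gx0 := g0 x Ox.
  apply: DeriveDef; first exact: derivableV.
  by rewrite deriveV// mulN1r exprVn scaleNr.
- by apply: CkZ => //; apply: CkM => //; [exact: Ck_exp|exact: Ck_partial].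
Qed.

Lemma is_derive_row_sqrt g j x : 0 < g x -> derivable g x (e j) ->
  is_derive x (e j) (fun y => Num.sqrt (g y)) ((2 * Num.sqrt (g x))^-1 * partial j g x).
Proof.
move=> g0 dgx; have ds := is_derive1_sqrt g0.
apply: is_derive_eq.
  by apply: (is_derive_compd dgx); apply/derivable1_diffP; case: ds.
rewrite -[X in 'd _ _ X]mulr1 linearZ/= -(@deriveE _ _ _ Num.sqrt).
  by rewrite (derive_sqrt g0) [LHS]mulrC.
by apply/derivable1_diffP; case: ds.
Qed.

Lemma Ck_sqrt k O g : open O -> (forall x, O x -> 0 < g x) ->
  Ck k O g -> Ck k O (fun x => Num.sqrt (g x)).
Proof.
move=> Oo g0; elim: k => [|k ih] kg.
  split=> // x Ox; apply: (@continuous_comp _ _ _ g Num.sqrt).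
    exact: (Ck_continuous kg Ox).
  exact: sqrt_continuous.
have kV := ih (CkW kg).
apply: (CkS (dg := fun j x => (2 * Num.sqrt (g x))^-1 * partial j g x)) => // [x Ox|j x Ox|j].
- apply: (@continuous_comp _ _ _ g Num.sqrt).
    exact: (Ck_continuous kg Ox).
  exact: sqrt_continuous.
- exact: (is_derive_row_sqrt (g0 x Ox) (Ck_derivable kg Ox)).
- apply: CkM => //; last exact: Ck_partial.
  apply: CkV => //; last exact: CkZ.
  by move=> x Ox; rewrite mulf_neq0// gt_eqF// sqrtr_gt0 g0.
Qed.

Lemma is_derive_comp_row O' (phi : 'rV[R]_n -> 'rV[R]_n) g j x :
  open O' -> O' (phi x) -> Ck 1 O' g ->
  (forall i, derivable (fun y => phi y ord0 i) x (e j)) ->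
  is_derive x (e j) (g \o phi)
    (\sum_i partial j (fun y => phi y ord0 i) x * partial i g (phi x)).
Proof.
move=> Oo' Ophix kg dphii.
have [dg dgE] : differentiable g (phi x) /\
    forall v, 'd g (phi x) v = \sum_i v ord0 i * partial i g (phi x).
  apply: (differentiable_partial Oo' Ophix) => [i y Oy|i].
    exact: (Ck_derivable kg Oy).
  exact: (Ck_continuous (Ck_partial i kg) Ophix).
have dphi : derivable phi x (e j) by apply/derivable_mxP => i l; rewrite ord1.
apply: is_derive_eq; first exact: (is_derive_compd dphi dg).
by rewrite dgE derive_mx//; apply: eq_bigr => i _; rewrite mxE.
Qed.

Lemma Ck_le k m O g : (k <= m)%N -> Ck m O g -> Ck k O g.
Proof.
move=> /subnK<-; elim: (m - k)%N => [//|d ih]; rewrite addSn => /CkW; exact: ih.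
Qed.

Lemma Ck_comp k O O' (phi : 'rV[R]_n -> 'rV[R]_n) g :
  open O -> open O' -> (forall x, O x -> O' (phi x)) ->
  (forall i, Ck k O (fun x => phi x ord0 i)) -> Ck k O' g -> Ck k O (g \o phi).
Proof.
move=> Oo Oo' OO'; elim: k g => [|k ih] g kphi kg.
  split=> // x Ox; apply: continuous_comp; last exact: (Ck_continuous kg (OO' _ Ox)).
  by apply: row_continuous => i; exact: (Ck_continuous (kphi i) Ox).
apply: (CkS (dg := fun j x => \sum_i partial j (fun y => phi y ord0 i) x * partial i g (phi x)))
  => // [x Ox|j x Ox|j].
- apply: continuous_comp; last exact: (Ck_continuous kg (OO' _ Ox)).
  by apply: row_continuous => i; exact: (Ck_continuous (kphi i) Ox).
- apply: (is_derive_comp_row Oo' (OO' _ Ox)) => [|i]; first exact: Ck_le kg.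
  exact: (Ck_derivable (kphi i) Ox).
- apply: Ck_sum => // i; apply: CkM => //; first exact: Ck_partial.
  by apply: ih; [move=> l; exact: CkW|exact: Ck_partial].
Qed.

(** In [foldr partial g s] the last index of [s] is differentiated first, so peeling it off with
    [rcons] matches the recursion of [Ck]. *)
Lemma smoothP g : smooth g <-> forall k, Ck k setT g.
Proof.
split=> [sg k|kg].
  elim: k g sg => [|k ih] g sg; first by split=> // x _; exact: (sg [::]).1.
  split=> [x _|j]; first exact: (sg [::]).1.
  split=> [x _|]; first exact: (sg [::]).2.
  by apply: ih => s; have := sg (rcons s j); rewrite foldr_rcons.
move=> s; elim/last_ind: s g kg => [|s j ih] g kg.
  split=> [x|j x]; first exact: Ck_continuous (kg 0) _.
  exact: Ck_derivable (kg 1) _.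
by rewrite foldr_rcons; apply: ih => k; exact: Ck_partial (kg k.+1).
Qed.

End Ck.

(** * Changes of variables for the Borel-Lebesgue measure *)

Lemma image_measure d d' (X : measurableType d) (Y : measurableType d') (R : realType)
    (mu : {measure set X -> \bar R}) (phi : X -> Y) : measurable_fun [set: X] phi ->
  exists nu : {measure set Y -> \bar R}, (forall A, nu A = mu (phi @^-1` A)) /\
    forall F, measurable_fun [set: Y] F -> (forall y, 0 <= F y)%E ->
      (\int[nu]_y F y = \int[mu]_x F (phi x))%E.
Proof.
move=> mphi; exists (measure_function_pushforward__canonical__measure_function_Measure mu mphi).
by split=> // F mF F0; exact: ge0_integral_pushforward.
Qed.

Lemma mule_posI (R : realType) (k : \bar R) :
  (0 < k < +oo)%E -> injective (fun x : \bar R => k * x)%E.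
Proof.
case: k => [k| |]//; last by rewrite ltxx andbF.
rewrite lte_fin => /andP[k0 _] x y /(congr1 (fun e => k^-1%:E * e)%E).
by rewrite !muleA -!EFinM mulVf ?gt_eqF// !mul1e.
Qed.

(** * Affine changes of variable on the line *)

Section RealLine.
Context {R : realType}.
Local Open Scope ereal_scope.
Notation lam := (@lebesgue_measure R).
Implicit Types F G : R -> \bar R.

Lemma measurable_shift (a : R) : measurable_fun [set: R] (fun x : R => (x + a)%R).
Proof. by apply: measurable_funD. Qed.

Lemma measurable_scale (c : R) : measurable_fun [set: R] (fun x : R => (c * x)%R).
Proof. exact: measurable_funM. Qed.

(** The image of Lebesgue measure agrees with it on half-open intervals, which determine it. *)
Lemma ge0_integral_shift F (a : R) : measurable_fun [set: R] F -> (forall x, 0 <= F x) ->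
  \int[lam]_x F x = \int[lam]_x F (x + a)%R.
Proof.
move=> mF F0; pose phi : R -> measurableTypeR R := fun x => (x + a)%R.
have mphi : measurable_fun [set: R] phi := measurable_shift a.
have [m [mE mI]] := image_measure lam mphi.
transitivity (\int[m]_x F x); last exact: mI.
apply: eq_measure_integral => A mA _.
apply: (@lebesgue_measure_unique R m) => // _ [[u v] _ <-].
rewrite mE; set I := phi @^-1` _.
have -> : I = `](u - a)%R, (v - a)%R]%classic.
  by apply/seteqP; split => x; rewrite /I /phi/= !in_itv/= ltrBlDr lerBrDr.
rewrite lebesgue_measure_itv/= (lebesgue_measure_itv `](u - a)%R, (v - a)%R])/=.
rewrite !lte_fin ltrD2r; case: ifP => // _.
by rewrite -!EFinB opprB addrA subrK.
Qed.

Lemma ge0_integral_scale F (c : R) : c != 0%R ->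
  measurable_fun [set: R] F -> (forall x, 0 <= F x) ->
  \int[lam]_x F x = `|c|%:E * \int[lam]_x F (c * x)%R.
Proof.
move=> c0 mF F0; pose phi : R -> measurableTypeR R := fun x => (c * x)%R.
have mphi : measurable_fun [set: R] phi := measurable_scale c.
pose k : {nonneg R} := NngNum (normr_ge0 c).
have [m [mE mI]] := image_measure lam mphi.
transitivity (\int[mscale k m]_x F x); last first.
  by rewrite ge0_integral_mscale//; congr (_ * _); exact: mI.
apply: eq_measure_integral => A mA _.
apply: (@lebesgue_measure_unique R (mscale k m)) => // _ [[u v] _ <-].
rewrite -[RHS]/(`|c|%:E * m `]u, v]%classic) mE; set I := phi @^-1` _.
have [cp|cn] : (0 < c)%R \/ (c < 0)%R.
  by case: (ltgtP c 0%R) c0 => //; [right|left].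
- have -> : I = `](c^-1 * u)%R, (c^-1 * v)%R]%classic.
    by apply/seteqP; split => x; rewrite /I /phi/= !in_itv/= ltr_pdivrMl// ler_pdivlMl.
  rewrite lebesgue_measure_itv/= (lebesgue_measure_itv `](c^-1 * u)%R, (c^-1 * v)%R])/=.
  rewrite !lte_fin ltr_pM2l ?invr_gt0//; case: ifP => _.
    by rewrite gtr0_norm// -!EFinB -EFinM -mulrBr mulrA mulfV ?mul1r.
  by rewrite mule0.
- have -> : I = `[(c^-1 * v)%R, (c^-1 * u)%R[%classic.
    by apply/seteqP; split => x; rewrite /I /phi/= !in_itv/= andbC ler_ndivrMl// ltr_ndivlMl.
  rewrite lebesgue_measure_itv/= (lebesgue_measure_itv `[(c^-1 * v)%R, (c^-1 * u)%R[)/=.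
  rewrite !lte_fin ltr_nM2l ?invr_lt0//; case: ifP => _.
    by rewrite ltr0_norm// -!EFinB -EFinM -mulrBr mulrA mulNr mulfV// mulN1r opprB.
  by rewrite mule0.
Qed.

End RealLine.

(** * The change of variable t -> 1/t on the line *)

Section RealInversion.
Context {R : realType}.
Local Open Scope ereal_scope.
Notation lam := (@lebesgue_measure R).
Implicit Types F G : R -> \bar R.

Lemma measurable_invr : measurable_fun [set: R] (fun x : R => x^-1%R).
Proof.
rewrite (_ : (fun x : R => x^-1%R) = fun x => if x == 0%R then 0%R else x^-1%R); last first.
  by apply/funext => x; case: eqP => // ->; rewrite invr0.
apply: measurable_fun_if => //.
  by apply: measurable_fun_eqr => //.
have -> : [set: R] `&` (fun x : R => x == 0%R) @^-1` [set false] = [set x | x != 0%R].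
  by apply/seteqP; split => x /=; [move=> [_ ->]|move=> /negPf].
apply: open_continuous_measurable_fun; last by move=> x; rewrite inE/=; exact: inv_continuous.
exact: open_neq.
Qed.

Lemma measurable_funVr d (T : measurableType d) (f : T -> R) :
  measurable_fun setT f -> measurable_fun setT (fun x => (f x)^-1%R).
Proof. by move=> mf; exact: (measurableT_comp measurable_invr). Qed.

(* Integration against the multiplicative Haar measure dx/|x|. *)
Let mu F := \int[lam]_x (F x * (`|x|^-1)%:E).

Let ninv x : 0 <= (`|x : R|^-1)%:E.
Proof. by rewrite lee_fin invr_ge0. Qed.

Let mninv : measurable_fun [set: R] (fun x : R => (`|x|^-1)%:E).
Proof. by apply/measurable_EFinP; apply: measurable_funVr; exact: normr_measurable. Qed.

Let mu_ge0 F : (forall x, 0 <= F x) -> 0 <= mu F.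
Proof. by move=> F0; apply: integral_ge0 => x _; exact: mule_ge0. Qed.

Let mu_scale F (c : R) : c != 0%R -> measurable_fun setT F -> (forall x, 0 <= F x) ->
  mu (fun x => F (c * x)%R) = mu F.
Proof.
move=> c0 mF F0; rewrite /mu [RHS](ge0_integral_scale c0)//; last 2 first.
- exact: emeasurable_funM.
- by move=> x; exact: mule_ge0.
have mFc : measurable_fun setT (fun x : R => F (c * x)%R).
  by apply: (measurableT_comp mF); exact: measurable_scale.
rewrite -ge0_integralZl//=; last 2 first.
- apply: emeasurable_funM => //.
  by apply: (measurableT_comp mninv); exact: measurable_scale.
- by move=> x _; exact: mule_ge0.
apply: eq_integral => x _; rewrite normrM invfM muleCA -EFinM mulrA mulfV ?mul1r//.
by rewrite normr_eq0.
Qed.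

(** A weight of positive finite [mu]-integral, to be divided out in [mu_inv]. *)
Let g (x : R) : \bar R := (\1_`[1%R, 2%R]%classic x)%:E.

Let g0 x : 0 <= g x. Proof. by rewrite lee_fin. Qed.

Let mg : measurable_fun setT g.
Proof. by apply/measurable_EFinP; exact: measurable_indic. Qed.

Let mu_g_gt0 : 0 < mu g.
Proof.
apply: (@lt_le_trans _ _ (\int[lam]_x (2^-1%:E * g x))).
  rewrite ge0_integralZl// integral_indic// setIT/= (lebesgue_measure_itv `[1%R, 2%R])/= lte_fin.
  by rewrite ltr1n/= -EFinB -EFinM lte_fin; lra.
apply: ge0_le_integral => //.
- by move=> x _; exact: mule_ge0.
- by apply: emeasurable_funM.
- by apply: emeasurable_funM.
move=> x _; rewrite muleC /g indicE; case: (boolP (x \in _)); last by rewrite !mul0e.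
rewrite inE/= in_itv/= => /andP[x1 x2]; rewrite !mul1e lee_fin lef_pV2 ?posrE//.
  by rewrite ger0_norm//; lra.
by rewrite normr_gt0; apply/eqP; lra.
Qed.

Let mu_g_ltoo : mu g < +oo.
Proof.
apply: (@le_lt_trans _ _ (\int[lam]_x g x)); last first.
  by rewrite integral_indic// setIT/= (lebesgue_measure_itv `[1%R, 2%R])/= lte_fin ltr1n/= ltry.
apply: ge0_le_integral => //.
- by move=> x _; exact: mule_ge0.
- by apply: emeasurable_funM.
move=> x _; rewrite /g indicE; case: (boolP (x \in _)); last by rewrite !mul0e.
rewrite inE/= in_itv/= => /andP[x1 x2]; rewrite !mul1e lee_fin invf_le1.
  by rewrite ger0_norm//; lra.
by rewrite normr_gt0; apply/eqP; lra.
Qed.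

(** Inversion invariance follows from scaling invariance by Tonelli. Integrate F(y/x) h(y) in both
    orders. For fixed y, the substitution x -> y x leads to mu(F(1/x)) mu(h). For fixed x, the
    substitution y -> x y turns the integrand into F(y) h(x y), of total integral mu(F) mu(h). Then
    divide by mu(h). *)
Let mu_inv F : measurable_fun setT F -> (forall x, 0 <= F x) ->
  mu (fun x => F x^-1%R) = mu F.
Proof.
move=> mF F0.
have [h h0 [mh /andP[mu_h_gt0 mu_h_ltoo]]] : exists2 h, forall x, 0 <= h x &
    measurable_fun setT h /\ 0 < mu h < +oo.
  by exists g => //; split=> //; rewrite mu_g_gt0.
have mdiv : measurable_fun setT (fun z : R * R => z.2 * z.1^-1)%R.
  by apply: measurable_funM => //; exact: measurable_funVr.
have mFdiv : measurable_fun setT (fun z : R * R => F (z.2 * z.1^-1)%R).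
  exact: (measurableT_comp mF).
pose A (z : R * R) := F (z.2 * z.1^-1)%R * h z.2 * (`|z.1|^-1)%:E * (`|z.2|^-1)%:E.
have mA : measurable_fun setT A.
  apply: emeasurable_funM; last exact: (measurableT_comp mninv).
  apply: emeasurable_funM; last exact: (measurableT_comp mninv).
  apply: emeasurable_funM => //; exact: (measurableT_comp mh).
have A0 z : 0 <= A z by rewrite !mule_ge0.
have mFinv : measurable_fun setT (fun x : R => F x^-1%R).
  by apply: (measurableT_comp mF); exact: measurable_invr.
have mFn : measurable_fun setT (fun x => F x * (`|x|^-1)%:E) by exact: emeasurable_funM.
have Fn0 x : 0 <= F x * (`|x|^-1)%:E by rewrite mule_ge0.
have mhn : measurable_fun setT (fun x => h x * (`|x|^-1)%:E) by exact: emeasurable_funM.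
have hn0 x : 0 <= h x * (`|x|^-1)%:E by rewrite mule_ge0.
have Finv0 x : 0 <= F x^-1%R by [].
have mF2 : measurable_fun setT (fun z : R * R => F z.2) by exact: (measurableT_comp mF).
have mh2 : measurable_fun setT (fun z : R * R => h (z.1 * z.2)%R).
  by apply: (measurableT_comp mh); exact: measurable_funM.
pose B (z : R * R) := F z.2 * h (z.1 * z.2)%R * (`|z.1|^-1)%:E * (`|z.2|^-1)%:E.
have mB : measurable_fun setT B.
  apply: emeasurable_funM; last exact: (measurableT_comp mninv).
  apply: emeasurable_funM; last exact: (measurableT_comp mninv).
  exact: emeasurable_funM.
have B0 z : 0 <= B z by rewrite !mule_ge0.
have [E1 E2 E3] : [/\ \int[lam]_y \int[lam]_x A (x, y) = mu h * mu (fun x => F x^-1%R),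
    \int[lam]_x \int[lam]_y A (x, y) = \int[lam]_x \int[lam]_y B (x, y)
  & \int[lam]_y \int[lam]_x B (x, y) = mu F * mu h].
split.
- rewrite {1}/mu -[RHS](ge0_integralZr lam measurableT mhn (fun y _ => hn0 y) (mu_ge0 Finv0)).
  apply: eq_integral => y _.
  have [->|y0] := eqVneq y 0%R.
    by rewrite normr0 invr0 mule0 mul0e integral0_eq// => x _; rewrite /A/= normr0 invr0 mule0.
  transitivity (\int[lam]_x ((h y * (`|y|^-1)%:E) * (F (y * x^-1)%R * (`|x|^-1)%:E))).
    by apply: eq_integral => x _; rewrite /A/= [F _ * h y]muleC -!muleA; congr (_ * _);
      rewrite [RHS]muleCA; congr (_ * _); rewrite muleC.
  rewrite ge0_integralZl//; last 2 first.
  - apply: emeasurable_funM => //; apply: (measurableT_comp mF).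
    by apply: measurable_funM => //; exact: measurable_invr.
  - by move=> x _; rewrite mule_ge0.
  congr (_ * _); rewrite -[LHS]/(mu (fun x => F (y * x^-1)%R)).
  rewrite -(mu_scale y0)//; last first.
    apply: (measurableT_comp mF); apply: measurable_funM => //; exact: measurable_invr.
  congr mu; apply/funext => x; congr F.
  by rewrite invfM mulrA mulfV// mul1r.
- apply: eq_integral => x _.
  have [->|x0] := eqVneq x 0%R.
    by rewrite !integral0_eq// => y _; rewrite /A/= /B/= normr0 invr0 mule0 mul0e.
  have mAx : measurable_fun setT (fun y : R => F (y * x^-1)%R * h y * (`|x|^-1)%:E).
    apply: emeasurable_funM => //; apply: emeasurable_funM => //.
    by apply: (measurableT_comp mF); exact: measurable_funM.
  rewrite -[LHS]/(mu (fun y => F (y * x^-1)%R * h y * (`|x|^-1)%:E)).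
  rewrite -(mu_scale x0)//; last by move=> y; rewrite !mule_ge0.
  apply: eq_integral => y _; congr (F _ * _ * _ * _).
  by rewrite mulrAC mulfV// mul1r.
- rewrite {1}/mu -[RHS](ge0_integralZr lam measurableT mFn (fun y _ => Fn0 y) (mu_ge0 h0)).
  apply: eq_integral => y _.
  have [->|y0] := eqVneq y 0%R.
    by rewrite normr0 invr0 mule0 mul0e integral0_eq// => x _; rewrite /B/= normr0 invr0 mule0.
  transitivity (\int[lam]_x ((F y * (`|y|^-1)%:E) * (h (y * x)%R * (`|x|^-1)%:E))).
    apply: eq_integral => x _; rewrite /B/= [(y * x)%R]mulrC -!muleA; congr (_ * _).
    by rewrite [RHS]muleCA; congr (_ * _); rewrite muleC.
  rewrite ge0_integralZl//; last 2 first.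
  - apply: emeasurable_funM => //; apply: (measurableT_comp mh).
    exact: measurable_scale.
  - by move=> x _; rewrite mule_ge0.
  by congr (_ * _); exact: mu_scale.
apply: (@mule_posI _ (mu h)); first by rewrite mu_h_gt0.
have fub (C : R * R -> \bar R) (mC : measurable_fun setT C) (C0 : forall z, 0 <= C z) :=
  @fubini_tonelli _ _ (measurableTypeR R) (measurableTypeR R) R lam lam C mC C0.
rewrite -E1 -[LHS](fub A mA A0) E2 [LHS](fub B mB B0) E3.
exact: muleC.
Qed.

Lemma ge0_integral_inv F : measurable_fun setT F -> (forall x, 0 <= F x) ->
  \int[lam]_x F x = \int[lam]_x (F x^-1%R * (`|x| ^- 2)%:E).
Proof.
move=> mF F0; pose G x := F x * `|x|%:E.
have mG : measurable_fun setT G.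
  by apply: emeasurable_funM => //; apply/measurable_EFinP; exact: normr_measurable.
have G0 x : 0 <= G x by rewrite mule_ge0// lee_fin.
have mFinv : measurable_fun setT (fun x : R => F x^-1%R).
  by apply: (measurableT_comp mF); exact: measurable_invr.
(* The factor |x| of [G] cancels the density 1/|x| of [mu] off the null set {0}. *)
transitivity (mu G).
  apply: ge0_ae_eq_integral => //.
  - exact: emeasurable_funM.
  - by move=> x _; rewrite mule_ge0.
  exists [set 0%R]; split => //; first exact: lebesgue_measure_set1.
  move=> x /=; apply: contra_notP => /eqP x0 _.
  by rewrite /G -muleA -EFinM mulfV ?mule1// normr_eq0.
rewrite -mu_inv//; apply: eq_integral => x _; rewrite /G -muleA -EFinM normfV.
by rewrite -expr2 exprVn.
Qed.

End RealInversion.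

(** * Translations and scalings of R^n *)

Section BorelLebesgue.
Context {R : realType}.
Local Open Scope ereal_scope.
Notation lam := (@lebesgue_measure R).
Notation beta := (@borel_lebesgue R).

Lemma measurable_coord n (i : 'I_n) :
  measurable_fun [set: 'rV[R]_n] (fun v : 'rV[R]_n => v ord0 i).
Proof. by have /measurable_fun_rowP := @measurable_id _ 'rV[R]_n setT. Qed.

Lemma measurable_row_shift n (p : 'rV[R]_n) :
  measurable_fun [set: 'rV[R]_n] (fun v : 'rV[R]_n => (v + p)%R).
Proof.
apply/measurable_fun_rowP => i; under eq_fun do rewrite mxE.
by apply: measurable_funD => //; exact: measurable_coord.
Qed.

Lemma measurable_row_scale n (c : R) :
  measurable_fun [set: 'rV[R]_n] (fun v : 'rV[R]_n => (c *: v)%R).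
Proof.
apply/measurable_fun_rowP => i; under eq_fun do rewrite mxE.
by apply: measurable_funM => //; exact: measurable_coord.
Qed.

Lemma row_unconsK n : cancel (@row_uncons R n) (@row_cons R n).
Proof.
move=> v; apply/rowP => i; have [j ->|->] := unliftP ord0 i.
  rewrite row_consS mxE; congr (v _ _); exact: val_inj.
by rewrite row_cons0.
Qed.

Lemma row_consD n (p q : R * 'rV[R]_n) :
  (row_cons p + row_cons q)%R = row_cons (p.1 + q.1, p.2 + q.2)%R.
Proof.
apply/rowP => i; rewrite mxE; have [j ->|->] := unliftP ord0 i.
  by rewrite !row_consS mxE.
by rewrite !row_cons0.
Qed.

Lemma row_consZ n (c : R) (p : R * 'rV[R]_n) :
  (c *: row_cons p)%R = row_cons (c * p.1, c *: p.2)%R.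
Proof.
apply/rowP => i; rewrite mxE; have [j ->|->] := unliftP ord0 i.
  by rewrite !row_consS mxE.
by rewrite !row_cons0.
Qed.

Lemma measurable_fun_cons n (F : 'rV[R]_n.+1 -> \bar R) : measurable_fun setT F ->
  measurable_fun [set: R * 'rV[R]_n] (fun p => F (row_cons p)).
Proof. by move=> mF; apply: (measurableT_comp mF); exact: measurable_row_cons. Qed.

Lemma ge0_integral_cons n (F : 'rV[R]_n.+1 -> \bar R) :
  measurable_fun setT F -> (forall x, 0 <= F x) ->
  \int[beta n.+1]_x F x = \int[lam]_t \int[beta n]_v F (row_cons (t, v)).
Proof.
move=> mF F0; transitivity (\int[lam \x beta n]_p F (row_cons p)); last first.
  apply: (@fubini_tonelli1 _ _ (measurableTypeR R) 'rV[R]_n R lam (beta n)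
    (fun p => F (row_cons p))) => //.
  exact: measurable_fun_cons.
have [m [mE mI]] := image_measure (lam \x beta n) (@measurable_row_cons R n).
rewrite -mI//; apply: eq_measure_integral => A mA _.
by rewrite mE.
Qed.

Lemma measurable_fun_cons1 n (F : 'rV[R]_n.+1 -> \bar R) (t : R) : measurable_fun setT F ->
  measurable_fun [set: 'rV[R]_n] (fun v => F (row_cons (t, v))).
Proof.
move=> mF; apply: (measurableT_comp (measurable_fun_cons mF)).
exact: pair1_measurable.
Qed.

Lemma measurable_integral_cons n (F : 'rV[R]_n.+1 -> \bar R) :
  measurable_fun setT F -> (forall x, 0 <= F x) ->
  measurable_fun [set: R] (fun t : R => \int[beta n]_v F (row_cons (t, v))).
Proof.
move=> mF F0.
exact: (measurable_fun_fubini_tonelli_F _ (measurable_fun_cons mF)).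
Qed.

Lemma ge0_integral_row_shift n (F : 'rV[R]_n -> \bar R) (p : 'rV[R]_n) :
  measurable_fun setT F -> (forall x, 0 <= F x) ->
  \int[beta n]_x F x = \int[beta n]_x F (x + p)%R.
Proof.
elim: n => [|n ih] in F p * => mF F0.
  by congr integral; apply/funext => x; congr F; apply/rowP => -[].
have mFp : measurable_fun setT (fun x : 'rV[R]_n.+1 => F (x + p)%R).
  by apply: (measurableT_comp mF); exact: measurable_row_shift.
rewrite !ge0_integral_cons//.
rewrite (ge0_integral_shift (row_uncons p).1); last 2 first.
- exact: measurable_integral_cons.
- by move=> t; exact: integral_ge0.
apply: eq_integral => t _; rewrite (ih _ (row_uncons p).2)//; last first.
  exact: measurable_fun_cons1.
apply: eq_integral => v _; congr F.
by rewrite -[in RHS](row_unconsK p) row_consD.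
Qed.

Lemma ge0_integral_row_scale n (F : 'rV[R]_n -> \bar R) (c : R) : c != 0%R ->
  measurable_fun setT F -> (forall x, 0 <= F x) ->
  \int[beta n]_x F x = (`|c| ^+ n)%:E * \int[beta n]_x F (c *: x)%R.
Proof.
move=> c0; elim: n => [|n ih] in F * => mF F0.
  by rewrite mul1e; congr integral; apply/funext => x; congr F; apply/rowP => -[].
have mFc : measurable_fun setT (fun x : 'rV[R]_n.+1 => F (c *: x)%R).
  by apply: (measurableT_comp mF); exact: measurable_row_scale.
rewrite !ge0_integral_cons// (ge0_integral_scale c0); last 2 first.
- exact: measurable_integral_cons.
- by move=> t; exact: integral_ge0.
rewrite exprS EFinM -muleA; congr (_ * _); rewrite -ge0_integralZl//; last 2 first.
- exact: (measurable_integral_cons mFc).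
- by move=> t _; exact: integral_ge0.
apply: eq_integral => t _; rewrite ih//; last first.
  exact: measurable_fun_cons1.
by congr (_ * _); apply: eq_integral => v _; rewrite row_consZ.
Qed.

End BorelLebesgue.

(** * Similarities of R^n *)

Section Similarity.
Context {R : realType}.
Local Open Scope ereal_scope.
Notation lam := (@lebesgue_measure R).
Notation beta := (@borel_lebesgue R).

Lemma measurable_rdot n :
  measurable_fun [set: 'rV[R]_n] (fun v : 'rV[R]_n => rdot v v).
Proof.
rewrite /rdot; apply: measurable_sum => i.
by apply: measurable_funM => //; exact: measurable_coord.
Qed.

Definition unit_ball n : set 'rV[R]_n := [set v | (rdot v v <= 1)%R].

Lemma measurable_unit_ball n : measurable (@unit_ball n).
Proof.
rewrite -[X in measurable X]setTI.
exact: (measurable_rdot measurableT (@measurable_itv _ `]-oo, 1%R])).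
Qed.

Lemma prode_gt0_lty n (a : 'I_n -> \bar R) :
  (forall i, 0 < a i < +oo) -> 0 < \prod_i a i < +oo.
Proof.
move=> a0; apply: (big_ind (fun e => 0 < e < +oo)) => //.
  by rewrite lte01 ltry.
move=> x y /andP[x0 xoo] /andP[y0 yoo]; rewrite mule_gt0//=.
by rewrite lte_mul_pinfty// ?ltW// ge0_fin_numE// ltW.
Qed.

(** The unit ball contains the cube [0, 1/(n+1)]^n and lies in [-1, 1]^n. *)
Lemma unit_ball_gt0_lty n : 0 < beta n (@unit_ball n) < +oo.
Proof.
have c1 : (0 <= (n%:R + 1 : R)^-1 <= 1)%R.
  by rewrite invr_ge0 addr_ge0//= invf_le1 ?ltr_wpDl// lerDr.
pose box (u v : R) := [set w : 'rV[R]_n | forall i, `[u, v]%classic (w ord0 i)].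
have boxE u v : beta n (box u v) = \prod_(i < n) lam `[u, v].
  by apply: (@borel_lebesgue_box R n (fun=> `[u, v]%classic)) => i; exact: measurable_itv.
have mbox u v : measurable (box u v).
  by apply: (@measurable_box R n (fun=> `[u, v]%classic)) => i; exact: measurable_itv.
have boxfin u v : (u < v)%R -> 0 < beta n (box u v) < +oo.
  move=> uv; rewrite boxE; apply: prode_gt0_lty => i.
  by rewrite /= lebesgue_measure_itv/= lte_fin uv -EFinB lte_fin subr_gt0 uv ltry.
apply/andP; split.
  have c0 : (0 < (n%:R + 1 : R)^-1)%R by rewrite invr_gt0 ltr_wpDl.
  have /andP[b0 _] := boxfin _ _ c0.
  apply: (lt_le_trans b0).
  apply: le_measure; rewrite ?inE//; first exact: measurable_unit_ball.
  move=> w bw; rewrite /unit_ball/= /rdot.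
  apply: (@le_trans _ _ (\sum_(i < n) (n%:R + 1)^-1)%R).
    apply: ler_sum => i _; have := bw i; rewrite /= in_itv/= => /andP[w0 w1].
    rewrite -[leRHS]mul1r ler_pM//; apply: le_trans w1 _.
    by case/andP: c1.
  rewrite sumr_const card_ord -[leLHS]mulr_natl ler_pdivrMr ?ltr_wpDl// mul1r.
  by rewrite lerDl.
have N11 : (-1 < 1 :> R)%R by lra.
have /andP[_ b1] := boxfin _ _ N11.
apply: (le_lt_trans _ b1).
apply: le_measure; rewrite ?inE//; first exact: measurable_unit_ball.
move=> w; rewrite /unit_ball/= => bw i; rewrite /= in_itv/= -ler_norml.
rewrite -(@ler_pXn2r _ 2) ?nnegrE// expr1n real_normK ?num_real//.
apply: le_trans bw; rewrite /rdot (bigD1 i)//= -expr2 lerDl.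
by apply: sumr_ge0 => j _; rewrite -expr2 sqr_ge0.
Qed.

(* Two translation-invariant measures are proportional (by Fubini); the unit ball
   determines the factor. *)
Lemma ge0_integral_similarity n (T : 'rV[R]_n -> 'rV[R]_n) (r : R)
    (F : 'rV[R]_n -> \bar R) :
  (0 < r)%R -> (forall x y, T (x + y) = T x + T y)%R ->
  (forall y, exists x, T x = y) -> measurable_fun setT T ->
  (forall x, rdot (T x) (T x) = r ^+ 2 * rdot x x)%R ->
  measurable_fun setT F -> (forall x, 0 <= F x) ->
  \int[beta n]_x F x = (r ^+ n)%:E * \int[beta n]_x F (T x).
Proof.
move=> r0 TD Tsurj mT Tdot mF F0.
pose K := beta n (@unit_ball n).
have [g g0 [mg gE gT]] : exists2 g : 'rV[R]_n -> \bar R, forall x, 0 <= g x &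
    [/\ measurable_fun setT g, \int[beta n]_x g x = K & forall x, g (T x) = g (r *: x)%R].
  exists (fun x => (\1_(@unit_ball n) x)%:E); first by move=> x; rewrite lee_fin.
  split=> [||x].
  - by apply/measurable_EFinP; apply: measurable_indic; exact: measurable_unit_ball.
  - by rewrite integral_indic ?setIT//; exact: measurable_unit_ball.
  - rewrite !indicE; have -> // : (T x \in @unit_ball n) = (r *: x \in @unit_ball n)%R.
    by apply/idP/idP; rewrite !inE /unit_ball/= rdotZl rdotZr mulrA -expr2 Tdot.
have mTF G : measurable_fun setT G -> measurable_fun setT (fun x => G (T x) : \bar R).
  by move=> mG; exact: (measurableT_comp mG).
have msum : measurable_fun setT (fun z : 'rV[R]_n * 'rV[R]_n => z.2 + T z.1)%R.
  apply/measurable_fun_rowP => i; under eq_fun do rewrite mxE.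
  apply: measurable_funD.
    by apply: (measurableT_comp (measurable_coord i)).
  apply: (measurableT_comp (measurable_coord i)); exact: (measurableT_comp mT).
have mdif : measurable_fun setT (fun z : 'rV[R]_n * 'rV[R]_n => T z.1 - z.2)%R.
  apply/measurable_fun_rowP => i; under eq_fun do rewrite !mxE.
  apply: measurable_funB.
    by apply: (measurableT_comp (measurable_coord i)); exact: (measurableT_comp mT).
  exact: (measurableT_comp (measurable_coord i)).
(* [A] integrates to K times the integral of F o T. The substitution x -> x + s with T s = -y turns
   it into [B], which integrates to the integral of g o T times that of F. As g depends on length
   only, g(T x) = g(r x), so K is r^n times the integral of g o T. *)
pose A (z : 'rV[R]_n * 'rV[R]_n) := F (T z.1) * g (z.2 + T z.1)%R.
have mA : measurable_fun setT A.
  apply: emeasurable_funM; last exact: (measurableT_comp mg msum).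
  exact: (measurableT_comp (mTF _ mF) measurable_fst).
have A0 z : 0 <= A z by rewrite mule_ge0.
pose B (z : 'rV[R]_n * 'rV[R]_n) := g (T z.1) * F (T z.1 - z.2)%R.
have mB : measurable_fun setT B.
  apply: emeasurable_funM; last exact: (measurableT_comp mF mdif).
  exact: (measurableT_comp (mTF _ mg) measurable_fst).
have B0 z : 0 <= B z by rewrite mule_ge0.
have E1 : \int[beta n]_x \int[beta n]_y A (x, y) = \int[beta n]_x F (T x) * K.
  rewrite -ge0_integralZr//; last 2 first.
  - exact: mTF.
  - exact: measure_ge0.
  apply: eq_integral => x _; rewrite /A/= ge0_integralZl//.
    by rewrite -(ge0_integral_row_shift (T x) mg)// gE.
  by apply: (measurableT_comp mg); exact: measurable_row_shift.
have E2 : \int[beta n]_y \int[beta n]_x A (x, y) = \int[beta n]_y \int[beta n]_x B (x, y).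
  apply: eq_integral => y _; have [s Ts] := Tsurj (- y)%R.
  rewrite (ge0_integral_row_shift s)//; last first.
    exact: (measurableT_comp mA (pair2_measurable y)).
  apply: eq_integral => x _; rewrite /A/= /B/= TD Ts muleC; congr (g _ * _).
  by rewrite addrC subrK.
have E3 : \int[beta n]_x \int[beta n]_y B (x, y) =
    \int[beta n]_x g (T x) * \int[beta n]_x F x.
  have I0 : 0 <= \int[beta n]_x F x by exact: integral_ge0.
  have Z := ge0_integralZr (beta n) measurableT (mTF g mg) (fun x _ => g0 (T x)) I0.
  rewrite -[RHS]Z.
  apply: eq_integral => x _; rewrite /B/= ge0_integralZl//; last first.
    by apply: (measurableT_comp mF); exact: (measurableT_comp mdif (pair1_measurable x)).
  congr (_ * _); rewrite (ge0_integral_row_shift (T x) mF)//.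
  have N10 : (-1 : R)%R != 0%R by rewrite oppr_eq0 oner_eq0.
  rewrite [RHS](ge0_integral_row_scale N10)//; last first.
    by apply: (measurableT_comp mF); exact: measurable_row_shift.
  rewrite normrN normr1 expr1n mul1e; apply: eq_integral => y _.
  by rewrite scaleN1r addrC.
have KE : K = (r ^+ n)%:E * \int[beta n]_x g (T x).
  rewrite -gE (ge0_integral_row_scale (lt0r_neq0 r0))// gtr0_norm//; congr (_ * _).
  by apply: eq_integral => x _; rewrite gT.
apply: (@mule_posI _ K); first exact: unit_ball_gt0_lty.
rewrite [RHS]muleCA [X in _ = _ * X]muleC -E1 (fubini_tonelli A mA A0) E2.
rewrite -(fubini_tonelli B mB B0) E3 muleA -KE.
reflexivity.
Qed.

End Similarity.

(** * The inversion x -> x/|x|^2 and the measure of R^n *)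

Section Inversion.
Context {R : realType}.
Local Open Scope ereal_scope.
Notation lam := (@lebesgue_measure R).
Notation beta := (@borel_lebesgue R).

Definition row_inv n (x : 'rV[R]_n) : 'rV[R]_n := ((rdot x x)^-1 *: x)%R.

Lemma measurable_row_inv n : measurable_fun setT (@row_inv n).
Proof.
apply/measurable_fun_rowP => i; under eq_fun do rewrite mxE.
apply: measurable_funM; last exact: measurable_coord.
by apply: measurable_funVr; exact: measurable_rdot.
Qed.

Lemma rdot_cons n (t : R) (v : 'rV[R]_n) :
  rdot (row_cons (t, v)) (row_cons (t, v)) = (t ^+ 2 + rdot v v)%R.
Proof.
rewrite /rdot big_ord_recl row_cons0 expr2; congr (_ + _)%R.
by apply: eq_bigr => i _; rewrite row_consS.
Qed.

Lemma measurable_cone n :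
  measurable_fun setT (fun z : R * 'rV[R]_n => row_cons (z.1, z.1 *: z.2)%R).
Proof.
apply/measurable_fun_rowP => i; have [j ->|->] := unliftP ord0 i.
  under eq_fun do rewrite row_consS mxE.
  by apply: measurable_funM => //; apply: (measurableT_comp (measurable_coord j)).
under eq_fun do rewrite row_cons0; exact: measurable_fst.
Qed.

(* The projective coordinates (t, u) of the point (t, t u). *)
Lemma ge0_integral_cone n (F : 'rV[R]_n.+1 -> \bar R) :
  measurable_fun setT F -> (forall x, 0 <= F x) ->
  \int[beta n.+1]_x F x =
  \int[beta n]_u \int[lam]_t ((`|t| ^+ n)%:E * F (row_cons (t, t *: u)%R)).
Proof.
move=> mF F0; pose A (z : R * 'rV[R]_n) := (`|z.1| ^+ n)%:E * F (row_cons (z.1, z.1 *: z.2)%R).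
have A0 z : 0 <= A z by rewrite mule_ge0// lee_fin exprn_ge0.
have mA : measurable_fun setT A.
  apply: emeasurable_funM; last exact: (measurableT_comp mF (@measurable_cone n)).
  apply/measurable_EFinP; apply: measurable_funX.
  exact: (measurableT_comp (@normr_measurable R setT)).
rewrite -(@fubini_tonelli _ _ (measurableTypeR R) 'rV[R]_n R lam (beta n) A)//.
rewrite ge0_integral_cons//; apply: ge0_ae_eq_integral => //.
- exact: measurable_integral_cons.
- exact: (measurable_fun_fubini_tonelli_F _ mA).
- by move=> t _; exact: integral_ge0.
- by move=> t _; exact: integral_ge0.
exists [set 0%R]; split => //; first exact: lebesgue_measure_set1.
move=> t /=; apply: contra_notP => /eqP t0 _.
rewrite (ge0_integral_row_scale t0)//; last exact: measurable_fun_cons1.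
rewrite -ge0_integralZl//.
apply: (measurableT_comp (measurable_fun_cons1 t mF)).
exact: measurable_row_scale.
Qed.

(** At x = (t, t u) one has |x|^2 = k t^2 with k = 1 + |u|^2, and the inversion fixes u and sends t
    to 1/(k t). For each u it is thus a scaling by k followed by the inversion of the line. *)
Lemma ge0_integral_row_inv n (F : 'rV[R]_n.+1 -> \bar R) :
  measurable_fun setT F -> (forall x, 0 <= F x) ->
  \int[beta n.+1]_x F x =
  \int[beta n.+1]_x (F (row_inv x) * (rdot x x ^- n.+1)%:E).
Proof.
move=> mF F0; have J0 (x : 'rV[R]_n.+1) : 0 <= (rdot x x ^- n.+1)%:E.
  by rewrite lee_fin invr_ge0 exprn_ge0// rdot_ge0.
rewrite ge0_integral_cone// [RHS]ge0_integral_cone//; last 2 first.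
- apply: emeasurable_funM; first exact: (measurableT_comp mF (@measurable_row_inv n.+1)).
  by apply/measurable_EFinP; apply: measurable_funVr; apply: measurable_funX; exact: measurable_rdot.
- by move=> x; exact: mule_ge0.
apply: eq_integral => u _; pose k := (1 + rdot u u)%R.
have k0 : (0 < k)%R by rewrite ltr_pwDl// rdot_ge0.
pose phi (t : R) := (`|t| ^+ n)%:E * F (row_cons (t, t *: u)%R).
have phi0 t : 0 <= phi t by rewrite mule_ge0// lee_fin exprn_ge0.
have mphi : measurable_fun setT phi.
  apply: emeasurable_funM.
    by apply/measurable_EFinP; apply: measurable_funX; exact: normr_measurable.
  exact: (measurableT_comp mF (measurableT_comp (@measurable_cone n) (pair2_measurable u))).
have mphiV : measurable_fun setT (fun x : R => phi x^-1%R * (`|x| ^- 2)%:E).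
  apply: emeasurable_funM; first exact: (measurableT_comp mphi measurable_invr).
  by apply/measurable_EFinP; apply: measurable_funVr; apply: measurable_funX; exact: normr_measurable.
have phiV0 x : 0 <= phi x^-1%R * (`|x| ^- 2)%:E.
  by rewrite mule_ge0// lee_fin invr_ge0 exprn_ge0.
rewrite -[LHS]/(\int[lam]_t phi t) ge0_integral_inv//.
rewrite (ge0_integral_scale (lt0r_neq0 k0))// -ge0_integralZl//; last first.
  exact: (measurableT_comp mphiV (measurable_scale k)).
apply: eq_integral => t _; rewrite /phi.
have dE : rdot (row_cons (t, t *: u)%R) (row_cons (t, t *: u)%R) = (k * t ^+ 2)%R.
  by rewrite rdot_cons rdotZl rdotZr /k; ring.
have -> : row_inv (row_cons (t, t *: u)%R) = row_cons ((k * t)^-1, (k * t)^-1 *: u)%R.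
  rewrite /row_inv dE row_consZ/= scalerA.
  suff -> : ((k * t ^+ 2)^-1 * t = (k * t)^-1)%R by [].
  have [->|t0] := eqVneq t 0%R; first by rewrite !mulr0 invr0.
  by field; rewrite t0 gt_eqF.
rewrite dE; set E := F _.
rewrite [_%:E * E]muleC -[E * _ * _]muleA [LHS]muleCA [RHS]muleCA; congr (_ * _).
rewrite -!EFinM; congr EFin; rewrite gtr0_norm// normfV normrM gtr0_norm//.
rewrite -[(t ^+ 2)%R]real_normK ?num_real//; have [->|t0] := eqVneq t 0%R.
  by rewrite normr0 mulr0 !expr0n/= mulr0 ?expr0n/= !invr0 !mulr0.
move: t0; rewrite -normr_eq0; move: `|t|%R => s s0.
have -> : ((k * s)^-1 ^+ n = (k ^+ n * s ^+ n)^-1)%R by rewrite exprVn exprMn.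
have -> : ((k * s ^+ 2) ^+ n.+1 = k * s ^+ 2 * (k ^+ n * (s ^+ n) ^+ 2))%R.
  by rewrite exprS exprMn -[(s ^+ 2 ^+ n)%R]exprM mulnC exprM.
have kn0 : (k ^+ n != 0)%R by rewrite expf_neq0// gt_eqF.
have sn0 : (s ^+ n != 0)%R by rewrite expf_neq0.
move: (k ^+ n)%R (s ^+ n)%R kn0 sn0 => a b a0 b0.
by field; rewrite a0 b0 s0 gt_eqF.
Qed.

End Inversion.

(** * Changes of variables on the completion *)

Section WeightedImage.
Local Open Scope ereal_scope.
Context d1 d2 (X : measurableType d1) (Y : measurableType d2) (R : realType).
Variables (mu : {measure set X -> \bar R}) (nu : {measure set Y -> \bar R}).
Variables (phi : X -> Y) (J : X -> R).
Hypotheses (mJ : measurable_fun setT J) (J0 : forall x, (0 <= J x)%R).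
Hypothesis mphi : forall A, measurable A -> measurable (phi @^-1` A `&` [set x | (0 < J x)%R]).
Hypothesis nuE : forall A, measurable A -> nu A = \int[mu]_x ((\1_A (phi x))%:E * (J x)%:E).

Import HBNNSimple.

(** Preimages under [phi] are controlled only where J > 0. Elsewhere J = 0 annihilates the product,
    so F o phi may be replaced by its restriction. *)
Lemma measurable_weighted (F : Y -> \bar R) : measurable_fun setT F ->
  measurable_fun setT (fun x => F (phi x) * (J x)%:E).
Proof.
move=> mF; pose O := [set x | (0 < J x)%R].
have mO : measurable O by have := mphi measurableT; rewrite preimage_setT setTI.
have -> : (fun x => F (phi x) * (J x)%:E) = (fun x => ((F \o phi) \_ O) x * (J x)%:E).
  apply/funext => x; rewrite patchE; case: ifPn => //; rewrite notin_setE => /negP.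
  rewrite -leNgt => Jx; have /eqP -> : J x == 0%R by rewrite eq_le Jx J0.
  by rewrite !mule0.
apply: emeasurable_funM; last exact/measurable_EFinP.
apply/(measurable_restrictT _ mO) => _ A mA.
rewrite setIC comp_preimage; apply: mphi; rewrite -[X in measurable X]setTI; exact: mF.
Qed.

(** From indicators to simple functions by linearity, then to F by monotone convergence on both
    sides. *)
Lemma ge0_integral_weighted (F : Y -> \bar R) :
  measurable_fun setT F -> (forall y, 0 <= F y) ->
  \int[nu]_y F y = \int[mu]_x (F (phi x) * (J x)%:E).
Proof.
move=> mF F0; pose f_ := nnsfun_approx measurableT mF.
have f_F y : EFin \o f_ ^~ y @ \oo --> F y by apply: cvg_nnsfun_approx.
have mf_ k : measurable_fun setT (fun y => (f_ k y)%:E) by exact/measurable_EFinP/measurable_funP.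
transitivity (limn (fun k => \int[nu]_y (f_ k y)%:E)).
  rewrite -monotone_convergence//.
  - by apply: eq_integral => y _; apply/esym/cvg_lim => //; exact: f_F.
  - by move=> n y _; rewrite lee_fin.
  - by move=> y _ m n mn; rewrite lee_fin; exact/lefP/nd_nnsfun_approx.
transitivity (limn (fun k => \int[mu]_x ((f_ k (phi x))%:E * (J x)%:E))); last first.
  rewrite -monotone_convergence//.
  - apply: eq_integral => x _; apply/cvg_lim => //.
    by apply: cvgeZr => //; exact: f_F.
  - by move=> k; apply: (measurable_weighted (mf_ k)).
  - by move=> n x _; rewrite mule_ge0// lee_fin.
  - move=> x _ m n mn; rewrite lee_wpmul2r ?lee_fin//.
    exact/lefP/nd_nnsfun_approx.
congr (limn _); apply/funext => k; move: (f_ k) => f.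
have f0 r y : 0 <= (r * \1_(f @^-1` [set r]) y)%:E.
  rewrite lee_fin indicE; case: (boolP (y \in _)) => [|_]; last by rewrite mulr0.
  by rewrite inE/= => <-; rewrite mulr1.
transitivity (\sum_(r \in range f) \int[nu]_y (r * \1_(f @^-1` [set r]) y)%:E).
  under eq_integral do rewrite fimfunE -fsumEFin//.
  rewrite ge0_integral_fsum//.
  - by move=> r; exact/measurable_EFinP/measurable_funM.
transitivity (\sum_(r \in range f)
    \int[mu]_x ((r * \1_(f @^-1` [set r]) (phi x))%:E * (J x)%:E)); last first.
  rewrite -ge0_integral_fsum//.
  - apply: eq_integral => x _; rewrite [in RHS]fimfunE -fsumEFin//.
    by rewrite ge0_mule_fsuml.
  - move=> r; apply: (@measurable_weighted (fun y => (r * \1_(f @^-1` [set r]) y)%:E)).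
    exact/measurable_EFinP/measurable_funM.
  - by move=> r x _; rewrite mule_ge0// lee_fin.
apply: eq_fsbigr => r /[!inE] -[y _ fyr].
have r0 : (0 <= r)%R by rewrite -fyr.
have mA : measurable (f @^-1` [set r]) by [].
under eq_integral do rewrite EFinM.
rewrite ge0_integralZl// ?lee_fin//; last exact/measurable_EFinP/measurable_indic.
rewrite integral_indic// setIT nuE// -ge0_integralZl//.
- by apply: eq_integral => x _; rewrite EFinM muleA.
- by apply: (@measurable_weighted (fun y => (\1_(f @^-1` [set r]) y)%:E));
    exact/measurable_EFinP/measurable_indic.
- by move=> x _; rewrite mule_ge0// lee_fin.
Qed.

End WeightedImage.

(** * Measurable sets of the completed measure *)

Section Completion.
Local Open Scope ereal_scope.
Context d (T : measurableType d) (R : realType).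
Variable mu : {sigma_finite_measure set T -> \bar R}.
Notation cT := (caratheodory_type (mu^*)%mu).
Notation cmu := (@completed_measure_extension _ _ _ mu).

Lemma sub_completion (A : set T) : measurable A -> measurable (A : set cT).
Proof. by move=> mA; apply: sub_caratheodory; exact: sub_sigma_algebra. Qed.

Lemma completionE (A : set T) : measurable A -> cmu A = mu A.
Proof. by move=> mA; exact: measurable_mu_extE. Qed.

Lemma completion_negligible (N M : set T) : measurable N -> mu N = 0 -> M `<=` N ->
  measurable (M : set cT).
Proof.
move=> mN N0 MN; apply: measure_is_complete_caratheodory.
exists N; split => //; first exact: sub_completion.
by rewrite -[LHS]/(cmu N) completionE.
Qed.

(** Intersect measurable sets containing E whose measures come within 1/(k+1) of the outer measure;
    if the latter is infinite, the whole space serves. *)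
Lemma measurable_hull (E : set T) :
  exists B, [/\ measurable B, E `<=` B & mu B = (mu^*)%mu E].
Proof.
have [Eoo|Efin] := eqVneq ((mu^*)%mu E) +oo.
  exists setT; split => //; rewrite Eoo; apply/eqP.
  by rewrite -leye_eq -Eoo -[leRHS]completionE//; exact: le_outer_measure.
have Ef : (mu^*)%mu E \is a fin_num by rewrite ge0_fin_numE ?outer_measure_ge0// ltey.
have /choice[B PB] : forall k : nat, exists B, [/\ measurable B, E `<=` B &
    mu B <= (mu^*)%mu E + (k.+1%:R^-1)%:E].
  move=> k; have k0 : (0 < k.+1%:R^-1 :> R)%R by [].
  have [_ /= [A [mA EA] <-] /ltW AE] := lb_ereal_inf_adherent k0 Ef.
  exists (\bigcup_i A i); split => //; first exact: bigcup_measurable.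
  by apply: le_trans AE; apply: measure_sigma_subadditive => //; exact: bigcup_measurable.
have mB : measurable (\bigcap_k B k) by apply: bigcap_measurable => // k _; have [] := PB k.
exists (\bigcap_k B k); split => //; first by move=> x Ex k _; have [_ EB _] := PB k; exact: EB.
apply/eqP; rewrite eq_le; apply/andP; split; last first.
  rewrite -[leRHS]completionE//; apply: le_outer_measure => x Ex k _.
  by have [_ EB _] := PB k; exact: EB.
apply/lee_addgt0Pr => e e0; have [k _ ke] := near_infty_natSinv_lt (PosNum e0).
apply: (@le_trans _ _ (mu (B k))).
  by apply: le_measure; rewrite ?inE//; [have [] := PB k|exact: bigcap_inf].
have [_ _] := PB k; move=> /le_trans; apply; rewrite leeD2l// lee_fin ltW//.
exact: (ke k (leqnn k)).
Qed.

(** On a piece of finite measure, take a hull B of E. Splitting B along E by the Caratheodory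
    property leaves outer measure 0 for B \ E, because the measures are finite and can be
    subtracted; N is a hull of B \ E. Sigma-finiteness gives countably many such pieces. *)
Lemma completion_ae (E : set T) : measurable (E : set cT) ->
  exists B N, [/\ measurable B, measurable N, mu N = 0, E `<=` B & B `\` E `<=` N].
Proof.
move=> mE; have [S ST Sfin] := sigma_finiteT mu.
have mS i : measurable (S i) by have [] := Sfin i.
have PB i : exists BN : set T * set T, [/\ measurable BN.1, measurable BN.2,
    mu BN.2 = 0, E `&` S i `<=` BN.1 & BN.1 `\` (E `&` S i) `<=` BN.2].
  have [B [mB EB muB]] := measurable_hull (E `&` S i).
  have [N [mN BN muN]] := measurable_hull (B `\` (E `&` S i)).
  exists (B, N); split => //=; rewrite muN.
  have mES : measurable (E `&` S i : set cT) by apply: measurableI => //; exact: sub_completion.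
  have ESfin : (mu^*)%mu (E `&` S i) \is a fin_num.
    rewrite ge0_fin_numE ?outer_measure_ge0//; apply: (@le_lt_trans _ _ (mu (S i))).
      rewrite -[leRHS]completionE//; apply: le_outer_measure; exact: subIsetr.
    by have [] := Sfin i.
  have : (mu^*)%mu (E `&` S i) =
      (mu^*)%mu (E `&` S i) + (mu^*)%mu (B `\` (E `&` S i)).
    have := mES B; rewrite setIidr// => <-.
    by rewrite -muB -completionE.
  move: ((mu^*)%mu (E `&` S i)) ESfin => [a| |]// _.
  by case: ((mu^*)%mu (B `\` _)) => [b| |]//= -[ab]; have -> : b = 0%R by lra.
have /choice[BN {}PB] := PB.
exists (\bigcup_i (BN i).1), (\bigcup_i (BN i).2); split.
- by apply: bigcup_measurable => i _; have [] := PB i.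
- by apply: bigcup_measurable => i _; have [] := PB i.
- apply/eqP; rewrite eq_le measure_ge0 andbT.
  apply: (@le_trans _ _ (\sum_(i <oo) mu (BN i).2)).
    apply: measure_sigma_subadditive => // [i|]; first by have [] := PB i.
    by apply: bigcup_measurable => i _; have [] := PB i.
  by rewrite eseries0// => i _ _; have [] := PB i.
- move=> x Ex; have : [set: T] x by []; rewrite ST => -[i _ Six].
  by exists i => //; have [_ _ _ EB _] := PB i; apply: EB.
- move=> x [[i _ Bx] NEx]; exists i => //; have [_ _ _ _ BE] := PB i.
  by apply: BE; split => // -[].
Qed.

End Completion.

(** * Carrying a change of variables to the completion *)

Section CompletionChange.
Local Open Scope ereal_scope.
Context d (T : measurableType d) (R : realType).
Variable mu : {sigma_finite_measure set T -> \bar R}.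
Notation cT := (caratheodory_type (mu^*)%mu).
Notation cmu := (@completed_measure_extension _ _ _ mu).
Variables (phi : T -> T) (J : T -> R).
Hypotheses (mphi : measurable_fun setT phi) (mJ : measurable_fun setT J).
Hypothesis J0 : forall x, (0 <= J x)%R.
Hypothesis phiJ : forall F : T -> \bar R, measurable_fun setT F -> (forall x, 0 <= F x) ->
  \int[mu]_x F x = \int[mu]_x (F (phi x) * (J x)%:E).

Lemma measurable_fun_completion d' (Y : measurableType d') (f : T -> Y) :
  measurable_fun setT f -> measurable_fun [set: cT] (f : cT -> Y).
Proof. by move=> mf _ A mA; apply: sub_completion; exact: mf. Qed.

Lemma ge0_integral_completion (F : T -> \bar R) :
  measurable_fun setT F -> (forall x, 0 <= F x) -> \int[cmu]_x F x = \int[mu]_x F x.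
Proof.
move=> mF F0; have mid : measurable_fun [set: cT] (id : cT -> T).
  by apply: measurable_fun_completion; exact: measurable_id.
have [m [mE mI]] := image_measure cmu mid.
rewrite -[LHS]mI//; apply: eq_measure_integral => A mA _.
by rewrite mE preimage_id; exact: completionE.
Qed.

Let Jpos := [set x | (0 < J x)%R].

Let mJpos : measurable Jpos.
Proof.
have -> : Jpos = [set: T] `&` J @^-1` `]0%R, +oo[.
  by apply/seteqP; split=> x; rewrite /Jpos/= in_itv/= andbT; [|case].
exact: (mJ measurableT (@measurable_itv _ `]0%R, +oo[)).
Qed.

(** Where J = 0 the map could collapse a large set onto a null set, hence the intersection with J >
    0: the integral of 1_N o phi times J is mu N = 0. *)
Let preimage_null (N : set T) : measurable N -> mu N = 0 ->
  measurable (phi @^-1` N `&` Jpos) /\ mu (phi @^-1` N `&` Jpos) = 0.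
Proof.
move=> mN N0; have mpN : measurable (phi @^-1` N `&` Jpos).
  by apply: measurableI => //; rewrite -[X in measurable X]setTI; exact: mphi.
split=> //; pose f x := (\1_N (phi x))%:E * (J x)%:E.
have m1 : measurable_fun setT (fun y => (\1_N y : R)%:E).
  by apply/measurable_EFinP; exact: measurable_indic.
have mf : measurable_fun setT f.
  apply: emeasurable_funM; last exact/measurable_EFinP.
  exact: (measurableT_comp m1 mphi).
have f0 x : 0 <= f x by rewrite mule_ge0// lee_fin.
have : \int[mu]_x `|f x| = 0.
  under eq_integral do rewrite gee0_abs//.
  rewrite -[LHS](phiJ m1); last by move=> x; rewrite lee_fin.
  by rewrite integral_indic// setIT.
move=> /(ae_eq_integral_abs mu measurableT mf)[M [mM M0 fM]].
apply/eqP; rewrite eq_le measure_ge0 andbT -M0; apply: le_measure; rewrite ?inE//.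
move=> x [/= Nx Jx]; apply: fM => /=; move/(_ Logic.I); rewrite /f indicE mem_set//.
by rewrite mul1e => -[] J00; move: Jx; rewrite /Jpos/= J00 ltxx.
Qed.

(** A is a measurable B minus the part B \ A of a null set; where J > 0, the preimage of that part
    is negligible, hence measurable in the completion. *)
Lemma measurable_completion_preimage (A : set cT) : measurable A ->
  measurable (phi @^-1` A `&` Jpos : set cT).
Proof.
move=> mA; have [B [N [mB mN N0 AB BN]]] := completion_ae mA.
have [mpN pN0] := preimage_null mN N0.
have -> : phi @^-1` A `&` Jpos = (phi @^-1` B `&` Jpos) `\` (phi @^-1` (B `\` A) `&` Jpos).
  apply/seteqP; split=> x /= [].
    by move=> Ax Ox; split; [split=> //; exact: AB|case; case].
  move=> [Bx Ox] nBA; split=> //; apply: contrapT => nA; exact: nBA.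
apply: measurableD.
  apply: sub_completion; apply: measurableI => //.
  by rewrite -[X in measurable X]setTI; exact: mphi.
apply: completion_negligible mpN pN0 _ => x [/= BAx Ox]; split=> //.
exact: BN.
Qed.

(** Replacing A by the measurable B changes neither side: the two differ only within N on the left,
    and within the preimage of N where J > 0 on the right. *)
Lemma completion_weighted (A : set cT) : measurable A ->
  cmu A = \int[cmu]_x ((\1_A (phi x))%:E * (J x)%:E).
Proof.
move=> mA; have [B [N [mB mN N0 AB BN]]] := completion_ae mA.
have [mpN pN0] := preimage_null mN N0.
have m1 (C : set cT) : measurable C -> measurable_fun [set: cT] (fun y => (\1_C y : R)%:E).
  by move=> mC; apply/measurable_EFinP; exact: measurable_indic.
have mJc : measurable_fun [set: cT] (J : cT -> R) by exact: measurable_fun_completion.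
have mw (C : set cT) : measurable C ->
    measurable_fun [set: cT] (fun x : cT => (\1_C (phi x) : R)%:E * (J x)%:E).
  move=> mC; exact: (@measurable_weighted _ _ cT cT R phi J mJc J0
    measurable_completion_preimage _ (m1 C mC)).
have -> : cmu A = cmu B.
  apply/eqP; rewrite eq_le; apply/andP; split; first exact: le_outer_measure.
  apply: (@le_trans _ _ (cmu (A `|` N))).
    apply: le_outer_measure => x Bx; have [Ax|nA] := pselect (A x); first by left.
    by right; exact: BN.
  apply: le_trans (outer_measureU2 _ _ _) _.
  by rewrite -[X in _ + X]/(cmu N) completionE// N0 adde0.
rewrite completionE//.
have mB1 : measurable_fun setT (fun y : T => (\1_B y : R)%:E).
  by apply/measurable_EFinP; exact: measurable_indic.
transitivity (\int[mu]_x (\1_B x)%:E); first by rewrite integral_indic// setIT.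
rewrite phiJ//.
rewrite -ge0_integral_completion; last 2 first.
- apply: emeasurable_funM; last exact/measurable_EFinP.
  exact: (measurableT_comp mB1 mphi).
- by move=> x; rewrite mule_ge0// lee_fin.
apply: ge0_ae_eq_integral.
- exact: measurableT.
- by apply: mw; exact: sub_completion.
- exact: mw.
- by move=> x _; rewrite mule_ge0// lee_fin.
- by move=> x _; rewrite mule_ge0// lee_fin.
exists (phi @^-1` N `&` Jpos); split.
- exact: sub_completion.
- by rewrite -[LHS]/(cmu _) completionE.
move=> x /=; apply: contra_notP => nNJ _.
have [Jx|/negP] := pselect (0 < J x)%R; last first.
  by rewrite -leNgt => Jx; have /eqP -> : J x == 0%R; rewrite ?mule0// eq_le Jx J0.
rewrite !indicE; congr (_%:R%:E * _); congr nat_of_bool.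
apply/idP/idP; rewrite !inE; last exact: AB.
move=> Bx; apply: contrapT => nA; apply: nNJ; split => //; exact: BN.
Qed.

Lemma ge0_integral_completion_change (F : cT -> \bar R) :
  measurable_fun [set: cT] F -> (forall x, 0 <= F x) ->
  \int[cmu]_x F x = \int[cmu]_x (F (phi x) * (J x)%:E).
Proof.
exact: (@ge0_integral_weighted _ _ cT cT R cmu cmu phi J (measurable_fun_completion mJ) J0
  measurable_completion_preimage completion_weighted F).
Qed.

End CompletionChange.

(** * The Dirac operator *)

Section RowTopology.
Variables (R : realType) (n : nat).
Implicit Types (O : set 'rV[R]_n) (g : 'rV[R]_n -> R).

(** Measurability refers to the product sigma-algebra, openness to the norm. An open set is the
    countable union of the cubes of rational centre and radius that it contains. *)
Lemma open_measurable_row O : open O -> measurable O.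
Proof.
move=> Oo; pose box (qr : 'rV[rat]_n * rat) : set 'rV[R]_n :=
  [set v | forall i, (ball (ratr (qr.1 ord0 i) : R) (ratr qr.2 : R) : set R) (v ord0 i)].
pose F qr := if `[< box qr `<=` O >] then box qr else set0.
have -> : O = \bigcup_qr F qr.
  apply/seteqP; split=> [x Ox|x [qr _]]; last by rewrite /F; case: asboolP => // + bx; exact.
  have /nbhs_ballP[e /= e0 xO] : nbhs x O by exact: open_nbhs_nbhs.
  have [r] := @rat_in_itvoo R 0 (e / 2) (divr_gt0 e0 (ltr0Sn _ _)).
  rewrite in_itv/= => /andP[r0 re].
  have /choice[q qP] : forall i : 'I_n, exists q : rat, `|x ord0 i - ratr q| < ratr r.
    move=> i; have [q] := @rat_in_itvoo R (x ord0 i - ratr r) (x ord0 i + ratr r) ltac:(lra).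
    by rewrite in_itv/= => qx; exists q; rewrite ltr_norml; lra.
  have bx : box (\row_i q i, r) x by move=> i; rewrite /= mxE /ball/= distrC.
  exists (\row_i q i, r) => //; rewrite /F; case: asboolP => // bO; exfalso; apply: bO.
  move=> y yb; apply: xO; rewrite -ball_normE/=.
  apply: (@le_lt_trans _ _ (ratr r + ratr r)); last by lra.
  apply/row_normP => [|i]; first by lra.
  rewrite !mxE (_ : x ord0 i - y ord0 i =
    (x ord0 i - ratr (q i)) + (ratr (q i) - y ord0 i)); last by ring.
  apply: le_trans (ler_normD _ _) _; apply: lerD; first exact: ltW (qP i).
  by have := yb i; rewrite /= mxE /ball/= => /ltW.
apply: countable_bigcupT_measurable => // qr; rewrite /F; case: asboolP => // _.
by apply: (@measurable_box R n (fun i => ball (ratr (qr.1 ord0 i) : R) (ratr qr.2 : R)));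
  move=> i; exact: measurable_ball.
Qed.

Lemma closed_measurable_row (K : set 'rV[R]_n) : closed K -> measurable K.
Proof. by move=> /closed_openC/open_measurable_row/measurableC; rewrite setCK. Qed.

Lemma compact_closed_row (K : set 'rV[R]_n) : compact K -> closed K.
Proof. by apply: compact_closed; exact: norm_hausdorff. Qed.

Lemma open_continuous_preimage (T : topologicalType) O (f : 'rV[R]_n -> T) (B : set T) :
  open O -> (forall x, O x -> {for x, continuous f}) -> open B -> open (O `&` f @^-1` B).
Proof.
move=> Oo cf Bo; rewrite openE => x [Ox Bfx]; rewrite /interior.
apply: filterI; first exact: open_nbhs_nbhs.
by apply: (cf x Ox); exact: open_nbhs_nbhs.
Qed.

Lemma continuous_measurable_row O g : open O ->
  (forall x, O x -> {for x, continuous g}) -> measurable_fun O g.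
Proof.
move=> Oo cg mO; apply: (measurability _ (RGenOpens.measurableE R)) => //.
move=> _ [_ [a [b ->] <-]]; apply: open_measurable_row.
by apply: open_continuous_preimage => //; exact: interval_open.
Qed.

End RowTopology.

Section CliffordCalculus.
Variables (R : realType) (n : nat).
Implicit Types (O : set 'rV[R]_n) (a b h : 'rV[R]_n -> Cl R n) (x : 'rV[R]_n).
Local Notation e j := (delta_mx ord0 j : 'rV[R]_n).

(** Structure constants: through them each coordinate of a product is a bilinear expression in real
    functions, which reduces calculus in Cl_n to real calculus. *)
Definition clstruct (A B C : {set 'I_n}) : R := clcoef (clbasis R A * clbasis R B) C.

Lemma clcoefM (u v : Cl R n) C : clcoef (u * v) C =
  \sum_A \sum_B clstruct A B C * (clcoef u A * clcoef v B).
Proof.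
rewrite {1}(clcoefE u) mulr_suml clcoef_sum; apply: eq_bigr => A _.
rewrite {1}(clcoefE v) mulr_sumr clcoef_sum; apply: eq_bigr => B _.
by rewrite -scalerAl -scalerAr !clcoefZ mulrA mulrC.
Qed.

Definition clCk k O h : Prop := forall A, Ck k O (fun x => clcoef (h x) A).

Definition clpartial j h x : Cl R n :=
  \sum_A partial j (fun y => clcoef (h y) A) x *: clbasis R A.

Lemma dirac_opE h x : dirac_op h x = \sum_j clgen R j * clpartial j h x.
Proof. by []. Qed.

Lemma clcoef_partial j h x A :
  clcoef (clpartial j h x) A = partial j (fun y => clcoef (h y) A) x.
Proof.
rewrite clcoef_sum (bigD1 A)//= big1 => [|B neBA].
  by rewrite clcoefZ clcoef_basis eqxx mulr1 addr0.
by rewrite clcoefZ clcoef_basis eq_sym (negPf neBA) mulr0.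
Qed.

Lemma eq_clpartial O h h' j x : open O -> O x -> (forall y, O y -> h y = h' y) ->
  clpartial j h x = clpartial j h' x.
Proof.
move=> Oo Ox hh'; apply: eq_bigr => A _; congr (_ *: _).
by apply: (eq_partial _ Oo) => // y Oy; rewrite hh'.
Qed.

Lemma eq_dirac_op O h h' x : open O -> O x -> (forall y, O y -> h y = h' y) ->
  dirac_op h x = dirac_op h' x.
Proof.
by move=> Oo Ox hh'; rewrite !dirac_opE; apply: eq_bigr => j _; rewrite (eq_clpartial _ Oo Ox hh').
Qed.

Lemma clCkM k O a b : open O -> clCk k O a -> clCk k O b ->
  clCk k O (fun x => a x * b x).
Proof.
move=> Oo ka kb C; under eq_fun do rewrite clcoefM.
apply: Ck_sum => // A; apply: Ck_sum => // B; apply: CkZ => //; exact: CkM.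
Qed.

Lemma is_derive_bigsum (V : normedModType R) (I : Type) (r : seq I)
    (F : I -> V -> R) (dF : I -> R) (x v : V) :
  (forall i, is_derive x v (F i) (dF i)) ->
  is_derive x v (fun y => \sum_(i <- r) F i y) (\sum_(i <- r) dF i).
Proof.
move=> FdF; elim: r => [|i r ih].
  by under eq_fun do rewrite big_nil; rewrite big_nil; exact: is_derive_cst.
under eq_fun do rewrite big_cons; rewrite big_cons.
exact: (@is_deriveD _ _ _ (F i)).
Qed.

Lemma clpartialM a b j x :
  (forall A, derivable (fun y => clcoef (a y) A) x (e j)) ->
  (forall A, derivable (fun y => clcoef (b y) A) x (e j)) ->
  clpartial j (fun y => a y * b y) x = clpartial j a x * b x + a x * clpartial j b x.
Proof.
move=> da db; apply: clP => C; rewrite clcoef_partial clcoefD !clcoefM -big_split/=.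
rewrite /partial; under eq_fun do rewrite clcoefM.
apply: derive_val; apply: is_derive_bigsum => A; rewrite -big_split/=.
apply: is_derive_bigsum => B; rewrite -mulrDr !clcoef_partial.
apply: is_derive_eq.
  apply: is_deriveZ; apply: is_deriveM; apply: derivableP; [exact: da|exact: db].
by rewrite addrC [clcoef (b x) B *: _]mulrC.
Qed.

Lemma clpartial_comp O' (psi : 'rV[R]_n -> 'rV[R]_n) h j x :
  open O' -> O' (psi x) -> clCk 1 O' h ->
  (forall i, derivable (fun y => psi y ord0 i) x (e j)) ->
  clpartial j (fun y => h (psi y)) x =
  \sum_i partial j (fun y => psi y ord0 i) x *: clpartial i h (psi x).
Proof.
move=> Oo' Opsi kh dpsi; apply: clP => A; rewrite clcoef_partial clcoef_sum.
under [RHS]eq_bigr do rewrite clcoefZ clcoef_partial.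
by apply: derive_val; exact: (is_derive_comp_row Oo' Opsi (kh A) dpsi).
Qed.

(** Product rule and chain rule. As the algebra is not commutative, [S] stays between [clgen R j]
    and the derivative of [h], while the derivatives of [S] assemble into [dirac_op S x]. *)
Lemma dirac_op_comp O O' (psi : 'rV[R]_n -> 'rV[R]_n) S h x :
  open O -> O x -> open O' -> (forall y, O y -> O' (psi y)) ->
  (forall i, Ck 1 O (fun y => psi y ord0 i)) -> clCk 1 O S -> clCk 1 O' h ->
  dirac_op (fun y => S y * h (psi y)) x = dirac_op S x * h (psi x) +
    \sum_i (\sum_j partial j (fun y => psi y ord0 i) x *: (clgen R j * S x)) *
      clpartial i h (psi x).
Proof.
move=> Oo Ox Oo' OO' kpsi kS kh; rewrite !dirac_opE.
have dpsi i j : derivable (fun y => psi y ord0 i) x (e j) by exact: (Ck_derivable (kpsi i) Ox).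
rewrite mulr_suml [X in _ = _ + X](_ : _ = \sum_j \sum_i
    partial j (fun y => psi y ord0 i) x *: (clgen R j * S x) * clpartial i h (psi x)); last first.
  by rewrite [RHS]exchange_big/=; apply: eq_bigr => i _; rewrite mulr_suml.
rewrite -big_split; apply: eq_bigr => j _ /=.
rewrite clpartialM; last 2 first.
- by move=> A; exact: (Ck_derivable (kS A) Ox).
- by move=> A; case: (is_derive_comp_row Oo' (OO' _ Ox) (kh A) (fun i => dpsi i j)).
rewrite mulrDr mulrA; congr (_ + _).
rewrite (clpartial_comp Oo' (OO' _ Ox) kh)// mulrA [LHS]mulr_sumr; apply: eq_bigr => i _.
by rewrite -!(scalerAl, scalerAr).
Qed.

End CliffordCalculus.

(** * Conformal changes of variables *)

(* J is the Jacobian of phi : O -> O', with inverse psi. Along phi, functions are   *)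
(* pulled back to W (f o phi), and test functions pushed forward to S (h o psi); the *)
(* field cc_conformal is what relates D h to D (S (h o psi)) by the chain rule.      *)
Record conformal_change (R : realType) (n : nat) (O O' : set 'rV[R]_n)
    (phi psi : 'rV[R]_n -> 'rV[R]_n) (J om : 'rV[R]_n -> R) (W S : 'rV[R]_n -> Cl R n) : Prop :=
  ConformalChange {
    cc_open : open O;
    cc_open' : open O';
    cc_to : forall x, O x -> O' (phi x);
    cc_from : forall y, O' y -> O (psi y);
    cc_phiK : forall x, O x -> psi (phi x) = x;
    cc_psiK : forall y, O' y -> phi (psi y) = y;
    cc_phi_cont : forall x, O x -> {for x, continuous phi};
    cc_psi_smooth : forall k i, Ck k O' (fun y => psi y ord0 i);
    cc_phi_meas : measurable_fun [set: 'rV[R]_n] phi;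
    cc_J_meas : measurable_fun [set: 'rV[R]_n] J;
    cc_J_ge0 : forall x, 0 <= J x;
    cc_J_gt0 : forall x, (0 < J x) <-> O x;
    cc_J_cont : forall x, O x -> {for x, continuous J};
    cc_integral : forall F : 'rV[R]_n -> \bar R, measurable_fun setT F ->
      (forall x, (0 <= F x)%E) ->
      (\int[borel_lebesgue n]_x F x = \int[borel_lebesgue n]_x (F (phi x) * (J x)%:E))%E;
    cc_W_cont : forall A x, O x -> {for x, continuous (fun x => clcoef (W x) A)};
    cc_om_cont : forall x, O x -> {for x, continuous om};
    cc_norm : forall x a, O x -> clnorm (W x * a) = om x * clnorm a;
    cc_S_smooth : forall k, clCk k O' S;
    cc_S_monogenic : forall y, O' y -> dirac_op S y = 0;
    cc_conformal : forall x i, O x ->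
      J x *: \sum_j partial j (fun y => psi y ord0 i) (phi x) *: (clgen R j * S (phi x)) =
      om x ^+ (n - 2) *: (clconj (W x) * clgen R i) }.

(** * Test functions and integrals along a conformal change *)

Section Transfer.
Variables (R : realType) (n : nat) (O O' : set 'rV[R]_n).
Variables (phi psi : 'rV[R]_n -> 'rV[R]_n) (J om : 'rV[R]_n -> R) (W S : 'rV[R]_n -> Cl R n).
Hypothesis cc : conformal_change O O' phi psi J om W S.
Notation leb := (@lebesgue R n).
Notation rVleb := (rV_lebesgue R n).
Implicit Types (U V : set 'rV[R]_n).

Let JO : [set x | 0 < J x] = O.
Proof. by apply/seteqP; split=> x /=; have [] := cc_J_gt0 cc x. Qed.

Let J_out x : ~ O x -> J x = 0.
Proof.
move=> nO; apply/eqP; rewrite eq_le (cc_J_ge0 cc) andbT leNgt; apply/negP.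
by move=> /(cc_J_gt0 cc x).1.
Qed.

Lemma borel_lebesgue_measurable U : measurable U -> measurable (U : set rVleb).
Proof. exact: sub_completion. Qed.

Lemma cc_measurable_comp d (Y : measurableType d) U (F : rVleb -> Y) : measurable U ->
  measurable_fun (U : set rVleb) F ->
  measurable_fun (O `&` phi @^-1` U : set rVleb) (fun x : rVleb => F (phi x)).
Proof.
move=> mU mF _ A mA.
have := mF (borel_lebesgue_measurable mU) A mA.
move=> /(measurable_completion_preimage (cc_phi_meas cc) (cc_J_meas cc) (cc_J_ge0 cc)
  (cc_integral cc)).
rewrite JO; congr measurable; apply/seteqP; split=> x /=.
  by move=> [[Ux Ax] Ox].
by move=> [[Ox Ux] Ax].
Qed.

(** The integral is a difference of integrals of positive and negative parts, and multiplication by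
    J >= 0 commutes with taking these parts. Restriction to [O] is possible because J vanishes
    outside. *)
Lemma cc_integral_set U (F : rVleb -> \bar R) : measurable U ->
  measurable_fun (U : set rVleb) F ->
  (\int[leb]_(y in U) F y = \int[leb]_(x in O `&` phi @^-1` U) (F (phi x) * (J x)%:E))%E.
Proof.
move=> mU mF; rewrite integral_mkcond [RHS]integral_mkcond.
have mG : measurable_fun [set: rVleb] (F \_ U).
  by apply/(measurable_restrictT _ (borel_lebesgue_measurable mU)).
rewrite [X in _ = (\int[_]_x X x)%E](_ : _ = fun x => ((F \_ U) (phi x) * (J x)%:E)%E); last first.
  apply/funext => x; rewrite !patchE; case: ifPn => [|].
    by rewrite inE => -[Ox Ux]; rewrite mem_set.
  rewrite notin_setE => nV; have [Ox|/J_out ->] := pselect (O x); last by rewrite mule0.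
  by rewrite memNset ?mul0e// => Ux; apply: nV.
move: (F \_ U) mG => G mG.
have change := ge0_integral_completion_change (cc_phi_meas cc) (cc_J_meas cc)
  (cc_J_ge0 cc) (cc_integral cc).
rewrite integralE [RHS]integralE; congr (_ - _)%E.
- rewrite [LHS](change _ (measurable_funepos mG) (funepos_ge0 G)).
  apply: eq_integral => x _; rewrite !funeposE maxe_pMl ?mul0e//.
  by rewrite lee_fin (cc_J_ge0 cc).
- rewrite [LHS](change _ (measurable_funeneg mG) (funeneg_ge0 G)).
  apply: eq_integral => x _; rewrite !funenegE -mulNe maxe_pMl ?mul0e//.
  by rewrite lee_fin (cc_J_ge0 cc).
Qed.

Lemma cc_preimage_open U : open U -> open (O `&` phi @^-1` U).
Proof. exact: (open_continuous_preimage (cc_open cc) (cc_phi_cont cc)). Qed.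

Lemma cc_image_compact (K : set 'rV[R]_n) : compact K -> K `<=` O -> compact (phi @` K).
Proof.
move=> cK KO; apply: continuous_compact => //; apply: continuous_in_subspaceT => x.
by rewrite inE => /KO /(cc_phi_cont cc).
Qed.

Definition cc_push (h : 'rV[R]_n -> Cl R n) : 'rV[R]_n -> Cl R n :=
  fun y => if `[< O' y >] then S y * h (psi y) else 0.

Lemma cc_pushE h y : O' y -> cc_push h y = S y * h (psi y).
Proof. by rewrite /cc_push; case: asboolP. Qed.

(** The support lies in the compact set phi(K), with K the union of the supports of the components
    of h. Smoothness is checked on two open sets that cover the space: [O'], by composition, and the
    complement of phi(K), where the function is 0. *)
Lemma cc_push_test U h : open U -> cl_test_function (O `&` phi @^-1` U) h ->
  cl_test_function U (cc_push h).
Proof.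
move=> Uo th.
pose K := \big[setU/set0]_(A : {set 'I_n}) closure [set x | clcoef (h x) A != 0].
have cK : compact K by apply: bigsetU_compact => A _; have [] := th A.
have KV : K `<=` O `&` phi @^-1` U.
  by apply: (big_ind (fun X => X `<=` _)) => // [X Y XV YV x [/XV|/YV]//|A _]; have [] := th A.
have hK x : ~ K x -> h x = 0.
  move=> nK; apply: clP => A; rewrite clcoef0; apply/eqP; apply: contra_notT nK => hx.
  by rewrite /K (bigD1 A)//=; left; apply: subset_closure.
have cphiK : compact (phi @` K) by apply: cc_image_compact => // x /KV[].
have clK : closed (phi @` K) := compact_closed_row cphiK.
have pushK y : ~ (phi @` K) y -> cc_push h y = 0.
  move=> nK; rewrite /cc_push; case: asboolP => // O'y; rewrite hK ?mulr0// => Kpsi.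
  by apply: nK; exists (psi y) => //; exact: (cc_psiK cc).
have kpush k : clCk k setT (cc_push h).
  move=> A; have -> : [set: 'rV[R]_n] = O' `|` ~` (phi @` K).
    apply/seteqP; split=> // y _; have [[x Kx <-]|] := pselect ((phi @` K) y); last by right.
    by left; apply: (cc_to cc); have [] := KV x Kx.
  apply: Ck_setU.
    apply: (@eq_Ck _ _ _ _ (fun y => clcoef (S y * h (psi y)) A)) => [|y O'y|].
    - exact: cc_open' cc.
    - by rewrite cc_pushE.
    - apply: clCkM; [exact: cc_open' cc|exact: cc_S_smooth cc _|move=> B].
      apply: (@Ck_comp _ _ _ _ setT psi (fun x => clcoef (h x) B)) => //.
      + exact: cc_open' cc.
      + exact: openT.
      + by move=> i; exact: cc_psi_smooth cc _ _.
      + by have [/smoothP] := th B.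
  apply: (@eq_Ck _ _ _ _ (cst 0)) => [|y nK|].
  - exact: closed_openC.
  - by rewrite pushK// clcoef0.
  - by apply: Ck_cst; exact: closed_openC.
move=> A; split; first by apply/smoothP => k; exact: kpush.
  apply: (subclosed_compact _ cphiK); first exact: closed_closure.
  rewrite [X in _ `<=` X]((closure_id _).1 clK); apply: closureS => y /= yA.
  by apply: contrapT => /pushK py; move: yA; rewrite py clcoef0 eqxx.
apply: (@subset_trans _ (phi @` K)); last by move=> _ [x Kx <-]; have [] := KV x Kx.
rewrite [X in _ `<=` X]((closure_id _).1 clK); apply: closureS => y /= yA.
by apply: contrapT => /pushK py; move: yA; rewrite py clcoef0 eqxx.
Qed.

(** In [dirac_op_comp] the term with [dirac_op S] vanishes; [cc_conformal] matches the others index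
    by index. *)
Lemma cc_dirac_push h x : (forall k, clCk k setT h) -> O x ->
  J x *: dirac_op (cc_push h) (phi x) = om x ^+ (n - 2) *: (clconj (W x) * dirac_op h x).
Proof.
move=> kh Ox; have O'x := cc_to cc Ox.
rewrite (eq_dirac_op (cc_open' cc) O'x (cc_pushE h)).
rewrite (dirac_op_comp (cc_open' cc) O'x openT (fun _ _ => Logic.I) (cc_psi_smooth cc 1)
  (cc_S_smooth cc 1) (kh 1)).
rewrite (cc_S_monogenic cc)// mul0r add0r (cc_phiK cc)// scaler_sumr.
rewrite dirac_opE [in RHS]mulr_sumr scaler_sumr; apply: eq_bigr => i _.
by rewrite scalerAl (cc_conformal cc)// -scalerAl mulrA.
Qed.

End Transfer.

(** Bound each t_i by the largest one, whose m-th power occurs in the sum on the right; [i0] ensures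
    that a largest one exists. *)
Lemma expr_sum_le (R : realFieldType) (I : finType) (i0 : I) (t : I -> R) (m : nat) :
  (forall i, 0 <= t i) -> (\sum_i t i) ^+ m <= #|I|%:R ^+ m * \sum_i t i ^+ m.
Proof.
move=> t0; have [j _ jmax] := @Order.TotalTheory.arg_maxP _ _ _ i0 xpredT t isT.
apply: (@le_trans _ _ ((#|I|%:R * t j) ^+ m)).
  apply: lerXn2r; rewrite ?nnegrE ?sumr_ge0//; first by rewrite mulr_ge0.
  rewrite mulr_natl -sumr_const; apply: ler_sum => i _; exact: jmax.
rewrite exprMn ler_wpM2l// ?exprn_ge0// (bigD1 j)//= lerDl.
by apply: sumr_ge0 => i _; rewrite exprn_ge0.
Qed.

Lemma clnorm_le_sum (R : rcfType) (n : nat) (a : Cl R n) :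
  clnorm a <= \sum_A `|clcoef a A|.
Proof.
have s0 : 0 <= \sum_A `|clcoef a A| by apply: sumr_ge0.
rewrite -[leRHS](ger0_norm s0) -sqrtr_sqr ler_sqrt ?sqr_ge0//.
suff [] : 0 <= \sum_A `|clcoef a A| /\ \sum_A clcoef a A ^+ 2 <= (\sum_A `|clcoef a A|) ^+ 2 by [].
apply: (big_ind2 (fun x y : R => 0 <= y /\ x <= y ^+ 2)) => [|x1 x2 y1 y2 [? ?] [? ?]|A _].
- by rewrite expr0n.
- by split; nra.
- by rewrite real_normK ?num_real.
Qed.

Section LebesgueMeasurable.
Variables (R : realType) (n : nat).
Notation rVleb := (rV_lebesgue R n).
Implicit Types (D U : set 'rV[R]_n) (f h : 'rV[R]_n -> Cl R n).

Lemma leb_measurable_fun d (Y : measurableType d) D (g : 'rV[R]_n -> Y) :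
  measurable D -> measurable_fun D g -> measurable_fun (D : set rVleb) (g : rVleb -> Y).
Proof. by move=> mD mg _ A mA; apply: sub_completion; exact: mg. Qed.

Lemma leb_measurable_continuous D (g : 'rV[R]_n -> R) : open D ->
  (forall x, D x -> {for x, continuous g}) -> measurable_fun (D : set rVleb) (g : rVleb -> R).
Proof.
move=> Do cg; apply: leb_measurable_fun; first exact: open_measurable_row.
exact: continuous_measurable_row.
Qed.

Definition cl_measurable U f : Prop :=
  forall A, measurable_fun (U : set rVleb) (fun x : rVleb => clcoef (f x) A).

Lemma cl_measurableM U f h : cl_measurable U f -> cl_measurable U h ->
  cl_measurable U (fun x => f x * h x).
Proof.
move=> mf mh C; under eq_fun do rewrite clcoefM.
apply: measurable_sum => A; apply: measurable_sum => B.
apply: measurable_funM; first exact: measurable_cst.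
exact: (measurable_funM (mf A) (mh B)).
Qed.

Lemma cl_measurable_conj U f : cl_measurable U f -> cl_measurable U (fun x => clconj (f x)).
Proof.
move=> mf A; under eq_fun do rewrite clconjE clcoef_twist.
by apply: measurable_funM; [exact: measurable_cst|exact: mf].
Qed.

Lemma cl_measurableZ U (g : 'rV[R]_n -> R) f : measurable_fun (U : set rVleb) (g : rVleb -> R) ->
  cl_measurable U f -> cl_measurable U (fun x => g x *: f x).
Proof. by move=> mg mf A; under eq_fun do rewrite clcoefZ; exact: (measurable_funM mg (mf A)). Qed.

Lemma cl_measurable_norm U f : cl_measurable U f ->
  measurable_fun (U : set rVleb) (fun x : rVleb => clnorm (f x)).
Proof.
move=> mf; apply: (measurableT_comp (continuous_measurable_fun (@sqrt_continuous R))).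
by apply: measurable_sum => A; exact: measurable_funX.
Qed.

Lemma cl_measurable_dirac U h : open U -> (forall A, smooth (fun x => clcoef (h x) A)) ->
  cl_measurable U (dirac_op h).
Proof.
move=> Uo sh A; under eq_fun do rewrite dirac_opE clcoef_sum.
apply: measurable_sum => j; under eq_fun do rewrite clcoefM.
apply: measurable_sum => B; apply: measurable_sum => C.
apply: measurable_funM; first exact: measurable_cst.
apply: measurable_funM; first exact: measurable_cst.
under eq_fun do rewrite clcoef_partial.
apply: leb_measurable_continuous => // x _; exact: (sh C [:: j]).1.
Qed.

End LebesgueMeasurable.

Section TransferTheorem.
Variables (R : realType) (n : nat) (O O' : set 'rV[R]_n).
Variables (phi psi : 'rV[R]_n -> 'rV[R]_n) (J om : 'rV[R]_n -> R) (W S : 'rV[R]_n -> Cl R n).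
Hypothesis cc : conformal_change O O' phi psi J om W S.
Notation leb := (@lebesgue R n).
Notation rVleb := (rV_lebesgue R n).
Variables (U : set 'rV[R]_n) (f : 'rV[R]_n -> Cl R n).
Hypotheses (Uo : open U) (mf : cl_measurable U f).
Let V := O `&` phi @^-1` U.
Let g (x : 'rV[R]_n) := W x * f (phi x).

Let Vo : open V. Proof. exact: (cc_preimage_open cc). Qed.

Lemma cc_measurable_pull : cl_measurable V g.
Proof.
apply: cl_measurableM => A; last first.
  exact: (cc_measurable_comp cc (open_measurable_row Uo) (mf A)).
apply: leb_measurable_continuous => // x [Ox _]; exact: (cc_W_cont cc).
Qed.

(** The quotient om^n / J is continuous on the compact K, hence bounded. *)
Let bound (K : set 'rV[R]_n) : compact K -> K `<=` O ->
  exists2 M, 0 <= M & forall x, K x -> om x ^+ n <= M * J x.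
Proof.
move=> cK KO; have [->|/set0P K0] := eqVneq K set0; first by exists 0.
have cont : {within K, continuous (fun x => om x ^+ n / J x)}.
  apply: continuous_in_subspaceT => x; rewrite inE => /KO Ox.
  have c1 : {for x, continuous (fun x => om x ^+ n)}.
    by apply: (@continuous_comp _ _ _ om (fun t => t ^+ n));
      [exact: (cc_om_cont cc)|exact: exprn_continuous].
  have c2 : {for x, continuous (fun x => (J x)^-1)}.
    by apply: continuousV; [rewrite gt_eqF//; exact/(cc_J_gt0 cc)|exact: (cc_J_cont cc)].
  exact: (continuousM c1 c2).
have [y _ ymax] := compact_EVT_max K0 cK cont.
exists (Num.max 0 (om y ^+ n / J y)); first by rewrite le_max lexx.
move=> x Kx; rewrite -ler_pdivrMr; last exact/(cc_J_gt0 cc)/KO.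
by rewrite le_max ymax ?orbT// inE.
Qed.

Let om_ge0 x : O x -> 0 <= om x.
Proof.
move=> Ox; have n1 : 0 < clnorm (1 : Cl R n).
  apply: lt_le_trans _ (clcoef_le_norm (1 : Cl R n) finset.set0).
  by rewrite -clbasis0 clcoef_basis eqxx normr1.
by rewrite -(pmulr_lge0 _ n1) -(cc_norm cc)// clnorm_ge0.
Qed.

(** A coordinate of W (f o phi) is at most om times the sum of the |f_B o phi|. On K its n-th power
    is therefore at most M J N^n times the sum of the |f_B o phi|^n, with N the number of
    coordinates. The change of variables turns this bound into an integral over the compact set
    phi(K). *)
Lemma cc_pull_Lp (K : set 'rV[R]_n) (A : {set 'I_n}) : 
  (forall B, forall K, compact K -> K `<=` U ->
    (\int[leb]_(x in K) (`|clcoef (f x) B| ^+ n)%:E < +oo)%E) ->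
  compact K -> K `<=` V -> (\int[leb]_(x in K) (`|clcoef (g x) A| ^+ n)%:E < +oo)%E.
Proof.
move=> fLp cK KV; have KO : K `<=` O by move=> x /KV[].
have [M M0 omJ] := bound cK KO.
have cphiK := cc_image_compact cc cK KO.
have mphiK := closed_measurable_row (compact_closed_row cphiK).
have phiKU : phi @` K `<=` U by move=> _ [x Kx <-]; have [] := KV x Kx.
have KE : O `&` phi @^-1` (phi @` K) = K.
  apply/seteqP; split=> [x [Ox [y Ky yx]]|x Kx]; last by split; [exact: KO|exists x].
  by rewrite -(cc_phiK cc Ox) -yx (cc_phiK cc)//; exact: KO.
pose c := M * #|{set 'I_n}|%:R ^+ n.
have c0 : 0 <= c by rewrite mulr_ge0// exprn_ge0.
pose F (y : rVleb) := (\sum_B (c * `|clcoef (f y) B| ^+ n)%:E)%E.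
have mUl : measurable (U : set rVleb).
  by apply: borel_lebesgue_measurable; exact: open_measurable_row.
have mfB B : measurable_fun (phi @` K : set rVleb)
    (fun y : rVleb => (c * `|clcoef (f y) B| ^+ n)%:E).
  apply/measurable_EFinP; apply: measurable_funM; first exact: measurable_cst.
  apply: measurable_funX.
  apply: (measurableT_comp (@normr_measurable R setT)).
  exact: (measurable_funS mUl phiKU (mf B)).
have mF : measurable_fun (phi @` K : set rVleb) F by exact: emeasurable_sum.
have := cc_integral_set cc mphiK mF; rewrite KE => E.
have mKl : measurable (phi @` K : set rVleb) by exact: borel_lebesgue_measurable.
have mK : measurable (K : set rVleb).
  by apply: borel_lebesgue_measurable; exact: (closed_measurable_row (compact_closed_row cK)).
have mFphi : measurable_fun (K : set rVleb) (fun x => F (phi x)).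
  by have := cc_measurable_comp cc mphiK mF; rewrite KE.
have mVl : measurable (V : set rVleb).
  by apply: borel_lebesgue_measurable; exact: open_measurable_row.
apply: (@le_lt_trans _ _ (\int[leb]_(y in phi @` K) F y)%E); last first.
  rewrite /F ge0_integral_sum//; last first.
    by move=> B x _; rewrite lee_fin mulr_ge0// exprn_ge0.
  apply: lte_sum_pinfty => B _; under eq_integral do rewrite EFinM.
  have mfn : measurable_fun (phi @` K : set rVleb)
      (fun y : rVleb => (`|clcoef (f y) B| ^+ n)%:E).
    apply/measurable_EFinP; apply: measurable_funX.
    apply: (measurableT_comp (@normr_measurable R setT)).
    exact: (measurable_funS mUl phiKU (mf B)).
  have f0 (y : rVleb) : (phi @` K) y -> (0 <= (`|clcoef (f y) B| ^+ n)%:E)%E.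
    by move=> _; rewrite lee_fin exprn_ge0.
  have c0' : (0 <= c%:E)%E by rewrite lee_fin.
  rewrite [X in (X < _)%E](ge0_integralZl leb mKl mfn f0 c0').
  by apply: lte_mul_pinfty => //; exact: fLp.
rewrite [leRHS]E; apply: ge0_le_integral.
- exact: mK.
- by move=> x _; rewrite lee_fin exprn_ge0.
- apply/measurable_EFinP; apply: measurable_funX.
  apply: (measurableT_comp (@normr_measurable R setT)).
  exact: (measurable_funS mVl KV (cc_measurable_pull A)).
- apply: (emeasurable_funM mFphi); apply/measurable_EFinP.
  apply: leb_measurable_fun; last first.
    exact: (measurable_funS measurableT (@subsetT _ K) (cc_J_meas cc)).
  exact: (closed_measurable_row (compact_closed_row cK)).
move=> x Kx; rewrite /F sumEFin -EFinM lee_fin -mulr_sumr.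
have Ox := KO x Kx; have o0 := om_ge0 Ox.
apply: (@le_trans _ _ ((om x * \sum_B `|clcoef (f (phi x)) B|) ^+ n)).
  apply: lerXn2r; rewrite ?nnegrE// ?mulr_ge0// ?sumr_ge0//.
  apply: le_trans (clcoef_le_norm _ _) _.
  by rewrite (cc_norm cc)// ler_wpM2l// clnorm_le_sum.
have sum_le := expr_sum_le (finset.set0 : {set 'I_n}) n
  (fun B => normr_ge0 (clcoef (f (phi x)) B)).
rewrite exprMn /c; apply: le_trans (ler_pM _ _ (omJ x Kx) sum_le) _.
- exact: exprn_ge0.
- by rewrite exprn_ge0// sumr_ge0.
by rewrite le_eqVlt; apply/orP; left; apply/eqP; ring.
Qed.

(** The factor |W (f o phi)|^(n-2) contributes the om^(n-2) that [cc_dirac_push] asks for, and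
    conjugation brings conj(W) next to D h. *)
Lemma cc_transfer_integrand (h : 'rV[R]_n -> Cl R n) x : (forall k, clCk k setT h) -> O x ->
  clconj (clnorm (g x) ^+ (n - 2) *: g x) * dirac_op h x =
  J x *: (clconj (clnorm (f (phi x)) ^+ (n - 2) *: f (phi x)) *
    dirac_op (cc_push O' psi S h) (phi x)).
Proof.
move=> kh Ox; rewrite [RHS]scalerAr (cc_dirac_push cc kh Ox) /g (cc_norm cc)//.
by rewrite !clconjZ clconjM -!scalerAl -scalerAr scalerA exprMn mulrA [in LHS]mulrC.
Qed.

End TransferTheorem.

(** The integrand for the pulled-back function is J times, at phi(x), the integrand of [f] tested
    against [cc_push]; the change of variables yields an integral that vanishes by hypothesis. *)
Theorem conformal_weak_solution (R : realType) (n : nat) (O O' : set 'rV[R]_n)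
    (phi psi : 'rV[R]_n -> 'rV[R]_n) (J om : 'rV[R]_n -> R) (W S : 'rV[R]_n -> Cl R n)
    (U : set 'rV[R]_n) (f : 'rV[R]_n -> Cl R n) :
  conformal_change O O' phi psi J om W S -> open U -> weak_ndirac_solution U f ->
  weak_ndirac_solution (O `&` phi @^-1` U) (fun x => W x * f (phi x)).
Proof.
move=> cc Uo [fLp fD]; have mf : cl_measurable U f by move=> A; have [] := fLp A.
split=> [A|h th A].
  split; first exact: (cc_measurable_pull cc Uo mf).
  move=> K; apply: (cc_pull_Lp cc Uo mf) => B; exact: (fLp B).2.
have sh B k : Ck k setT (fun x => clcoef (h x) B) by have [/smoothP] := th B.
have tp := cc_push_test cc Uo th.
have sp B : smooth (fun x => clcoef (cc_push O' psi S h x) B) by have [] := tp B.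
pose G (y : rV_lebesgue R n) :=
  (clcoef (clconj (clnorm (f y) ^+ (n - 2) *: f y) * dirac_op (cc_push O' psi S h) y) A)%:E.
have mG : measurable_fun (U : set (rV_lebesgue R n)) G.
  apply/measurable_EFinP; apply: cl_measurableM; last exact: cl_measurable_dirac.
  apply: cl_measurable_conj; apply: (cl_measurableZ _ mf).
  by apply: measurable_funX; exact: cl_measurable_norm.
rewrite (_ : (\int[_]_(x in _) _ =
    \int[@lebesgue R n]_(x in O `&` phi @^-1` U) (G (phi x) * (J x)%:E))%E).
  by rewrite -(cc_integral_set cc (open_measurable_row Uo) mG); exact: fD.
apply: eq_integral => x; rewrite inE => -[Ox _].
by rewrite (cc_transfer_integrand cc f (fun k B => sh B k) Ox) clcoefZ /G -EFinM mulrC.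
Qed.

(** * Translations, sandwich maps and the inversion *)

Section RowCalculus.
Variables (R : realType) (n : nat).
Notation e j := (delta_mx ord0 j : 'rV[R]_n).
Implicit Types (O : set 'rV[R]_n) (F : 'rV[R]_n -> 'rV[R]_n) (y v : 'rV[R]_n).

Lemma clcoef_vec v A : clcoef (clvec v) A = \sum_i v ord0 i * clcoef (clgen R i) A.
Proof. by rewrite clcoef_sum; apply: eq_bigr => i _; rewrite clcoefZ. Qed.

Lemma clCk_vec k O F : open O -> (forall i, Ck k O (fun y => F y ord0 i)) ->
  clCk k O (fun y => clvec (F y)).
Proof.
move=> Oo kF A; under eq_fun do rewrite clcoef_vec.
by apply: Ck_sum => // i; apply: CkM => //; exact: Ck_cst.
Qed.

Lemma clpartial_vec F j y v :
  (forall i, is_derive y (e j) (fun x => F x ord0 i) (v ord0 i)) ->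
  clpartial j (fun x => clvec (F x)) y = clvec v.
Proof.
move=> dF; apply: clP => A; rewrite clcoef_partial clcoef_vec /partial.
under eq_fun do rewrite clcoef_vec.
apply: (@derive_val _ _ _ _ _ _ _ (is_derive_bigsum _ _)) => i.
under eq_fun do rewrite mulrC.
rewrite [v _ _ * _]mulrC.
exact: is_deriveZ.
Qed.

Lemma Ck_row_measurable F : (forall i, Ck 0 setT (fun y => F y ord0 i)) ->
  measurable_fun setT F.
Proof.
move=> kF; apply/measurable_fun_rowP => i.
apply: (continuous_measurable_row (@openT 'rV[R]_n)) => y _.
exact: (Ck_continuous (kF i)).
Qed.

Lemma Ck_row_continuous O F y : O y -> (forall i, Ck 0 O (fun y => F y ord0 i)) ->
  {for y, continuous F}.
Proof. by move=> Oy kF; apply: row_continuous => i; exact: (Ck_continuous (kF i) Oy). Qed.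

Lemma clvec_sum_gen v a : \sum_j v ord0 j *: (clgen R j * a) = clvec v * a.
Proof. by rewrite mulr_suml; apply: eq_bigr => j _; rewrite scalerAl. Qed.

(** The sum in [cc_conformal] is the gradient [v] of the i-th component of psi, read as a Clifford
    vector, times [a]. *)
Lemma conformalE (psi : 'rV[R]_n -> 'rV[R]_n) i y v a :
  (forall j, is_derive y (e j) (fun x => psi x ord0 i) (v ord0 j)) ->
  \sum_j partial j (fun x => psi x ord0 i) y *: (clgen R j * a) = clvec v * a.
Proof.
move=> dpsi; rewrite -clvec_sum_gen; apply: eq_bigr => j _; congr (_ *: _).
exact: derive_val.
Qed.

Lemma dirac_op_cst (a : Cl R n) y : dirac_op (fun=> a) y = 0.
Proof.
rewrite dirac_opE big1// => j _; rewrite [clpartial _ _ _]big1 ?mulr0// => A _.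
by rewrite /partial derive_cst scale0r.
Qed.

Lemma is_derive_row_inv (g : 'rV[R]_n -> R) y v t : g y != 0 -> is_derive y v g t ->
  is_derive y v (fun x => (g x)^-1) (- (g y) ^- 2 * t).
Proof.
move=> g0 [dg <-]; apply: DeriveDef; first exact: derivableV.
exact: deriveV.
Qed.

Lemma delta_sym (i j : 'I_n) : e j ord0 i = e i ord0 j.
Proof. by rewrite !mxE eq_sym. Qed.

End RowCalculus.

Section Translation.
Variables (R : realType) (n : nat) (p : 'rV[R]_n).

Lemma conformal_translation :
  conformal_change setT setT (fun x => x + p) (fun y => y - p) (cst 1) (cst 1)
    (cst (1 : Cl R n)) (cst (1 : Cl R n)).
Proof.
have kshift k (q : 'rV[R]_n) i : Ck k setT (fun y => (y + q) ord0 i).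
  under eq_fun do rewrite mxE.
  by apply: CkD; [exact: openT|apply: Ck_coord; exact: openT|apply: Ck_cst; exact: openT].
split.
- exact: openT.
- exact: openT.
- by [].
- by [].
- by move=> x _; rewrite addrK.
- by move=> y _; rewrite subrK.
- by move=> x _; apply: (@Ck_row_continuous _ _ setT).
- by move=> k i; exact: kshift.
- exact: Ck_row_measurable.
- exact: measurable_cst.
- by move=> x; exact: ler01.
- by move=> x; split=> // _; exact: ltr01.
- by move=> x _; exact: cst_continuous.
- move=> F mF F0; rewrite (ge0_integral_row_shift p mF F0).
  by apply: eq_integral => x _; rewrite mule1.
- by move=> A x _; exact: cst_continuous.
- by move=> x _; exact: cst_continuous.
- by move=> x a _; rewrite !mul1r.
- by move=> k A; apply: Ck_cst; exact: openT.
- by move=> y _; exact: dirac_op_cst.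
- move=> x i _; rewrite expr1n !scale1r clconj1 mul1r.
  have d j : is_derive (x + p) (delta_mx ord0 j) (fun y => (y - p) ord0 i)
      ((delta_mx ord0 i : 'rV[R]_n) ord0 j).
    rewrite -delta_sym -[X in is_derive _ _ _ X]addr0; under eq_fun do rewrite mxE.
    by apply: is_deriveD; exact: is_derive_coord.
  by rewrite (conformalE _ d) mulr1 clvec_delta.
Qed.

End Translation.

Section SandwichMap.
Variables (R : realType) (n : nat) (w : 'rV[R]_n).
Hypothesis w0 : w != 0.
Notation r := (rdot w w).
Let r0 : 0 < r. Proof. by rewrite rdot_gt0. Qed.
Let rn0 : r != 0. Proof. by rewrite gt_eqF. Qed.

Lemma sandwich_scaleK (x : 'rV[R]_n) : r ^- 2 *: sandwich w (sandwich w x) = x.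
Proof. by rewrite sandwich_sandwich scalerA mulVf ?scale1r// expf_neq0. Qed.

Lemma sandwichZ (k : R) (x : 'rV[R]_n) : sandwich w (k *: x) = k *: sandwich w x.
Proof. by apply/rowP => i; rewrite !(mxE, rdotZr); ring. Qed.

Lemma sandwichD (x y : 'rV[R]_n) : sandwich w (x + y) = sandwich w x + sandwich w y.
Proof. by apply/rowP => i; rewrite !(mxE, rdotDr); ring. Qed.

(** The matrix is symmetric, being |w|^2 times that of a reflection. *)
Lemma sandwich_delta i (y : 'rV[R]_n) : sandwich w y ord0 i =
  \sum_j sandwich w (delta_mx ord0 i) ord0 j * y ord0 j.
Proof.
rewrite -[RHS]/(rdot (sandwich w (delta_mx ord0 i)) y) -[LHS]rdot_delta /sandwich.
by rewrite -!scaleNr !(rdotDl, rdotZl) [rdot y _]rdotC; ring.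
Qed.

Lemma Ck_sandwich k i : Ck k setT (fun y => sandwich w y ord0 i).
Proof.
under eq_fun do rewrite sandwich_delta.
by apply: Ck_sum => [|j]; [exact: openT|apply: CkZ; [exact: openT|apply: Ck_coord; exact: openT]].
Qed.

Lemma is_derive_sandwich i j (y : 'rV[R]_n) :
  is_derive y (delta_mx ord0 j) (fun y => sandwich w y ord0 i)
    (sandwich w (delta_mx ord0 i) ord0 j).
Proof.
under eq_fun do rewrite sandwich_delta.
have -> : sandwich w (delta_mx ord0 i) ord0 j =
    \sum_l sandwich w (delta_mx ord0 i) ord0 l * (delta_mx ord0 j : 'rV[R]_n) ord0 l.
  by rewrite -rdot_delta.
apply: is_derive_bigsum => l; apply: is_deriveZ; exact: is_derive_coord.
Qed.

(** The map is r = |w|^2 times a reflection, so J = r^n. The i-th component of the inverse has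
    gradient r^-2 w e_i w; with S = s w and w w = -r, the left side of [cc_conformal] is -s r^(n-1)
    w e_i, which fixes s. *)
Lemma conformal_sandwich :
  conformal_change setT setT (sandwich w) (fun y => r ^- 2 *: sandwich w y)
    (cst (r ^+ n)) (cst (Num.sqrt r)) (cst (clvec w))
    (cst ((Num.sqrt r ^+ (n - 2) / r ^+ n.-1) *: clvec w)).
Proof.
split.
- exact: openT.
- exact: openT.
- by [].
- by [].
- by move=> x _; exact: sandwich_scaleK.
- by move=> y _; rewrite sandwichZ sandwich_scaleK.
- by move=> x _; apply: (@Ck_row_continuous _ _ setT) => // i; exact: Ck_sandwich.
- move=> k i; under eq_fun do rewrite mxE.
  by apply: CkZ; [exact: openT|exact: Ck_sandwich].
- by apply: Ck_row_measurable => i; exact: Ck_sandwich.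
- exact: measurable_cst.
- by move=> x; rewrite exprn_ge0// ltW.
- by move=> x; split=> // _; rewrite exprn_gt0.
- by move=> x _; exact: cst_continuous.
- move=> F mF F0.
  have mS : measurable_fun setT (sandwich w) by apply: Ck_row_measurable => i; exact: Ck_sandwich.
  rewrite (@ge0_integral_similarity R n (sandwich w) r F)//.
  + rewrite -ge0_integralZl//; first by apply: eq_integral => x _; rewrite muleC.
    * exact: (measurableT_comp mF mS).
    * by rewrite lee_fin exprn_ge0// ltW.
  + exact: sandwichD.
  + by move=> y; exists (r ^- 2 *: sandwich w y); rewrite sandwichZ sandwich_scaleK.
  + by move=> x; exact: rdot_sandwich.
- by move=> A x _; exact: cst_continuous.
- by move=> x _; exact: cst_continuous.
- by move=> x a _; exact: clnorm_vecM.
- by move=> k A; apply: Ck_cst; exact: openT.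
- by move=> y _; exact: dirac_op_cst.
- move=> x i _.
  have n0 : (0 < n)%N by case: (n) i => // -[].
  have d j : is_derive (sandwich w x) (delta_mx ord0 j) (fun y => (r ^- 2 *: sandwich w y) ord0 i)
      ((r ^- 2 *: sandwich w (delta_mx ord0 i)) ord0 j).
    rewrite mxE; under eq_fun do rewrite mxE.
    by apply: is_deriveZ; exact: is_derive_sandwich.
  rewrite (conformalE _ d) clvecZ sandwichE clvec_delta clconj_vec.
  have key : clvec w * clgen R i * clvec w * clvec w = - (r *: (clvec w * clgen R i)).
    by rewrite -[LHS]mulrA clvec_sq mulrN -scalerAr mulr1.
  rewrite -scalerAr -scalerAl key !scalerN !scalerA mulNr scalerN; congr (- (_ *: _)).
  have -> : cst (r ^+ n) x = r * r ^+ n.-1 by rewrite -exprS prednK.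
  field.
  by rewrite expf_neq0 rn0.
Qed.

End SandwichMap.

Section Inversion.
Variables (R : realType) (n : nat).
Notation e j := (delta_mx ord0 j : 'rV[R]_n).
Implicit Types (y : 'rV[R]_n).
Notation O := [set y : 'rV[R]_n | y != 0].

Definition inv_norm y : R := (Num.sqrt (rdot y y))^-1.
Notation t := inv_norm.

Let rdot_neq0 y : O y -> rdot y y != 0.
Proof. by rewrite rdot_eq0. Qed.

Let Ck_rdot k O' : open O' -> Ck k O' (fun y : 'rV[R]_n => rdot y y).
Proof.
by move=> Oo; apply: Ck_sum => // i; apply: CkM => //; exact: Ck_coord.
Qed.

Lemma open_neq0_row : open O.
Proof.
have -> : O = setT `&` (fun y => rdot y y) @^-1` [set s : R | 0 < s].
  by rewrite setTI; apply/seteqP; split=> y /=; rewrite rdot_gt0.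
apply: open_continuous_preimage; [exact: openT| |exact: open_gt].
by move=> y Oy; apply: Ck_continuous Oy; apply: (Ck_rdot 0); exact: openT.
Qed.
Let Oo := open_neq0_row.

Let Ck_t k : Ck k O t.
Proof.
apply: CkV => //; first by move=> y Oy; rewrite gt_eqF// sqrtr_gt0 rdot_gt0.
by apply: Ck_sqrt => //; [move=> y Oy; rewrite rdot_gt0|exact: Ck_rdot].
Qed.

Lemma is_derive_rdot y j : is_derive y (e j) (fun x => rdot x x) (y ord0 j *+ 2).
Proof.
apply: is_derive_eq.
  by apply: is_derive_bigsum => i; apply: is_deriveM; exact: is_derive_coord.
by rewrite -[y _ _]rdot_delta -sumrMnl; apply: eq_bigr => i _; rewrite mulr2n.
Qed.

Let is_derive_t y j : O y -> is_derive y (e j) t (- (t y ^+ 3 * y ord0 j)).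
Proof.
move=> Oy; have q0 : 0 < rdot y y by rewrite rdot_gt0.
have s0 : Num.sqrt (rdot y y) != 0 by rewrite gt_eqF// sqrtr_gt0.
have dq := is_derive_rdot y j.
have dx : derivable (fun x : 'rV[R]_n => rdot x x) y (e j) by case: dq.
have ds : is_derive y (e j) (fun x : 'rV[R]_n => Num.sqrt (rdot x x))
    ((2 * Num.sqrt (rdot y y))^-1 * (y ord0 j *+ 2)).
  apply: is_derive_eq; first exact: (@is_derive_row_sqrt _ _ (fun x => rdot x x)).
  by congr (_ * _); exact: derive_val.
apply: is_derive_eq; first exact: (is_derive_row_inv s0 ds).
by rewrite /inv_norm mulr2n; field.
Qed.

(** The differential of the inversion at y is |y|^-2 times the reflection along y, that is |y|^-4
    times the sandwich map of y. *)
Let is_derive_inversion y i j : O y -> is_derive y (e j) (fun z => row_inv z ord0 i)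
  ((rdot y y ^- 2 *: sandwich y (e i)) ord0 j).
Proof.
move=> /rdot_neq0 q0; rewrite /row_inv; under eq_fun do rewrite mxE.
have dr := is_derive_rdot y j.
have dV := @is_derive_row_inv R n (fun z => rdot z z) y (e j) _ q0 dr.
apply: is_derive_eq; first by apply: is_deriveM; exact: is_derive_coord.
rewrite /sandwich rdot_delta !mxE /GRing.scale/= (eq_sym j i).
by field.
Qed.

(** As for the sandwich map, the gradient is a multiple of y e_i y, so S must be a multiple of y to
    leave y e_i. The multiple now depends on y; the power of |y| that the conformal identity
    dictates is also the one that makes S monogenic. *)
Lemma conformal_inversion : (2 <= n)%N ->
  conformal_change O O (@row_inv R n) (@row_inv R n) (fun x => rdot x x ^- n) t
    (fun x => (clvec x)^-1) (fun y => clvec (- t y ^+ n *: y)).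
Proof.
move=> n2.
have kinv k i : Ck k O (fun y => row_inv y ord0 i).
  rewrite /row_inv; under [X in Ck _ _ X]eq_fun do rewrite mxE.
  apply: CkM => //; last exact: Ck_coord.
  by apply: CkV => //; exact: Ck_rdot.
have rdot_inv (x : 'rV[R]_n) : rdot (row_inv x) (row_inv x) = (rdot x x)^-1.
  rewrite /row_inv rdotZl rdotZr; have [->|x0] := eqVneq x 0.
    by rewrite rdot0l invr0 !mul0r.
  by field; exact: rdot_neq0.
have invK x : O x -> row_inv (row_inv x) = x.
  move=> /rdot_neq0 x0; rewrite {1}/row_inv rdot_inv invrK /row_inv scalerA divff ?scale1r//.
have inv_to x : O x -> O (row_inv x).
  by move=> /rdot_neq0 x0; rewrite /= -rdot_eq0 rdot_inv invr_eq0.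
have kS k i : Ck k O (fun y => (- t y ^+ n *: y) ord0 i).
  under [X in Ck _ _ X]eq_fun do rewrite mxE mulNr -mulN1r.
  apply: CkZ => //; apply: CkM => //; last exact: Ck_coord.
  exact: Ck_exp.
split.
- exact: Oo.
- exact: Oo.
- exact: inv_to.
- exact: inv_to.
- exact: invK.
- exact: invK.
- by move=> x Ox; apply: (Ck_row_continuous Ox) => i; exact: kinv.
- exact: kinv.
- exact: measurable_row_inv.
- apply: measurable_funVr; apply: measurable_funX; exact: measurable_rdot.
- by move=> x; rewrite invr_ge0 exprn_ge0// rdot_ge0.
(* At the origin J is 0^-1 = 0, as n > 0, so J is positive exactly off the origin. *)
- move=> x; rewrite invr_gt0; have [->|x0] := eqVneq x 0.
    by rewrite /= eqxx rdot0l expr0n; case: (n) n2 => //= ? _; rewrite ltxx; split.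
  by split=> // _; rewrite exprn_gt0// rdot_gt0.
- move=> x Ox.
  have kJ : Ck 0 O (fun x => (rdot x x ^+ n)^-1).
    apply: CkV => // [y Oy|]; first by rewrite expf_neq0// rdot_neq0.
    by apply: Ck_exp => //; exact: Ck_rdot.
  exact: (Ck_continuous kJ Ox).
- by move=> F; case: (n) n2 F => // m _ F; exact: ge0_integral_row_inv.
- move=> A x Ox.
  have kW : clCk 0 O (fun x => clvec (- (rdot x x)^-1 *: x)).
    apply: clCk_vec => // i; under [X in Ck _ _ X]eq_fun do rewrite mxE mulNr -mulN1r.
    apply: CkZ => //; apply: CkM => //; last exact: Ck_coord.
    by apply: CkV => //; exact: Ck_rdot.
  have -> : (fun x => clcoef (clvec x)^-1 A) =
      (fun x : 'rV[R]_n => clcoef (clvec (- (rdot x x)^-1 *: x)) A).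
    by apply/funext => y; rewrite clvecV.
  exact: (Ck_continuous (kW A) Ox).
- by move=> x Ox; exact: (Ck_continuous (Ck_t 0) Ox).
- move=> x a Ox; rewrite clvecV clnorm_vecM; congr (_ * _).
  rewrite rdotZl rdotZr -/(t x) /inv_norm -sqrtrV ?rdot_ge0//; congr Num.sqrt.
  by field; exact: rdot_neq0.
- by move=> k; apply: clCk_vec.
(* With t = 1/|y|, the j-th derivative of S is n t^(n+2) y_j y - t^n e_j. Multiplying by e_j on the
   left and summing gives n t^(n+2) y y + n t^n, which is 0 since y y = -|y|^2. *)
- move=> y Oy.
  have q0 := rdot_neq0 Oy.
  have tq : t y ^+ 2 * rdot y y = 1.
    by rewrite /inv_norm exprVn sqr_sqrtr ?rdot_ge0// mulVf.
  pose dF j := (t y ^+ n.+2 * n%:R * y ord0 j) *: y - t y ^+ n *: e j.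
  have dS j : clpartial j (fun y => clvec (- t y ^+ n *: y)) y = clvec (dF j).
    have dX : is_derive y (e j) (fun y => t y ^+ n)
        (n%:R * t y ^+ n.-1 * - (t y ^+ 3 * y ord0 j)).
      by have := @is_deriveX _ _ t n y (e j) _ (is_derive_t j Oy); rewrite fctE.
    have dN : is_derive y (e j) (fun y => - t y ^+ n)
        (- (n%:R * t y ^+ n.-1 * - (t y ^+ 3 * y ord0 j))).
      by have := @is_deriveN _ _ _ _ _ _ _ dX; rewrite fctE.
    apply: clpartial_vec => i; under eq_fun do rewrite mxE.
    apply: is_derive_eq.
      apply: is_deriveM; last exact: is_derive_coord.
    have tn : t y ^+ n = t y * t y ^+ n.-1 by rewrite -exprS prednK// (ltn_trans _ n2).
    by rewrite /dF !mxE /GRing.scale/= !exprS tn; ring.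
  have sumE j : clgen R j * clvec (dF j) =
      y ord0 j *: (clgen R j * ((t y ^+ n.+2 * n%:R) *: clvec y)) + (t y ^+ n)%:A.
    rewrite /dF clvecD clvecN !clvecZ clvec_delta mulrBr -!scalerAr clgen_sq scalerN opprK.
    by rewrite scalerA [in RHS]mulrC.
  rewrite dirac_opE; under eq_bigr do rewrite dS sumE.
  rewrite big_split/= clvec_sum_gen sumr_const card_ord -scalerAr clvec_sq.
  rewrite scalerN scalerA scalerMnl -mulr_natr addrC; apply/eqP; rewrite subr_eq0; apply/eqP.
  congr (_ *: _); rewrite -addn2 exprD.
  transitivity (t y ^+ n * n%:R * (t y ^+ 2 * rdot y y)); last by ring.
  by rewrite tq mulr1 mulr_natr.
- move=> x i Ox.
  have q0 := rdot_neq0 Ox.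
  have Oy := inv_to x Ox; have qy := rdot_inv x.
  have Y : clvec (row_inv x) = (rdot x x)^-1 *: clvec x by rewrite /row_inv clvecZ.
  move: (row_inv x) Oy qy Y => y Oy qy Y.
  have d j := is_derive_inversion i j Oy.
  rewrite (conformalE _ d) !clvecZ sandwichE clvec_delta.
  rewrite clvecV clconj_vec clvecZ.
  (* All scalars become powers of u = |x|, to be compared through n = (n - 2) + 2. *)
  pose u := Num.sqrt (rdot x x).
  have u0 : u != 0 by rewrite gt_eqF// sqrtr_gt0 rdot_gt0.
  have ru : rdot x x = u ^+ 2 by rewrite sqr_sqrtr// rdot_ge0.
  have tx : t x = u^-1 by [].
  have ty : t y = u by rewrite /inv_norm qy sqrtrV ?rdot_ge0// invrK.
  have key : clvec x * clgen R i * clvec x * clvec x = - (u ^+ 2 *: (clvec x * clgen R i)).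
    by rewrite -[LHS]mulrA clvec_sq ru mulrN -scalerAr mulr1.
  rewrite tx ty qy Y ru.
  do ![rewrite -scalerAl || rewrite -scalerAr || rewrite scalerA].
  rewrite key scaleNr opprK -scalerAl scalerN !scalerA -scaleNr; congr (_ *: _).
  have -> : u ^+ 2 ^+ n = u ^+ n ^+ 2 by rewrite -!exprM mulnC.
  have -> : u ^+ n = u ^+ (n - 2) * u ^+ 2 by rewrite -exprD subnK.
  by rewrite !exprVn exprMn /GRing.scale/=; field; rewrite u0 expf_neq0.
Qed.

End Inversion.

(** * Moebius transformations *)

Section VectorProducts.
Variables (R : rcfType) (n : nat).
Implicit Types (B c : Cl R n) (x y v : 'rV[R]_n).

(** A nonzero product has nonzero factors, and a nonzero vector v has the vector -v/|v|^2 as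
    inverse. *)
Lemma vector_product_unit c : is_vector_product c -> c != 0 ->
  c \is a GRing.unit /\ is_vector_product c^-1.
Proof.
move=> [s ->] {c}; elim: s => [|v s ih].
  by rewrite big_nil unitr1 invr1; split=> //; exists [::]; rewrite big_nil.
rewrite big_cons => vs0.
have v0 : v != 0 by apply: contraNneq vs0 => ->; rewrite clvec0 mul0r.
have /ih[su [r rE]] : \prod_(w <- s) clvec w != 0 by apply: contraNneq vs0 => ->; rewrite mulr0.
have vu : clvec v \is a GRing.unit by rewrite clvec_unit.
split; first by rewrite (unitrMl _ su).
exists (rcons r (- (rdot v v)^-1 *: v)).
by rewrite (invrM vu su) clvecV rE -cats1 big_cat/= big_seq1.
Qed.

(** From the inside out, each factor contributes the real number v v = -|v|^2. *)
Lemma vector_product_rev B : is_vector_product B -> exists k : R, B * clrev B = k%:A.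
Proof.
move=> [s ->]; elim: s => [|v s [k ih]].
  by exists 1; rewrite big_nil clrev1 mulr1 scale1r.
exists (- (k * rdot v v)); rewrite big_cons clrevM clrev_vec mulrA -(mulrA (clvec v)) ih.
by rewrite -scalerAr mulr1 -scalerAl clvec_sq scalerN scalerA scaleNr.
Qed.

(** For a product of vectors this composes the sandwich maps of the factors, so [clvec_part] loses
    nothing ([spin_mapE]). *)
Definition spin_map B x : 'rV[R]_n := clvec_part (clrev B * clvec x * B).

Lemma spin_map_cons v B x : spin_map (clvec v * B) x = spin_map B (sandwich v x).
Proof. by rewrite /spin_map sandwichE clrevM clrev_vec !mulrA. Qed.

Lemma spin_mapE B x : is_vector_product B -> clvec (spin_map B x) = clrev B * clvec x * B.
Proof.
move=> [s ->]; elim: s x => [|v s ih] x.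
  by rewrite /spin_map big_nil clrev1 mul1r mulr1 clvecK.
rewrite big_cons spin_map_cons ih sandwichE clrevM clrev_vec.
by rewrite !mulrA.
Qed.

End VectorProducts.

Section WeakSolutions.
Variables (R : realType) (n : nat).
Implicit Types (U : set 'rV[R]_n) (f : 'rV[R]_n -> Cl R n) (w p x : 'rV[R]_n).

Lemma eq_weak_ndirac_solution U f f' : open U -> (forall x, U x -> f x = f' x) ->
  weak_ndirac_solution U f -> weak_ndirac_solution U f'.
Proof.
move=> Uo ff' [fLp fD]; split=> [A|h th A].
  have [mf Lf] := fLp A; split.
    apply: eq_measurable_fun mf => x; rewrite inE => Ux; by rewrite ff'.
  move=> K cK KU; rewrite [X in (X < _)%E](_ : _ =
    \int[@lebesgue R n]_(x in K) (`|clcoef (f x) A| ^+ n)%:E)%E; first exact: Lf.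
  by apply: eq_integral => x; rewrite inE => /KU Ux; rewrite ff'.
apply: etrans _ (fD h th A).
by apply: eq_integral => x; rewrite inE => Ux; rewrite ff'.
Qed.

(** Openness of the new set is returned as well, so that these transfers can be chained. *)
Lemma translation_weak_solution p U f : open U -> weak_ndirac_solution U f ->
  open [set x | U (x + p)] /\ weak_ndirac_solution [set x | U (x + p)] (fun x => f (x + p)).
Proof.
move=> Uo wf; have ct := @conformal_translation R n p; split.
  by have := cc_preimage_open ct Uo; rewrite setTI.
have := conformal_weak_solution ct Uo wf; rewrite setTI.
by congr weak_ndirac_solution; apply/funext => x; exact: mul1r.
Qed.

Lemma sandwich_weak_solution w U f : w != 0 -> open U -> weak_ndirac_solution U f ->
  open [set x | U (sandwich w x)] /\
  weak_ndirac_solution [set x | U (sandwich w x)] (fun x => clvec w * f (sandwich w x)).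
Proof.
move=> w0 Uo wf; have ct := conformal_sandwich w0; split.
  by have := cc_preimage_open ct Uo; rewrite setTI.
by have := conformal_weak_solution ct Uo wf; rewrite setTI.
Qed.

(** One sandwich map per factor: the first factor of B acts first on x and stands leftmost in the
    weight. *)
Lemma spin_weak_solution (B : Cl R n) U f : is_vector_product B -> B != 0 ->
  open U -> weak_ndirac_solution U f ->
  open [set x | U (spin_map B x)] /\
  weak_ndirac_solution [set x | U (spin_map B x)] (fun x => B * f (spin_map B x)).
Proof.
move=> [s ->] + Uo wf; elim: s => [_|v s ih].
  have E x : spin_map (\prod_(w <- [::]) clvec w : Cl R n) x = x.
    by rewrite /spin_map big_nil clrev1 mul1r mulr1 clvecK.
  have -> : [set x | U (spin_map (\prod_(w <- [::]) clvec w) x)] = U.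
    by apply/seteqP; split=> x /=; rewrite E.
  split; first exact: Uo.
  by apply: (eq_weak_ndirac_solution Uo _ wf) => x _; rewrite E big_nil mul1r.
rewrite big_cons => vs0.
have v0 : v != 0 by apply: contraNneq vs0 => ->; rewrite clvec0 mul0r.
have /ih[So wS] : \prod_(w <- s) clvec w != 0 by apply: contraNneq vs0 => ->; rewrite mulr0.
have [U1o w1] := sandwich_weak_solution v0 So wS.
have -> : [set x | U (spin_map (clvec v * \prod_(w <- s) clvec w) x)] =
    [set x | [set x | U (spin_map (\prod_(w <- s) clvec w) x)] (sandwich v x)].
  by apply/seteqP; split=> x /=; rewrite spin_map_cons.
split; first exact: U1o.
by apply: (eq_weak_ndirac_solution U1o _ w1) => x _; rewrite spin_map_cons mulrA.
Qed.

Lemma inversion_weak_solution U f : (2 <= n)%N -> open U -> weak_ndirac_solution U f ->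
  open [set x | x != 0 /\ U (row_inv x)] /\
  weak_ndirac_solution [set x | x != 0 /\ U (row_inv x)]
    (fun x => (clvec x)^-1 * f (row_inv x)).
Proof.
move=> n2 Uo wf; have ct := conformal_inversion R n2; split.
  exact: (cc_preimage_open ct Uo).
exact: (conformal_weak_solution ct Uo wf).
Qed.

End WeakSolutions.

Theorem theorem1 (R : realType) (n : nat) (U : set 'rV[R]_n)
    (f : 'rV[R]_n -> Cl R n) (a b c d : Cl R n) :
  (3 <= n)%N ->
  domain U ->
  weak_ndirac_solution U f ->
  mobius_coefficients a b c d ->
  (forall x, closure (mobius_preimage a b c d U) x -> mobius_den c d x != 0) ->
  weak_ndirac_solution (mobius_preimage a b c d U) (mobius_pullback a b c d f).
Proof.
move=> n3 [Uo _ _] wf [[pa pb pc pd] [va vc vd vb] abcd] _.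
have n2 : (2 <= n)%N by exact: ltnW.
have [c0|c0] := eqVneq c 0.
  (* If c = 0, then rev(a) d = 1 gives a = rev(d)^-1, and M(x) = rev(d)^-1 x d^-1 + b d^-1 is a spin
     map followed by a translation. *)
  have rev0 : clrev (0 : Cl R n) = 0 by rewrite clrevE cltwist0.
  move: abcd; rewrite c0 rev0 mul0r subr0 => ad.
  have d0 : d != 0.
    by apply/negP => /eqP d0; move/eqP: ad; rewrite d0 mulr0 eq_sym oner_eq0.
  have [du pB] := vector_product_unit pd d0.
  have rd : clrev d^-1 * clrev d = 1 by rewrite -clrevM divrr// clrev1.
  have aE : a = clrev d^-1.
    have : clrev d * a = 1 by rewrite -[a]clrevK -clrevM ad clrev1.
    by move=> da; rewrite -[a]mul1r -rd -mulrA da mulr1.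
  (* As rev(d) b is a vector w, so is b d^-1 = rev(d)^-1 w d^-1. *)
  have [w wE] := vd.
  have bE : clvec (spin_map d^-1 w) = b * d^-1 by rewrite (spin_mapE _ pB) -wE !mulrA rd mul1r.
  have ME x : mobius a b 0 d x = clvec (spin_map d^-1 x + spin_map d^-1 w).
    by rewrite clvecD (spin_mapE x pB) bE /mobius /mobius_den mul0r add0r mulrDl aE.
  have [U1o w1] := translation_weak_solution (spin_map d^-1 w) Uo wf.
  have B0 : d^-1 != 0 by rewrite invr_eq0.
  have [U2o w2] := spin_weak_solution pB B0 U1o w1.
  have -> : mobius_preimage a b 0 d U =
      [set x | [set x | U (x + spin_map d^-1 w)] (spin_map d^-1 x)].
    apply/seteqP; split=> x /=; rewrite /mobius_preimage/= ME /mobius_den mul0r add0r.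
      by move=> [_ [y Uy /clvec_inj ->]].
    by move=> Ux; split=> //; eexists; first exact: Ux.
  apply: (eq_weak_ndirac_solution U2o _ w2) => x _.
  by rewrite /mobius_pullback ME clvecK /mobius_den mul0r add0r.
have [cu pB] := vector_product_unit pc c0.
have rc : clrev c^-1 * clrev c = 1 by rewrite -clrevM divrr// clrev1.
(* The vector rev(a) c equals its reversal rev(c) a, so a c^-1 = rev(c)^-1 w c^-1 is a vector: the
   final translation of M. *)
have [w wE] := va.
have ca : clrev c * a = clvec w by rewrite -[a]clrevK -clrevM wE clrev_vec.
have aE : clvec (spin_map c^-1 w) = a * c^-1 by rewrite (spin_mapE _ pB) -ca !mulrA rc mul1r.
have [k kE] := vector_product_rev pB.
have [w' w'E] := vc.
(* Since c^-1 rev(c)^-1 is the real number k and rev(c) d the vector w', c^-1 d = k w'. *)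
pose p := k *: w'.
have dE : d = c * clvec p.
  have <- : c^-1 * d = clvec p by rewrite clvecZ -w'E -mulr_algl -kE mulrA -(mulrA c^-1) rc mulr1.
  by rewrite mulrA divrr// mul1r.
have denE x : mobius_den c d x = c * clvec (x + p) by rewrite /mobius_den dE clvecD mulrDr.
(* Solve rev(a) d - rev(c) b = 1 for b, using d = c p and rev(a) c = rev(c) a. *)
have bE : b = a * clvec p - clrev c^-1.
  rewrite -[b]mul1r -rc -mulrA.
  have -> : clrev c * b = clrev a * d - 1 by rewrite -abcd opprB addrC subrK.
  by rewrite mulrBr mulr1 dE !mulrA -(mulrA _ (clrev a)) wE -ca !mulrA rc mul1r.
have ME x : x + p != 0 ->
    mobius a b c d x = clvec (spin_map c^-1 (row_inv (x + p)) + spin_map c^-1 w).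
  move=> xp0; have xu : clvec (x + p) \is a GRing.unit by rewrite clvec_unit.
  rewrite clvecD (spin_mapE (row_inv (x + p)) pB) aE /mobius denE (invrM cu xu).
  have -> : a * clvec x + b = a * clvec (x + p) - clrev c^-1.
    by rewrite bE clvecD mulrDr addrA.
  rewrite mulrA mulrBl mulrK// mulrBl addrC -mulNr; congr (_ * _ + _).
  by rewrite clvecV /row_inv !clvecZ scaleNr mulrN opprK.
(* The solution is pulled back through the factors of M from the outermost to the innermost; the
   weights accumulate on the left to (x + p)^-1 c^-1. *)
have [U1o w1] := translation_weak_solution (spin_map c^-1 w) Uo wf.
have B0 : c^-1 != 0 by rewrite invr_eq0.
have [U2o w2] := spin_weak_solution pB B0 U1o w1.
have [U3o w3] := inversion_weak_solution n2 U2o w2.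
have [U4o w4] := translation_weak_solution p U3o w3.
have den0 x : (mobius_den c d x != 0) = (x + p != 0).
  rewrite denE; congr (~~ _); apply/eqP/eqP => [cx0|->]; last by rewrite clvec0 mulr0.
  by apply: clvec_inj; rewrite clvec0 -[clvec _](mulKr cu) cx0 mulr0.
have -> : mobius_preimage a b c d U = [set x | [set x | x != 0 /\
    [set x | [set x | U (x + spin_map c^-1 w)] (spin_map c^-1 x)] (row_inv x)] (x + p)].
  apply/seteqP; split=> x /=; rewrite /mobius_preimage/= den0.
    by move=> [xp0 [y Uy]]; rewrite ME// => /clvec_inj ->.
  by move=> [xp0 Ux]; split=> //; eexists; [exact: Ux|exact: ME].
apply: (eq_weak_ndirac_solution U4o _ w4) => x [xp0 _].
by rewrite /mobius_pullback ME// clvecK denE invrM ?clvec_unit// !mulrA.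
Qed.
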